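(* Let $\sigma(t)=(\lambda_h(t),\Lambda_h(t))$ be the real-analytic parametrization of the separatrix described in the context and let $a_\pm=-\tfrac12\pm\tfrac{\sqrt2}2$. Then $q(t)=\cos\big(\tfrac{\lambda_h(t)}2\big)$ satisfies $q(t)\in[a_+,1)$ for $t\in\mathbb R$, $q(0)=a_+$, and $$\dot q^2=\frac3q(q-1)^2(q+1)(q-a_-)(q-a_+).$$ Moreover, with $A=\int_0^{a_+}\frac1{1-x}\sqrt{\frac{x}{3(x+1)(a_+-x)(x-a_-)}}\,dx$ and $\Pi_A=\{|\operatorname{Im}t|<A\}$: (i) $q$ extends analytically to $\Pi_A$; (ii) $q$ has only two singularities on $\partial\Pi_A$, at $t=\pm iA$; (iii) there exists $\nu>0$ such that for $|t-iA|<\nu$ and $\arg(t-iA)\in(-\tfrac{3\pi}2,\tfrac\pi2)$, $$q(t)=-\frac{3\alpha_+}2(t-iA)^{2/3}+\mathcal O\big((t-iA)^{4/3}\big),$$ with $\alpha_+\in\mathbb C$ such that $\alpha_+^3=\tfrac12$; analogously, for $|t+iA|<\nu$ and $\arg(t+iA)\in(-\tfrac\pi2,\tfrac{3\pi}2)$, $q(t)=-\frac{3\alpha_-}2(t+iA)^{2/3}+\mathcal O((t+iA)^{4/3})$ with $\alpha_-=\overline{\alpha_+}$.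
   Context: $H_{\mathrm{pend}}(\lambda,\Lambda)=-\tfrac32\Lambda^2+V(\lambda)$ with $V(\lambda)=1-\cos\lambda-\frac1{\sqrt{2+2\cos\lambda}}$, equations $\dot\lambda=-3\Lambda$, $\dot\Lambda=-V'(\lambda)$. $\sigma(t)=(\lambda_h(t),\Lambda_h(t))$ is the solution parametrizing the homoclinic orbit to the saddle $(0,0)$ with $\lambda\in(0,\pi)$ (energy level $H_{\mathrm{pend}}=-\tfrac12$), normalized by $\sigma(0)=(\lambda_0,0)$ with $\lambda_0\in(\tfrac23\pi,\pi)$. *)

(* Defs.v *)
From Stdlib Require Import Reals.
From Coquelicot Require Import Coquelicot.
Open Scope R_scope.

Definition Vpend (l : R) : R := 1 - cos l - / sqrt (2 + 2 * cos l).
Definition Hpend (l L : R) : R := - (3/2) * L ^ 2 + Vpend l.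

Definition a_plus : R := - (1/2) + sqrt 2 / 2.
Definition a_minus : R := - (1/2) - sqrt 2 / 2.

Definition A_integrand (x : R) : R :=
  / (1 - x) * sqrt (x / (3 * (x + 1) * (a_plus - x) * (x - a_minus))).

Definition holo (f : C -> C) (U : C -> Prop) : Prop :=
  forall z, U z -> @ex_derive C_AbsRing C_NormedModule f z.

Definition strip (A : R) (z : C) : Prop := Rabs (snd z) < A.

Definition cdisc (c : C) (r : R) (w : C) : Prop := Cmod (Cminus w c) < r.

Definition polar (c : C) (r th : R) : C := Cplus c (r * cos th, r * sin th).

Definition slit_disc (c : C) (nu th0 th1 : R) (w : C) : Prop :=
  exists r th, 0 < r < nu /\ th0 < th < th1 /\ w = polar c r th.

Definition regular_at (Q : C -> C) (A : R) (z : C) : Prop :=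
  exists r, 0 < r /\ exists g : C -> C, holo g (cdisc z r) /\
    forall w, cdisc z r w -> strip A w -> g w = Q w.

(* Near c, on the slit disc with arguments in (th0, th1), the analytic
   continuation g of Q satisfies
   g(t) = -(3 alpha/2) (t-c)^{2/3} + O((t-c)^{4/3}),
   where (t-c)^{2/3} = r^{2/3} e^{2 i th/3} for t - c = r e^{i th}. *)
Definition puiseux_at (Q : C -> C) (A : R) (c : C) (th0 th1 : R) (alpha : C)
  : Prop :=
  exists nu, 0 < nu /\ exists g : C -> C,
    holo g (slit_disc c nu th0 th1) /\
    (forall w, slit_disc c nu th0 th1 w -> strip A w -> g w = Q w) /\
    exists K, forall r th, 0 < r < nu -> th0 < th < th1 ->
      Cmod (Cplus (g (polar c r th))
              (Cmult (RtoC (3/2))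
                 (Cmult alpha (polar (RtoC 0) (Rpower r (2/3)) (2 * th / 3)))))
      <= K * Rpower r (4/3).

(* Main.v *)
(* With u defined by 1 - q = (1 - a_plus) / cosh (u / 2)^2, the equation for q becomes
   dt/du = W(u) = kap * sqrt (q / ((q + 1) (q - a_minus))), holomorphic on the strip |Im u| < pi/2
   cut along {iv : |v| >= v0}, where q is a nonpositive real.  This domain is star-shaped about 0, so
   W has a primitive t(u), with t(0) = 0; it is real on the real axis (the orbit) and maps
   ]-i v0, i v0[ onto ]-iA, iA[, which is the substitution giving the integral A.

   Since Re W > 0, t is injective on the right half of the domain.  Where Re u > 0 and Im u > 0 one
   also has Im W > 0, so Re t decreases and Im t increases with Im u.  Hence each level line
   Re t = x > 0 is a graph over Im u, and along it Im t passes A: by the intermediate value theorem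
   t reaches a strip slightly wider than |Im t| < A, cut along the vertical half-lines from iA
   and -iA.  The extension of q is q(u(t)) on that cut strip, so that it is regular at all the
   boundary points other than iA and -iA.

   Near iA, (q^(3/2))' = (3/2) sqrt q q' is bounded and tends to a constant; integrating it along
   the axis and then along arcs around iA gives the expansion of q^(3/2), whose cube root is
   identified by quadrants. *)

Require Import Defs.
From Stdlib Require Import Reals Lra Ranalysis5 ClassicalEpsilon.
From Coquelicot Require Import Coquelicot.
Open Scope R_scope.

(** * Complex derivatives *)

(** The square root of [q] changes sign across the removed half-lines. Along the right side of
    [{iv : v > v0}], [q] is a negative real and [dt/du] tends to a positive multiple of [i], so [t]
    runs horizontally from [iA] into [Re t < 0]; the left side is its mirror image. The images of
    the two halves of the domain thus overlap, and the inverse becomes single-valued only once the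
    half is prescribed: [Re u] must have the sign of [Re t]. The same crossing makes the widening of
    the strip uniform. At some height [y > v0] there is [x0 > 0] with [Re t <= 0]; at that height
    every point with [Re t > 0] lies to the right of [x0], where [Im t] exceeds [A] by a fixed
    amount. Holomorphy means complex differentiability and no integral formula is invoked: the
    primitive is differentiated under the integral sign, hence the requirement that [W] have a
    differentiable derivative, and the inverse is differentiated through a lower bound on
    [|t(u) - t(u0)|]. *)

Lemma Rmin_lt_l {x a b : R} : x < Rmin a b -> x < a.
Proof. intros H. exact (Rlt_le_trans _ _ _ H (Rmin_l a b)). Qed.

Lemma Rmin_lt_r {x a b : R} : x < Rmin a b -> x < b.
Proof. intros H. exact (Rlt_le_trans _ _ _ H (Rmin_r a b)). Qed.

Lemma exists_small {a b : R} : 0 < a -> 0 < b -> exists x, 0 < x < a /\ x < b.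
Proof.
intros Ha Hb. exists (Rmin (a / 2) (b / 2)). unfold Rmin. destruct (Rle_dec _ _); lra.
Qed.

(** The bound is non-strict, so it includes [w = z] and no quotient appears; the rules of calculus
    then reduce to the triangle inequality. *)
Definition cderiv (f : C -> C) (z l : C) : Prop :=
  forall eps : R, 0 < eps -> exists d : R, 0 < d /\
    forall w : C, Cmod (w - z)%C < d ->
      Cmod (f w - f z - l * (w - z))%C <= eps * Cmod (w - z)%C.

Lemma cderiv_is_derive (f : C -> C) (z l : C) :
  cderiv f z l <-> @is_derive C_AbsRing C_NormedModule f z l.
Proof.
split.
- intros H; split.
  + apply is_linear_scal_l.
  + intros x Hx eps.
    assert (E : x = z).
    { symmetry; apply (@is_filter_lim_locally_unique C_AbsRing (AbsRing_NormedModule C_AbsRing)); exact Hx. }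
    subst x.
    destruct (H eps (cond_pos eps)) as [d [d0 Hd]].
    exists (mkposreal d d0). intros w Hw.
    specialize (Hd w Hw).
    change (Cmod (f w - f z - (w - z) * l)%C <= eps * Cmod (w - z)%C).
    rewrite (Cmult_comm (w - z)%C l). exact Hd.
- intros [_ H] eps eps0.
  destruct (H z (fun P HP => HP) (mkposreal eps eps0)) as [d Hd].
  exists d; split; [apply cond_pos|]. intros w Hw.
  specialize (Hd w Hw).
  change (Cmod (f w - f z - (w - z) * l)%C <= eps * Cmod (w - z)%C) in Hd.
  rewrite (Cmult_comm l (w - z)%C). exact Hd.
Qed.

Lemma cderiv_lip (f : C -> C) (z l : C) :
  cderiv f z l -> exists d : R, 0 < d /\
    forall w : C, Cmod (w - z)%C < d -> Cmod (f w - f z)%C <= (Cmod l + 1) * Cmod (w - z)%C.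
Proof.
intros H. destruct (H 1 Rlt_0_1) as [d [d0 Hd]].
exists d; split; [exact d0|]. intros w Hw.
replace (f w - f z)%C with ((f w - f z - l * (w - z)) + l * (w - z))%C by ring.
eapply Rle_trans; [apply Cmod_triangle|]. rewrite Cmod_mult.
specialize (Hd w Hw). lra.
Qed.

Lemma cderiv_cont (f : C -> C) (z l : C) :
  cderiv f z l -> forall eps : R, 0 < eps -> exists d : R, 0 < d /\
    forall w : C, Cmod (w - z)%C < d -> Cmod (f w - f z)%C < eps.
Proof.
intros H eps e0. destruct (cderiv_lip f z l H) as [d [d0 Hd]].
pose proof (Cmod_ge_0 l) as Hl.
exists (Rmin d (eps / (Cmod l + 1))); split.
- apply Rmin_pos; [exact d0|]. apply Rdiv_lt_0_compat; lra.
- intros w Hw. eapply Rle_lt_trans.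
  + apply Hd. exact (Rmin_lt_l Hw).
  + assert (Cmod (w - z)%C < eps / (Cmod l + 1)) as H1.
    { exact (Rmin_lt_r Hw). }
    apply Rlt_div_r in H1; lra.
Qed.

Lemma cderiv_ext_loc (f g : C -> C) (z l : C) (r : R) :
  0 < r -> (forall w, Cmod (w - z)%C < r -> f w = g w) -> cderiv f z l -> cderiv g z l.
Proof.
intros r0 E H eps e0. destruct (H eps e0) as [d [d0 Hd]].
exists (Rmin d r); split; [apply Rmin_pos; assumption|].
intros w Hw.
rewrite <- (E w), <- (E z).
- apply Hd. exact (Rmin_lt_l Hw).
- replace (z - z)%C with (RtoC 0) by ring. rewrite Cmod_0. exact r0.
- exact (Rmin_lt_r Hw).
Qed.

Lemma cderiv_ext (f g : C -> C) (z l : C) :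
  (forall w, f w = g w) -> cderiv f z l -> cderiv g z l.
Proof. intros E; apply (cderiv_ext_loc f g z l 1 Rlt_0_1); intros; apply E. Qed.

Lemma cderiv_const (c z : C) : cderiv (fun _ => c) z 0.
Proof.
intros eps e0; exists 1; split; [lra|]. intros w _.
replace (c - c - 0 * (w - z))%C with (RtoC 0) by ring. rewrite Cmod_0.
pose proof (Cmod_ge_0 (w - z)%C). nra.
Qed.

Lemma cderiv_id (z : C) : cderiv (fun w => w) z 1.
Proof.
intros eps e0; exists 1; split; [lra|]. intros w _.
replace (w - z - 1 * (w - z))%C with (RtoC 0) by ring. rewrite Cmod_0.
pose proof (Cmod_ge_0 (w - z)%C). nra.
Qed.

Lemma cderiv_plus (f g : C -> C) (z l m : C) :
  cderiv f z l -> cderiv g z m -> cderiv (fun w => f w + g w)%C z (l + m)%C.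
Proof.
intros Hf Hg eps e0.
destruct (Hf (eps / 2)) as [d1 [d10 H1]]; [lra|].
destruct (Hg (eps / 2)) as [d2 [d20 H2]]; [lra|].
exists (Rmin d1 d2); split; [apply Rmin_pos; assumption|]. intros w Hw.
specialize (H1 w (Rmin_lt_l Hw)).
specialize (H2 w (Rmin_lt_r Hw)).
replace (f w + g w - (f z + g z) - (l + m) * (w - z))%C
  with ((f w - f z - l * (w - z)) + (g w - g z - m * (w - z)))%C by ring.
eapply Rle_trans; [apply Cmod_triangle|]. lra.
Qed.

Lemma cderiv_mult (f g : C -> C) (z l m : C) :
  cderiv f z l -> cderiv g z m ->
  cderiv (fun w => f w * g w)%C z (l * g z + f z * m)%C.
Proof.
intros Hf Hg eps e0.
pose proof (Cmod_ge_0 (f z)) as F0. pose proof (Cmod_ge_0 (g z)) as G0.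
pose proof (Cmod_ge_0 l) as L0.
(* Sum of the coefficients of the three terms into which the increment of the product is split
   below, each taken with tolerance [eps / K]. *)
assert (K0 : 0 < Cmod (f z) + Cmod (g z) + (Cmod l + 1)) by lra.
set (K := Cmod (f z) + Cmod (g z) + (Cmod l + 1)) in *.
assert (e1 : 0 < eps / K) by (apply Rdiv_lt_0_compat; lra).
destruct (Hf _ e1) as [d1 [d10 H1]].
destruct (Hg _ e1) as [d2 [d20 H2]].
destruct (cderiv_lip f z l Hf) as [d3 [d30 H3]].
destruct (cderiv_cont g z m Hg _ e1) as [d4 [d40 H4]].
exists (Rmin (Rmin d1 d2) (Rmin d3 d4)); split; [repeat apply Rmin_pos; assumption|].
intros w Hw.
assert (Hw12 := Rmin_lt_l Hw).
assert (Hw34 := Rmin_lt_r Hw).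
specialize (H1 w (Rmin_lt_l Hw12)).
specialize (H2 w (Rmin_lt_r Hw12)).
specialize (H3 w (Rmin_lt_l Hw34)).
specialize (H4 w (Rmin_lt_r Hw34)).
replace (f w * g w - f z * g z - (l * g z + f z * m) * (w - z))%C
  with ((f w - f z - l * (w - z)) * g z + f z * (g w - g z - m * (w - z))
        + (f w - f z) * (g w - g z))%C by ring.
eapply Rle_trans; [apply Cmod_triangle|].
eapply Rle_trans; [apply Rplus_le_compat_r, Cmod_triangle|].
rewrite !Cmod_mult.
pose proof (Cmod_ge_0 (w - z)%C) as W0.
pose proof (Cmod_ge_0 (g w - g z)%C) as G1.
replace (eps * Cmod (w - z)%C) with (eps / K * Cmod (w - z)%C * Cmod (g z)
  + Cmod (f z) * (eps / K * Cmod (w - z)%C) + (Cmod l + 1) * Cmod (w - z)%C * (eps / K))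
  by (unfold K; field; unfold K in K0; lra).
apply Rplus_le_compat; [apply Rplus_le_compat|].
- apply Rmult_le_compat_r; assumption.
- apply Rmult_le_compat_l; assumption.
- apply Rmult_le_compat; try apply Cmod_ge_0; [exact H3|lra].
Qed.

Lemma cderiv_comp (f g : C -> C) (z l m : C) :
  cderiv f (g z) l -> cderiv g z m -> cderiv (fun w => f (g w)) z (l * m)%C.
Proof.
intros Hf Hg eps e0.
pose proof (Cmod_ge_0 m) as M0. pose proof (Cmod_ge_0 l) as L0.
set (K := Cmod m + 1 + Cmod l).
assert (K0 : 0 < K) by (unfold K; lra).
assert (e1 : 0 < eps / K) by (apply Rdiv_lt_0_compat; lra).
destruct (Hf _ e1) as [d1 [d10 H1]].
destruct (Hg _ e1) as [d2 [d20 H2]].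
destruct (cderiv_lip g z m Hg) as [d3 [d30 H3]].
destruct (cderiv_cont g z m Hg _ d10) as [d4 [d40 H4]].
exists (Rmin d2 (Rmin d3 d4)); split; [repeat apply Rmin_pos; assumption|].
intros w Hw.
assert (Hw34 := Rmin_lt_r Hw).
specialize (H2 w (Rmin_lt_l Hw)).
specialize (H3 w (Rmin_lt_l Hw34)).
specialize (H4 w (Rmin_lt_r Hw34)).
specialize (H1 (g w) H4).
replace (f (g w) - f (g z) - l * m * (w - z))%C
  with ((f (g w) - f (g z) - l * (g w - g z)) + l * (g w - g z - m * (w - z)))%C by ring.
eapply Rle_trans; [apply Cmod_triangle|]. rewrite Cmod_mult.
pose proof (Cmod_ge_0 (w - z)%C) as W0.
replace (eps * Cmod (w - z)%C) with (eps / K * ((Cmod m + 1) * Cmod (w - z)%C)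
  + Cmod l * (eps / K * Cmod (w - z)%C)) by (unfold K; field; unfold K in K0; lra).
apply Rplus_le_compat.
- eapply Rle_trans; [exact H1|]. apply Rmult_le_compat_l; lra.
- apply Rmult_le_compat_l; assumption.
Qed.

Lemma Cmod_minus_sym (a b : C) : Cmod (a - b)%C = Cmod (b - a)%C.
Proof. rewrite <- Cmod_opp. f_equal. ring. Qed.

Lemma Cmod_minus_ge (a b : C) : Cmod a - Cmod (a - b)%C <= Cmod b.
Proof.
pose proof (Cmod_triangle (a - b)%C b) as H.
replace (a - b + b)%C with a in H by ring. lra.
Qed.

Lemma cderiv_Cinv (z : C) : z <> 0 -> cderiv Cinv z (- / (z * z))%C.
Proof.
intros z0 eps e0.
assert (P : 0 < Cmod z) by (apply Cmod_gt_0; exact z0).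
(* The remainder is [(w - z)^2 / (w z^2)]; the first radius gives [|w| > |z| / 2], the second then
   absorbs one factor [w - z]. *)
exists (Rmin (Cmod z / 2) (eps * Cmod z ^ 3 / 2)); split.
- apply Rmin_pos; [lra|]. apply Rdiv_lt_0_compat; [|lra].
  apply Rmult_lt_0_compat; [lra|]. apply pow_lt; exact P.
- intros w Hw.
  assert (H1 := Rmin_lt_l Hw).
  assert (H2 := Rmin_lt_r Hw).
  assert (Hw2 : Cmod z / 2 < Cmod w).
  { pose proof (Cmod_minus_ge z w) as H3. rewrite (Cmod_minus_sym z w) in H3. lra. }
  assert (w0 : w <> 0) by (apply Cmod_gt_0; lra).
  replace (/ w - / z - - / (z * z) * (w - z))%C
    with (((w - z) * (w - z)) / (w * (z * z)))%C by (field; split; assumption).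
  rewrite Cmod_div by (repeat apply Cmult_neq_0; assumption).
  rewrite !Cmod_mult.
  pose proof (Cmod_ge_0 (w - z)%C) as W0.
  apply Rle_div_l; [apply Rmult_lt_0_compat; nra|].
  assert (Cmod (w - z)%C <= eps * (Cmod w * (Cmod z * Cmod z))); [|nra].
  assert (eps * (Cmod z / 2 * (Cmod z * Cmod z)) <= eps * (Cmod w * (Cmod z * Cmod z))); [|nra].
  apply Rmult_le_compat_l; [lra|]. apply Rmult_le_compat_r; nra.
Qed.

Lemma cderiv_inv (f : C -> C) (z l : C) :
  f z <> 0 -> cderiv f z l -> cderiv (fun w => / f w)%C z (- / (f z * f z) * l)%C.
Proof. intros H Hf. apply (cderiv_comp Cinv f); [apply cderiv_Cinv; exact H|exact Hf]. Qed.

Lemma cderiv_scal (c : C) (f : C -> C) (z l : C) :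
  cderiv f z l -> cderiv (fun w => c * f w)%C z (c * l)%C.
Proof.
intros H. pose proof (cderiv_mult (fun _ => c) f z 0 l (cderiv_const c z) H) as H1.
replace (c * l)%C with (0 * f z + c * l)%C by ring. exact H1.
Qed.

Lemma cderiv_conj (f : C -> C) (z l : C) :
  cderiv f z l -> cderiv (fun w => Cconj (f (Cconj w))) (Cconj z) (Cconj l).
Proof.
intros H eps e0. destruct (H eps e0) as [d [d0 Hd]].
exists d; split; [exact d0|]. intros w Hw.
assert (E : Cmod (Cconj w - z)%C = Cmod (w - Cconj z)%C).
{ rewrite <- (Cmod_conj (w - Cconj z)%C), Cminus_conj, Cconj_conj. reflexivity. }
rewrite <- E in Hw |- *. specialize (Hd _ Hw).
rewrite <- (Cmod_conj (f (Cconj w) - f z - l * (Cconj w - z))%C) in Hd.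
rewrite !Cminus_conj, Cmult_conj, Cminus_conj, !Cconj_conj in Hd.
rewrite Cconj_conj. exact Hd.
Qed.

Lemma cderiv_opp_arg (f : C -> C) (z l : C) :
  cderiv f (- z)%C l -> cderiv (fun w => f (- w)%C) z (- l)%C.
Proof.
intros H. replace (- l)%C with (l * (-1 * 1))%C by ring.
apply (cderiv_comp f (fun w => - w)%C).
- exact H.
- apply (cderiv_ext (fun w => -1 * w)%C); [intros; ring|].
  apply cderiv_scal, cderiv_id.
Qed.

(** * Curves and mean value inequalities *)

(** Velocity of a plane curve, stated on coordinates so that the real mean value theorem applies to
    its projections. *)
Definition vderiv (g : R -> C) (s : R) (v : C) : Prop :=
  is_derive (fun x => Re (g x)) s (Re v) /\ is_derive (fun x => Im (g x)) s (Im v).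

Lemma is_derive_eps (f : R -> R) (s l : R) :
  is_derive f s l <->
  (forall eps, 0 < eps -> exists d, 0 < d /\ forall x, Rabs (x - s) < d ->
     Rabs (f x - f s - l * (x - s)) <= eps * Rabs (x - s)).
Proof.
split.
- intros [_ H] eps e0.
  destruct (H s (fun P HP => HP) (mkposreal eps e0)) as [d Hd].
  exists d; split; [apply cond_pos|]. intros x Hx.
  rewrite (Rmult_comm l). exact (Hd x Hx).
- intros H; split; [apply is_linear_scal_l|].
  intros x Hx eps.
  assert (E : x = s).
  { symmetry; apply (@is_filter_lim_locally_unique R_AbsRing R_NormedModule); exact Hx. }
  subst x. destruct (H eps (cond_pos eps)) as [d [d0 Hd]].
  exists (mkposreal d d0). intros w Hw. specialize (Hd w Hw).
  rewrite (Rmult_comm l) in Hd. exact Hd.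
Qed.

Lemma Im_le_Cmod (z : C) : Rabs (Im z) <= Cmod z.
Proof. eapply Rle_trans; [apply Rmax_r|apply (Rmax_Cmod z)]. Qed.

Lemma Cmod_le_Re_Im (z : C) : Cmod z <= Rabs (Re z) + Rabs (Im z).
Proof.
destruct z as [x y]. unfold Re, Im; simpl.
replace (x, y) with (RtoC x + Ci * RtoC y)%C
  by (unfold Ci, RtoC, Cmult, Cplus; simpl; f_equal; ring).
eapply Rle_trans; [apply Cmod_triangle|].
rewrite Cmod_mult, Cmod_Ci, !Cmod_R. lra.
Qed.

Lemma vderiv_eps (g : R -> C) (s : R) (v : C) :
  vderiv g s v <->
  (forall eps, 0 < eps -> exists d, 0 < d /\ forall x, Rabs (x - s) < d ->
     Cmod (g x - g s - v * RtoC (x - s))%C <= eps * Rabs (x - s)).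
Proof.
assert (E1 : forall x, Re (g x - g s - v * RtoC (x - s))%C
   = Re (g x) - Re (g s) - Re v * (x - s)).
{ intros x. unfold Re, Cminus, Cplus, Copp, Cmult, RtoC; simpl. ring. }
assert (E2 : forall x, Im (g x - g s - v * RtoC (x - s))%C
   = Im (g x) - Im (g s) - Im v * (x - s)).
{ intros x. unfold Im, Cminus, Cplus, Copp, Cmult, RtoC; simpl. ring. }
split.
- intros [H1 H2] eps e0.
  rewrite is_derive_eps in H1. rewrite is_derive_eps in H2.
  destruct (H1 (eps / 2)) as [d1 [d10 D1]]; [lra|].
  destruct (H2 (eps / 2)) as [d2 [d20 D2]]; [lra|].
  exists (Rmin d1 d2); split; [apply Rmin_pos; assumption|]. intros x Hx.
  specialize (D1 x (Rmin_lt_l Hx)).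
  specialize (D2 x (Rmin_lt_r Hx)).
  eapply Rle_trans; [apply Cmod_le_Re_Im|]. rewrite E1, E2. lra.
- intros H; split; apply is_derive_eps; intros eps e0;
    destruct (H eps e0) as [d [d0 D]]; exists d; (split; [exact d0|]);
    intros x Hx; specialize (D x Hx); (eapply Rle_trans; [|exact D]).
  + rewrite <- E1. apply re_le_Cmod.
  + rewrite <- E2. apply Im_le_Cmod.
Qed.

Lemma vderiv_comp (f : C -> C) (g : R -> C) (s : R) (l v : C) :
  cderiv f (g s) l -> vderiv g s v -> vderiv (fun x => f (g x)) s (l * v)%C.
Proof.
intros Hf Hg. apply vderiv_eps. intros eps e0.
pose proof (proj1 (vderiv_eps _ _ _) Hg) as Hg'.
pose proof (Cmod_ge_0 v) as M0. pose proof (Cmod_ge_0 l) as L0.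
set (K := Cmod v + 1 + Cmod l).
assert (K0 : 0 < K) by (unfold K; lra).
assert (e1 : 0 < eps / K) by (apply Rdiv_lt_0_compat; lra).
destruct (Hf _ e1) as [d1 [d10 H1]].
destruct (Hg' _ e1) as [d2 [d20 H2]].
destruct (Hg' 1 Rlt_0_1) as [d3 [d30 H3]].
set (d4 := d1 / (Cmod v + 1)).
assert (d40 : 0 < d4) by (apply Rdiv_lt_0_compat; lra).
exists (Rmin d2 (Rmin d3 d4)); split; [repeat apply Rmin_pos; assumption|].
intros x Hx.
assert (Hx34 := Rmin_lt_r Hx).
specialize (H2 x (Rmin_lt_l Hx)).
specialize (H3 x (Rmin_lt_l Hx34)).
assert (H4 := Rmin_lt_r Hx34).
assert (H5 : Cmod (g x - g s)%C <= (Cmod v + 1) * Rabs (x - s)).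
{ replace (g x - g s)%C with ((g x - g s - v * RtoC (x - s)) + v * RtoC (x - s))%C by ring.
  eapply Rle_trans; [apply Cmod_triangle|]. rewrite Cmod_mult, Cmod_R. lra. }
assert (H6 : Cmod (g x - g s)%C < d1).
{ eapply Rle_lt_trans; [exact H5|]. unfold d4 in H4.
  apply Rlt_div_r in H4; lra. }
specialize (H1 (g x) H6).
replace (f (g x) - f (g s) - l * v * RtoC (x - s))%C
  with ((f (g x) - f (g s) - l * (g x - g s)) + l * (g x - g s - v * RtoC (x - s)))%C by ring.
eapply Rle_trans; [apply Cmod_triangle|]. rewrite Cmod_mult.
replace (eps * Rabs (x - s)) with (eps / K * ((Cmod v + 1) * Rabs (x - s))
  + Cmod l * (eps / K * Rabs (x - s))) by (unfold K; field; unfold K in K0; lra).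
apply Rplus_le_compat.
- eapply Rle_trans; [exact H1|]. apply Rmult_le_compat_l; lra.
- apply Rmult_le_compat_l; assumption.
Qed.

Lemma vderiv_line (a d : C) (s : R) : vderiv (fun x => a + RtoC x * d)%C s d.
Proof.
split.
- apply (is_derive_ext (fun x => Re a + x * Re d)).
  + intros x. unfold Re, Cplus, Cmult, RtoC; simpl. ring.
  + auto_derive; [trivial|ring].
- apply (is_derive_ext (fun x => Im a + x * Im d)).
  + intros x. unfold Im, Cplus, Cmult, RtoC; simpl. ring.
  + auto_derive; [trivial|ring].
Qed.

Lemma is_derive_continuity_pt (f : R -> R) (x l : R) : is_derive f x l -> continuity_pt f x.
Proof.
intros H. apply derivable_continuous_pt. exists l. apply is_derive_Reals. exact H.
Qed.

Lemma vderiv_continuity (g : R -> C) (s : R) (v : C) :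
  vderiv g s v -> continuity_pt (fun x => Re (g x)) s /\ continuity_pt (fun x => Im (g x)) s.
Proof. intros [H1 H2]; split; eapply is_derive_continuity_pt; eassumption. Qed.

Lemma is_derive_lin2 (f g : R -> R) (s l m a b : R) :
  is_derive f s l -> is_derive g s m -> is_derive (fun x => a * f x + b * g x) s (a * l + b * m).
Proof.
intros Hf Hg.
exact (is_derive_plus _ _ _ _ _ (is_derive_scal f s a l Hf) (is_derive_scal g s b m Hg)).
Qed.

Lemma Re_conj_mult (e z : C) : Re (Cconj e * z)%C = Re e * Re z + Im e * Im z.
Proof. unfold Re, Im, Cconj, Cmult; simpl. ring. Qed.

(** The mean value theorem fails for plane curves but holds for their projection on a fixed
    direction: [Re (Cconj e * z)] is the scalar product of [e] and [z]. *)
Lemma curve_mvt (g g' : R -> C) (a b : R) (e : C) :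
  a < b ->
  (forall s, a < s < b -> vderiv g s (g' s)) ->
  (forall s, a <= s <= b ->
     continuity_pt (fun x => Re (g x)) s /\ continuity_pt (fun x => Im (g x)) s) ->
  exists c, a <= c <= b /\
    Re (Cconj e * (g b - g a))%C = Re (Cconj e * g' c)%C * (b - a).
Proof.
intros ab Hd Hc.
destruct (MVT_gen (fun x => Re e * Re (g x) + Im e * Im (g x)) a b
  (fun s => Re e * Re (g' s) + Im e * Im (g' s))) as [c [Hc1 Hc2]].
- rewrite Rmin_left, Rmax_right by lra. intros x Hx.
  destruct (Hd x Hx) as [H1 H2].
  apply is_derive_lin2; assumption.
- rewrite Rmin_left, Rmax_right by lra. intros x Hx.
  destruct (Hc x Hx) as [H1 H2].
  apply continuity_pt_plus; apply continuity_pt_mult; try assumption;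
    apply continuity_pt_const; intros u v; reflexivity.
- rewrite Rmin_left, Rmax_right in Hc1 by lra. exists c; split; [exact Hc1|].
  rewrite !Re_conj_mult, <- Hc2.
  unfold Re, Im, Cminus, Cplus, Copp; simpl. ring.
Qed.

Lemma Re_conj_self (z : C) : Re (Cconj z * z)%C = Cmod z ^ 2.
Proof. rewrite Re_conj_mult, Cmod2_alt. ring. Qed.

(** Projecting on the chord [g b - g a] itself gives the square of its length on the left;
    Cauchy-Schwarz bounds the right-hand side. *)
Lemma curve_mean_value (g g' : R -> C) (a b M : R) :
  a <= b ->
  (forall s, a < s < b -> vderiv g s (g' s)) ->
  (forall s, a <= s <= b ->
     continuity_pt (fun x => Re (g x)) s /\ continuity_pt (fun x => Im (g x)) s) ->
  (forall s, a <= s <= b -> Cmod (g' s) <= M) ->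
  Cmod (g b - g a)%C <= M * (b - a).
Proof.
intros ab Hd Hc HM. destruct ab as [ab|ab].
2:{ subst b. replace (g a - g a)%C with (RtoC 0) by ring. rewrite Cmod_0. lra. }
destruct (curve_mvt g g' a b (g b - g a)%C ab Hd Hc) as [c [Hc1 Hc2]].
rewrite Re_conj_self in Hc2.
specialize (HM c Hc1).
set (D := (g b - g a)%C) in *.
pose proof (Cmod_ge_0 D) as D0.
assert (H : Re (Cconj D * g' c)%C <= Cmod D * M).
{ eapply Rle_trans; [apply Rle_abs|]. eapply Rle_trans; [apply re_le_Cmod|].
  rewrite Cmod_mult, Cmod_conj. apply Rmult_le_compat_l; assumption. }
destruct D0 as [D0|D0].
- apply Rmult_le_reg_l with (Cmod D); [exact D0|].
  replace (Cmod D * Cmod D) with (Cmod D ^ 2) by ring. rewrite Hc2, <- Rmult_assoc.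
  apply Rmult_le_compat_r; lra.
- rewrite <- D0. pose proof (Cmod_ge_0 (g' c)). nra.
Qed.

Lemma segment_mean_value (f f' : C -> C) (a b : C) (M : R) :
  (forall s, 0 <= s <= 1 -> cderiv f (a + RtoC s * (b - a))%C (f' (a + RtoC s * (b - a))%C)) ->
  (forall s, 0 <= s <= 1 -> Cmod (f' (a + RtoC s * (b - a))%C) <= M) ->
  Cmod (f b - f a)%C <= M * Cmod (b - a)%C.
Proof.
intros Hd HM.
assert (V : forall s, 0 <= s <= 1 -> vderiv (fun x => f (a + RtoC x * (b - a))%C) s
   (f' (a + RtoC s * (b - a))%C * (b - a))%C).
{ intros s Hs. apply (vderiv_comp f); [apply Hd, Hs|apply vderiv_line]. }
pose proof (curve_mean_value (fun x => f (a + RtoC x * (b - a))%C)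
  (fun s => f' (a + RtoC s * (b - a))%C * (b - a))%C 0 1 (M * Cmod (b - a)%C)) as H.
replace (f b - f a)%C with (f (a + RtoC 1 * (b - a)) - f (a + RtoC 0 * (b - a)))%C
  by (f_equal; [|f_equal]; f_equal; ring).
eapply Rle_trans; [apply H|].
- lra.
- intros s Hs. apply V. lra.
- intros s Hs. eapply vderiv_continuity. apply V, Hs.
- intros s Hs. rewrite Cmod_mult. apply Rmult_le_compat_r; [apply Cmod_ge_0|]. apply HM, Hs.
- lra.
Qed.

(** The direction is left free: [e = b - a] serves univalence, [e = 1] and [e = Ci] separate real
    and imaginary parts. *)
Lemma segment_mvt (f f' : C -> C) (a b e : C) :
  (forall s, 0 <= s <= 1 -> cderiv f (a + RtoC s * (b - a))%C (f' (a + RtoC s * (b - a))%C)) ->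
  exists s, 0 <= s <= 1 /\
    Re (Cconj e * (f b - f a))%C = Re (Cconj e * (f' (a + RtoC s * (b - a))%C * (b - a)))%C.
Proof.
intros Hd.
assert (V : forall s, 0 <= s <= 1 -> vderiv (fun x => f (a + RtoC x * (b - a))%C) s
   (f' (a + RtoC s * (b - a))%C * (b - a))%C).
{ intros s Hs. apply (vderiv_comp f); [apply Hd, Hs|apply vderiv_line]. }
destruct (curve_mvt (fun x => f (a + RtoC x * (b - a))%C)
  (fun s => f' (a + RtoC s * (b - a))%C * (b - a))%C 0 1 e) as [c [Hc1 Hc2]].
- lra.
- intros s Hs. apply V. lra.
- intros s Hs. eapply vderiv_continuity. apply V, Hs.
- exists c; split; [exact Hc1|].
  replace (f b - f a)%C with (f (a + RtoC 1 * (b - a)) - f (a + RtoC 0 * (b - a)))%C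
    by (f_equal; [|f_equal]; f_equal; ring).
  rewrite Hc2. ring.
Qed.

Lemma vderiv_minus (f g : R -> C) (s : R) (u v : C) :
  vderiv f s u -> vderiv g s v -> vderiv (fun x => f x - g x)%C s (u - v)%C.
Proof.
intros [F1 F2] [G1 G2]; split.
- exact (is_derive_minus _ _ _ _ _ F1 G1).
- exact (is_derive_minus _ _ _ _ _ F2 G2).
Qed.

Lemma vderiv_mult (f g : R -> C) (s : R) (u v : C) :
  vderiv f s u -> vderiv g s v -> vderiv (fun x => f x * g x)%C s (u * g s + f s * v)%C.
Proof.
intros [F1 F2] [G1 G2].
assert (M : forall (a b : R -> R) l m, is_derive a s l -> is_derive b s m ->
  is_derive (fun x => a x * b x) s (l * b s + a s * m)).
{ intros a b l m Ha Hb. exact (is_derive_mult a b s l m Ha Hb Rmult_comm). }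
split.
- pose proof (is_derive_minus _ _ _ _ _ (M _ _ _ _ F1 G1) (M _ _ _ _ F2 G2)) as H.
  replace (Re (u * g s + f s * v)%C) with
    (Re u * Re (g s) + Re (f s) * Re v - (Im u * Im (g s) + Im (f s) * Im v))
    by (unfold Re, Im, Cplus, Cmult; simpl; ring).
  exact H.
- pose proof (is_derive_plus _ _ _ _ _ (M _ _ _ _ F1 G2) (M _ _ _ _ F2 G1)) as H.
  replace (Im (u * g s + f s * v)%C) with
    (Re u * Im (g s) + Re (f s) * Im v + (Im u * Re (g s) + Im (f s) * Re v))
    by (unfold Re, Im, Cplus, Cmult; simpl; ring).
  apply (is_derive_ext (fun x => Re (f x) * Im (g x) + Im (f x) * Re (g x))); [|exact H].
  intros t. unfold Re, Im, Cmult; simpl. ring.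
Qed.

Lemma vderiv_scal_line (v : C) (s : R) : vderiv (fun x => RtoC x * v)%C s v.
Proof.
destruct (vderiv_line 0 v s) as [H1 H2].
split; (eapply is_derive_ext; [|eassumption]); intros t; cbv beta; f_equal; ring.
Qed.

Lemma re_minus (a b : C) : Re (a - b)%C = Re a - Re b.
Proof. reflexivity. Qed.

Lemma im_minus (a b : C) : Im (a - b)%C = Im a - Im b.
Proof. reflexivity. Qed.

(** * Primitives on star-shaped domains *)

(** A Lebesgue number argument on the compact segment from 0 to [z]. *)
Lemma segment_uniform (z : C) (P : C -> C -> Prop) :
  (forall s, 0 <= s <= 1 -> exists d, 0 < d /\ forall v w,
     Cmod (v - RtoC s * z)%C < d -> Cmod (w - RtoC s * z)%C < d -> P v w) ->
  exists d, 0 < d /\ forall s w, 0 <= s <= 1 -> Cmod (w - RtoC s * z)%C < d ->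
     P (RtoC s * z)%C w.
Proof.
intros H.
pose proof (Cmod_ge_0 z) as z0.
(* The factor [2 (1 + |z|)] leaves room for both the displacement [|z| delta t] from [t z] to [s z]
   and the distance from [s z] to [w]. *)
assert (H' : forall s, exists d : posreal, 0 <= s <= 1 -> forall v w,
     Cmod (v - RtoC s * z)%C < 2 * (1 + Cmod z) * d ->
     Cmod (w - RtoC s * z)%C < 2 * (1 + Cmod z) * d -> P v w).
{ intros s. destruct (Rle_dec 0 s) as [h0|h0]; [destruct (Rle_dec s 1) as [h1|h1]|].
  - destruct (H s (conj h0 h1)) as [d [d0 Hd]].
    assert (p : 0 < d / (2 * (1 + Cmod z))) by (apply Rdiv_lt_0_compat; lra).
    exists (mkposreal _ p). intros _ v w Hv Hw. simpl in Hv, Hw.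
    replace (2 * (1 + Cmod z) * (d / (2 * (1 + Cmod z)))) with d in Hv, Hw by (field; lra).
    apply Hd; assumption.
  - exists (mkposreal 1 Rlt_0_1). lra.
  - exists (mkposreal 1 Rlt_0_1). lra. }
set (delta := fun s => proj1_sig (constructive_indefinite_description _ (H' s))).
assert (Hdelta : forall s, 0 <= s <= 1 -> forall v w,
     Cmod (v - RtoC s * z)%C < 2 * (1 + Cmod z) * delta s ->
     Cmod (w - RtoC s * z)%C < 2 * (1 + Cmod z) * delta s -> P v w).
{ intros s. exact (proj2_sig (constructive_indefinite_description _ (H' s))). }
destruct (compactness_value_1d 0 1 delta) as [d Hd].
exists d; split; [apply cond_pos|]. intros s w Hs Hw.
apply NNPP; intros N. apply (Hd s Hs). intros [t [Ht [Hst Hdt]]].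
apply N.
assert (E : Cmod (RtoC s * z - RtoC t * z)%C <= Cmod z * delta t).
{ replace (RtoC s * z - RtoC t * z)%C with (RtoC (s - t) * z)%C by (rewrite RtoC_minus; ring).
  rewrite Cmod_mult, Cmod_R, Rmult_comm. apply Rmult_le_compat_l; lra. }
pose proof (cond_pos (delta t)) as p.
apply (Hdelta t Ht).
- nra.
- replace (w - RtoC t * z)%C with ((w - RtoC s * z) + (RtoC s * z - RtoC t * z))%C by ring.
  eapply Rle_lt_trans; [apply Cmod_triangle|]. nra.
Qed.

Definition clamp (s : R) : R := Rmax 0 (Rmin 1 s).

Lemma clamp_bounds (s : R) : 0 <= clamp s <= 1.
Proof. unfold clamp, Rmax, Rmin. destruct (Rle_dec 1 s); destruct (Rle_dec 0 _); lra. Qed.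

Lemma clamp_id (s : R) : 0 <= s <= 1 -> clamp s = s.
Proof. intros H. unfold clamp, Rmax, Rmin. destruct (Rle_dec 1 s); destruct (Rle_dec 0 _); lra. Qed.

Lemma clamp_lip (s t : R) : Rabs (clamp s - clamp t) <= Rabs (s - t).
Proof.
unfold clamp, Rmax, Rmin, Rabs.
destruct (Rle_dec 1 s), (Rle_dec 1 t);
  repeat match goal with |- context [Rle_dec ?a ?b] => destruct (Rle_dec a b) end;
  repeat match goal with |- context [Rcase_abs ?a] => destruct (Rcase_abs a) end; lra.
Qed.

Lemma continuous_eps (f : R -> R) (x : R) :
  (forall eps, 0 < eps -> exists d, 0 < d /\ forall y, Rabs (y - x) < d -> Rabs (f y - f x) < eps) ->
  continuous f x.
Proof.
intros H P [e He]. destruct (H e (cond_pos e)) as [d [d0 Hd]].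
exists (mkposreal d d0). intros y Hy. apply He. apply Hd. exact Hy.
Qed.

(* The restriction of W to the ray from 0 to z, clamped outside the segment [0, z], is
   continuous on the whole line, so its integrals are differentiable also at the end points. *)
Definition ray_integrand (W : C -> C) (z : C) (s : R) : C := (W (RtoC (clamp s) * z) * z)%C.

Definition ray_integral (W : C -> C) (z : C) (s : R) : C :=
  (RInt (fun x => Re (ray_integrand W z x)) 0 s, RInt (fun x => Im (ray_integrand W z x)) 0 s).

Section Star.
Variables (U : C -> Prop) (W W1 : C -> C).
Hypothesis U_star : forall z s, U z -> 0 <= s <= 1 -> U (RtoC s * z)%C.
Hypothesis U_open : forall z, U z -> exists r, 0 < r /\ forall w, Cmod (w - z)%C < r -> U w.
Hypothesis W_deriv : forall z, U z -> cderiv W z (W1 z).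
Hypothesis W1_deriv : forall z, U z -> exists l, cderiv W1 z l.

Lemma ray_integrand_cont (z : C) (x : R) : U z ->
  continuous (fun x => Re (ray_integrand W z x)) x /\
  continuous (fun x => Im (ray_integrand W z x)) x.
Proof.
intros Uz.
assert (H : forall eps, 0 < eps -> exists d, 0 < d /\ forall y, Rabs (y - x) < d ->
   Cmod (ray_integrand W z y - ray_integrand W z x)%C < eps).
{ intros eps e0. pose proof (Cmod_ge_0 z) as z0.
  assert (e1 : 0 < eps / (Cmod z + 1)) by (apply Rdiv_lt_0_compat; lra).
  destruct (cderiv_cont W _ _ (W_deriv _ (U_star z (clamp x) Uz (clamp_bounds x))) _ e1)
    as [d [d0 Hd]].
  exists (d / (Cmod z + 1)); split; [apply Rdiv_lt_0_compat; lra|].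
  intros y Hy. unfold ray_integrand.
  replace (W (RtoC (clamp y) * z) * z - W (RtoC (clamp x) * z) * z)%C
    with ((W (RtoC (clamp y) * z) - W (RtoC (clamp x) * z)) * z)%C by ring.
  rewrite Cmod_mult.
  assert (H1 : Cmod (RtoC (clamp y) * z - RtoC (clamp x) * z)%C < d).
  { replace (RtoC (clamp y) * z - RtoC (clamp x) * z)%C
      with (RtoC (clamp y - clamp x) * z)%C by (rewrite RtoC_minus; ring).
    rewrite Cmod_mult, Cmod_R. apply Rlt_div_r in Hy; [|lra].
    pose proof (clamp_lip y x). pose proof (Rabs_pos (y - x)). nra. }
  specialize (Hd _ H1). apply Rlt_div_r in Hd; [|lra].
  pose proof (Cmod_ge_0 (W (RtoC (clamp y) * z) - W (RtoC (clamp x) * z))%C). nra. }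
split; apply continuous_eps; intros eps e0; destruct (H eps e0) as [d [d0 Hd]];
  exists d; (split; [exact d0|]); intros y Hy; (eapply Rle_lt_trans; [|apply (Hd y Hy)]).
- rewrite <- re_minus. apply re_le_Cmod.
- rewrite <- im_minus. apply Im_le_Cmod.
Qed.

Lemma ray_integral_deriv (z : C) (s : R) : U z ->
  vderiv (ray_integral W z) s (ray_integrand W z s).
Proof.
intros Uz.
assert (A : forall f : R -> R, (forall x, continuous f x) -> is_derive (fun x => RInt f 0 x) s (f s)).
{ intros f Hf. apply (is_derive_RInt f (fun x => RInt f 0 x) 0 s).
  - exists (mkposreal 1 Rlt_0_1). intros y _.
    apply (@RInt_correct R_CompleteNormedModule), (@ex_RInt_continuous R_CompleteNormedModule).
    intros t _. apply Hf.
  - apply Hf. }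
split.
- exact (A (fun x => Re (ray_integrand W z x)) (fun x => proj1 (ray_integrand_cont z x Uz))).
- exact (A (fun x => Im (ray_integrand W z x)) (fun x => proj2 (ray_integrand_cont z x Uz))).
Qed.

(** One radius for the whole segment, so that remainders can be estimated under the integral. *)
Lemma ray_uniform (z : C) (eps : R) : U z -> 0 < eps ->
  exists d, 0 < d /\ forall s w, 0 <= s <= 1 -> Cmod (w - RtoC s * z)%C < d ->
    U w /\ Cmod (W w - W (RtoC s * z))%C <= eps /\ Cmod (W1 w - W1 (RtoC s * z))%C <= eps.
Proof.
intros Uz e0.
apply (segment_uniform z (fun v w =>
  U w /\ Cmod (W w - W v)%C <= eps /\ Cmod (W1 w - W1 v)%C <= eps)).
intros s Hs. pose proof (U_star z s Uz Hs) as Us.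
destruct (U_open _ Us) as [r [r0 Hr]].
destruct (W1_deriv _ Us) as [l Hl].
destruct (cderiv_cont W _ _ (W_deriv _ Us) (eps / 2)) as [d1 [d10 H1]]; [lra|].
destruct (cderiv_cont W1 _ _ Hl (eps / 2)) as [d2 [d20 H2]]; [lra|].
exists (Rmin r (Rmin d1 d2)); split; [repeat apply Rmin_pos; assumption|].
intros v w Hv Hw.
assert (Hv' := Rmin_lt_r Hv).
assert (Hw' := Rmin_lt_r Hw).
split; [apply Hr; exact (Rmin_lt_l Hw)|].
assert (T : forall F : C -> C, Cmod (F v - F (RtoC s * z))%C < eps / 2 ->
  Cmod (F w - F (RtoC s * z))%C < eps / 2 -> Cmod (F w - F v)%C <= eps).
{ intros F F1 F2.
  replace (F w - F v)%C with ((F w - F (RtoC s * z)) + - (F v - F (RtoC s * z)))%C by ring.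
  eapply Rle_trans; [apply Cmod_triangle|]. rewrite Cmod_opp. lra. }
split.
- apply T; apply H1; eapply Rlt_le_trans; try eassumption; apply Rmin_l.
- apply T; apply H2; eapply Rlt_le_trans; try eassumption; apply Rmin_r.
Qed.

(** Differentiation under the integral sign: the [z]-derivative of [z W(s z)] is the [s]-derivative
    of [s W(s z)], whose integral over [[0, 1]] is [W z]. The remainder [g s] of the integrals up to
    [s] starts at 0 and has speed at most [eps |h|]. *)
Lemma ray_integral_cderiv (z : C) : U z -> cderiv (fun w => ray_integral W w 1) z (W z).
Proof.
intros Uz eps e0.
pose proof (Cmod_ge_0 z) as z0.
assert (e1 : 0 < eps / (Cmod z + 1)) by (apply Rdiv_lt_0_compat; lra).
set (e := eps / (Cmod z + 1)) in *.
destruct (ray_uniform z e Uz e1) as [d [d0 Hd]].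
exists d; split; [exact d0|]. intros w Hw.
set (h := (w - z)%C) in *.
assert (Ew : w = (z + h)%C) by (unfold h; ring).
assert (Uw : U w).
{ apply (Hd 1 w); [lra|]. replace (w - 1 * z)%C with h by (unfold h; ring). exact Hw. }
assert (Hsh : forall s s', 0 <= s <= 1 -> 0 <= s' <= 1 ->
   Cmod ((RtoC s * z + RtoC s' * (RtoC s * w - RtoC s * z)) - RtoC s * z)%C < d).
{ intros s s' Hs Hs'.
  replace ((RtoC s * z + RtoC s' * (RtoC s * w - RtoC s * z)) - RtoC s * z)%C
    with (RtoC (s' * s) * h)%C by (rewrite RtoC_mult; unfold h; ring).
  rewrite Cmod_mult, Cmod_R, Rabs_pos_eq by nra.
  pose proof (Cmod_ge_0 h).
  assert (s' * s <= 1) by nra. nra. }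
assert (Hs1 : forall s, 0 <= s <= 1 -> Cmod (RtoC s * w - RtoC s * z)%C < d).
{ intros s Hs. pose proof (Hsh s 1 Hs ltac:(lra)) as Q.
  replace (RtoC s * z + 1 * (RtoC s * w - RtoC s * z) - RtoC s * z)%C
    with (RtoC s * w - RtoC s * z)%C in Q by ring. exact Q. }
set (g := fun s => (ray_integral W w s - ray_integral W z s - RtoC s * h * W (RtoC s * z))%C).
set (g' := fun s => (W (RtoC s * w) * w - W (RtoC s * z) * z
   - (h * W (RtoC s * z) + RtoC s * h * (W1 (RtoC s * z) * z)))%C).
assert (Hg : forall s, 0 <= s <= 1 -> vderiv g s (g' s)).
{ intros s Hs.
  pose proof (ray_integral_deriv w s Uw) as A.
  pose proof (ray_integral_deriv z s Uz) as B.
  unfold ray_integrand in A, B. rewrite clamp_id in A, B by exact Hs.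
  assert (Us : U (RtoC s * z)%C) by (apply U_star; assumption).
  apply vderiv_minus; [apply vderiv_minus; assumption|].
  apply vderiv_mult; [apply vderiv_scal_line|].
  apply (vderiv_comp W); [apply W_deriv, Us|apply vderiv_scal_line]. }
assert (Hb : forall s, 0 <= s <= 1 -> Cmod (g' s) <= eps * Cmod h).
{ intros s Hs. unfold g'.
  set (a := (RtoC s * z)%C). set (b := (RtoC s * w)%C).
  destruct (Hd s b Hs (Hs1 s Hs)) as [_ [HA _]]. fold a in HA.
  (* First-order remainder of [W] at [a]: the function [W x - W1 a * x] has derivative
     [W1 x - W1 a], which is small on the tube. *)
  assert (HB : Cmod (W b - W1 a * b - (W a - W1 a * a))%C <= e * Cmod (b - a)%C).
  { apply (segment_mean_value (fun x => W x - W1 a * x)%C (fun x => W1 x - W1 a)%C).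
    - intros s' Hs'.
      destruct (Hd s _ Hs (Hsh s s' Hs Hs')) as [Ux _].
      apply (cderiv_ext (fun x => W x + (- W1 a) * x)%C); [intros; ring|].
      replace (W1 (a + RtoC s' * (b - a)) - W1 a)%C
        with (W1 (a + RtoC s' * (b - a)) + - W1 a * 1)%C by ring.
      apply cderiv_plus; [apply W_deriv, Ux|apply cderiv_scal, cderiv_id].
    - intros s' Hs'. apply (Hd s _ Hs (Hsh s s' Hs Hs')). }
  replace (W b * w - W a * z - (h * W a + RtoC s * h * (W1 a * z)))%C
    with ((W b - W1 a * b - (W a - W1 a * a)) * z + h * (W b - W a))%C
    by (unfold a, b; rewrite Ew; ring).
  eapply Rle_trans; [apply Cmod_triangle|]. rewrite !Cmod_mult.
  replace (b - a)%C with (RtoC s * h)%C in HB by (unfold a, b, h; ring).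
  rewrite Cmod_mult, Cmod_R, Rabs_pos_eq in HB by lra.
  replace (eps * Cmod h) with (e * Cmod h * Cmod z + Cmod h * e) by (unfold e; field; lra).
  pose proof (Cmod_ge_0 h).
  apply Rplus_le_compat; [|apply Rmult_le_compat_l; assumption].
  apply Rmult_le_compat_r; [exact z0|]. eapply Rle_trans; [exact HB|].
  apply Rmult_le_compat_l; nra. }
pose proof (curve_mean_value g g' 0 1 (eps * Cmod h) ltac:(lra)
  (fun s Hs => Hg s ltac:(lra))
  (fun s Hs => vderiv_continuity _ _ _ (Hg s Hs)) Hb) as M.
replace (eps * Cmod h * (1 - 0)) with (eps * Cmod h) in M by ring.
eapply Rle_trans; [|exact M]. apply Req_le. f_equal.
assert (Z : forall v, ray_integral W v 0 = RtoC 0).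
{ intros v. unfold ray_integral. rewrite !RInt_point. reflexivity. }
unfold g. rewrite !Z. replace (1 * z)%C with z by ring. ring.
Qed.

Lemma star_primitive : exists T : C -> C, T 0 = 0 /\ forall z, U z -> cderiv T z (W z).
Proof.
exists (fun w => ray_integral W w 1). split; [|exact ray_integral_cderiv].
assert (Z : forall x, ray_integrand W 0 x = RtoC 0).
{ intros x. unfold ray_integrand. ring. }
assert (Z' : forall p : C -> R, p (RtoC 0) = 0 -> RInt (fun x => p (ray_integrand W 0 x)) 0 1 = 0).
{ intros p Hp. rewrite (RInt_ext _ (fun _ => 0)) by (intros x _; rewrite Z; exact Hp).
  rewrite RInt_const. apply Rmult_0_r. }
unfold ray_integral. rewrite (Z' Re), (Z' Im) by reflexivity. reflexivity.
Qed.

End Star.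

(** * Elementary functions *)

Lemma C_eq (z w : C) : Re z = Re w -> Im z = Im w -> z = w.
Proof. intros H1 H2; apply injective_projections; assumption. Qed.

Definition cexp (z : C) : C := (exp (Re z) * cos (Im z), exp (Re z) * sin (Im z)).

Lemma cexp_plus (z w : C) : cexp (z + w)%C = (cexp z * cexp w)%C.
Proof.
apply C_eq; unfold cexp, Re, Im; simpl; rewrite exp_plus, ?cos_plus, ?sin_plus; ring.
Qed.

Lemma cexp_cderiv_0 : cderiv cexp 0 1.
Proof.
intros eps e0.
(* With [|w| < e] the four error terms below add up to at most [8 e |w|]. *)
set (e := Rmin 1 (eps / 12)).
assert (e1 : 0 < e) by (apply Rmin_pos; lra).
assert (e2 : e <= 1) by apply Rmin_l.
assert (e3 : e <= eps / 12) by apply Rmin_r.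
clearbody e.
assert (Hexp : is_derive exp 0 1)
  by (apply is_derive_Reals; pose proof (derivable_pt_lim_exp 0) as h; rewrite exp_0 in h; exact h).
assert (Hcos : is_derive cos 0 0)
  by (apply is_derive_Reals; pose proof (derivable_pt_lim_cos 0) as h; rewrite sin_0, Ropp_0 in h; exact h).
assert (Hsin : is_derive sin 0 1)
  by (apply is_derive_Reals; pose proof (derivable_pt_lim_sin 0) as h; rewrite cos_0 in h; exact h).
rewrite is_derive_eps in Hexp. rewrite is_derive_eps in Hcos. rewrite is_derive_eps in Hsin.
destruct (Hexp e e1) as [d1 [d10 H1]].
destruct (Hcos e e1) as [d2 [d20 H2]].
destruct (Hsin e e1) as [d3 [d30 H3]].
exists (Rmin e (Rmin d1 (Rmin d2 d3))); split; [repeat apply Rmin_pos; assumption|].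
intros w Hw. replace (w - 0)%C with w in * by ring.
assert (w0 := Rmin_lt_l Hw).
assert (w123 := Rmin_lt_r Hw).
assert (w1 := Rmin_lt_l w123).
assert (w23 := Rmin_lt_r w123).
assert (w2 := Rmin_lt_l w23).
assert (w3 := Rmin_lt_r w23).
pose proof (re_le_Cmod w) as Rw. pose proof (Im_le_Cmod w) as Iw.
set (x := Re w) in *. set (y := Im w) in *.
specialize (H1 x). specialize (H2 y). specialize (H3 y).
rewrite ?Rminus_0_r, ?exp_0, ?cos_0, ?sin_0, ?Rmult_1_l, ?Rmult_0_l, ?Rminus_0_r in *.
specialize (H1 ltac:(lra)). specialize (H2 ltac:(lra)). specialize (H3 ltac:(lra)).
set (m := Cmod w) in *.
assert (m0 : 0 <= m) by apply Cmod_ge_0.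
assert (K : forall a b c d, Rabs a <= c -> Rabs b <= d -> Rabs (a * b) <= c * d).
{ intros a b c d Ha Hb. rewrite Rabs_mult.
  apply Rmult_le_compat; try assumption; apply Rabs_pos. }
assert (Hc1 : Rabs (cos y) <= 1) by (apply Rabs_le, COS_bound).
assert (A1 : Rabs (exp x - 1) <= 2 * m).
{ replace (exp x - 1) with (exp x - 1 - x + x) by ring.
  eapply Rle_trans; [apply Rabs_triang|]. nra. }
assert (A2 : Rabs (sin y) <= 2 * m).
{ replace (sin y) with (sin y - y + y) by ring.
  eapply Rle_trans; [apply Rabs_triang|]. nra. }
eapply Rle_trans; [apply Cmod_le_Re_Im|].
assert (Er : Re (cexp w - cexp 0 - 1 * w)%C = (exp x - 1 - x) * cos y + (1 + x) * (cos y - 1)).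
{ unfold cexp, Cminus, Cplus, Copp, Cmult, Re, Im; simpl.
  rewrite exp_0, cos_0. fold (Re w) (Im w). fold x y. ring. }
assert (Ei : Im (cexp w - cexp 0 - 1 * w)%C = (exp x - 1) * sin y + (sin y - y)).
{ unfold cexp, Cminus, Cplus, Copp, Cmult, Re, Im; simpl.
  rewrite exp_0, sin_0. fold (Re w) (Im w). fold x y. ring. }
rewrite Er, Ei.
assert (B1 : Rabs ((exp x - 1 - x) * cos y) <= e * m * 1) by (apply K; nra).
assert (B2 : Rabs ((1 + x) * (cos y - 1)) <= 2 * (e * m)).
{ apply K; [|nra]. eapply Rle_trans; [apply Rabs_triang|]. rewrite Rabs_R1. lra. }
assert (B3 : Rabs ((exp x - 1) * sin y) <= 2 * m * (2 * m)) by (apply K; assumption).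
pose proof (Rabs_triang ((exp x - 1 - x) * cos y) ((1 + x) * (cos y - 1))).
pose proof (Rabs_triang ((exp x - 1) * sin y) (sin y - y)).
assert (m * m <= e * m) by nra. nra.
Qed.

Lemma cexp_cderiv (z : C) : cderiv cexp z (cexp z).
Proof.
apply (cderiv_ext (fun w => cexp z * cexp (w - z))%C).
{ intros w. rewrite <- cexp_plus. f_equal. ring. }
enough (H : cderiv (fun w => cexp z * cexp (w - z))%C z (cexp z * (1 * 1))%C).
{ replace (cexp z * (1 * 1))%C with (cexp z) in H by ring. exact H. }
apply cderiv_scal. apply (cderiv_comp cexp (fun w => w - z)%C).
- replace (z - z)%C with (RtoC 0) by ring. apply cexp_cderiv_0.
- replace (RtoC 1) with (1 + 0)%C by ring.
  apply (cderiv_plus (fun w => w) (fun _ => - z)%C); [apply cderiv_id|apply cderiv_const].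
Qed.

Definition ccosh (z : C) : C := (cosh (Re z) * cos (Im z), sinh (Re z) * sin (Im z)).
Definition csinh (z : C) : C := (sinh (Re z) * cos (Im z), cosh (Re z) * sin (Im z)).

Lemma ccosh_cderiv (z : C) : cderiv ccosh z (csinh z).
Proof.
apply (cderiv_ext (fun w => / 2 * (cexp w + cexp (- w)))%C).
{ intros w. apply C_eq; unfold ccosh, cexp, cosh, sinh, Cinv, Cmult, Cplus, Copp, Re, Im; simpl;
    rewrite cos_neg, sin_neg; field. }
replace (csinh z) with (/ 2 * (cexp z + - cexp (- z)))%C.
- apply cderiv_scal, cderiv_plus; [apply cexp_cderiv|].
  apply cderiv_opp_arg, cexp_cderiv.
- apply C_eq; unfold csinh, cexp, cosh, sinh, Cinv, Cmult, Cplus, Copp, Re, Im; simpl;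
    rewrite cos_neg, sin_neg; field.
Qed.

Lemma csinh_cderiv (z : C) : cderiv csinh z (ccosh z).
Proof.
apply (cderiv_ext (fun w => / 2 * (cexp w + -1 * cexp (- w)))%C).
{ intros w. apply C_eq; unfold csinh, cexp, cosh, sinh, Cinv, Cmult, Cplus, Copp, Re, Im; simpl;
    rewrite cos_neg, sin_neg; field. }
replace (ccosh z) with (/ 2 * (cexp z + -1 * - cexp (- z)))%C.
- apply cderiv_scal, cderiv_plus; [apply cexp_cderiv|].
  apply cderiv_scal, cderiv_opp_arg, cexp_cderiv.
- apply C_eq; unfold ccosh, cexp, cosh, sinh, Cinv, Cmult, Cplus, Copp, Re, Im; simpl;
    rewrite cos_neg, sin_neg; field.
Qed.

Lemma cosh2_sinh2 (x : R) : cosh x ^ 2 - sinh x ^ 2 = 1.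
Proof.
unfold cosh, sinh.
assert (exp x * exp (- x) = 1) by (rewrite <- exp_plus, Rplus_opp_r; apply exp_0). nra.
Qed.

Lemma sinh_pos (x : R) : 0 < x -> 0 < sinh x.
Proof. intros H. unfold sinh. assert (exp (- x) < exp x) by (apply exp_increasing; lra). lra. Qed.

Lemma sinh_odd (x : R) : sinh (- x) = - sinh x.
Proof. unfold sinh. rewrite Ropp_involutive. field. Qed.

Lemma cosh_even (x : R) : cosh (- x) = cosh x.
Proof. unfold cosh. rewrite Ropp_involutive. field. Qed.

Lemma cosh_ge_1 (x : R) : 1 <= cosh x.
Proof.
assert (0 < cosh x) by (unfold cosh; pose proof (exp_pos x); pose proof (exp_pos (- x)); lra).
pose proof (cosh2_sinh2 x). pose proof (pow2_ge_0 (sinh x)). nra.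
Qed.

(** * The principal square root on the plane without the nonpositive reals *)

Definition slit (z : C) : Prop := 0 < Re z \/ Im z <> 0.

(** The real part is given by the half-angle formula, the imaginary part by [2 Re Im = Im z]. *)
Definition csqrt (z : C) : C :=
  let x := sqrt ((Cmod z + Re z) / 2) in (x, Im z / (2 * x)).

Lemma slit_mod (z : C) : slit z -> 0 < Cmod z + Re z.
Proof.
intros H. pose proof (Cmod_ge_0 z) as M. pose proof (Cmod2_alt z) as E.
destruct H as [H|H]; [lra|].
assert (0 < Im z ^ 2) by (apply pow2_gt_0; exact H). nra.
Qed.

Lemma csqrt_Re (z : C) : slit z -> 0 < Re (csqrt z).
Proof. intros H. apply sqrt_lt_R0. pose proof (slit_mod z H). lra. Qed.

Lemma csqrt_sqr (z : C) : slit z -> (csqrt z * csqrt z)%C = z.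
Proof.
intros H. pose proof (slit_mod z H) as M. pose proof (csqrt_Re z H) as P.
pose proof (Cmod2_alt z) as E.
assert (S : Re (csqrt z) * Re (csqrt z) = (Cmod z + Re z) / 2) by (apply sqrt_sqrt; lra).
assert (I : Im (csqrt z) = Im z / (2 * Re (csqrt z))) by reflexivity.
apply C_eq.
- rewrite re_mult. rewrite I.
  replace (Im z / (2 * Re (csqrt z)) * (Im z / (2 * Re (csqrt z))))
    with (Im z ^ 2 / (4 * (Re (csqrt z) * Re (csqrt z)))) by (field; lra).
  rewrite S. replace (Im z ^ 2) with ((Cmod z + Re z) * (Cmod z - Re z)) by lra.
  field. lra.
- rewrite im_mult, I. field. lra.
Qed.

(** The two square roots are opposite, so a positive real part singles out the principal one. *)
Lemma csqrt_unique (z w : C) : 0 < Re w -> (w * w)%C = z -> slit z /\ csqrt z = w.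
Proof.
intros Hw E.
assert (S : slit z).
{ subst z. unfold slit. rewrite re_mult, im_mult.
  destruct (Req_dec (Im w) 0) as [h|h]; [left; rewrite h; nra|right].
  replace (Re w * Im w + Im w * Re w) with (2 * Re w * Im w) by ring.
  apply Rmult_integral_contrapositive; split; lra. }
split; [exact S|].
pose proof (csqrt_Re z S) as P. pose proof (csqrt_sqr z S) as Q.
set (v := csqrt z) in *.
assert (F : ((v - w) * (v + w))%C = RtoC 0).
{ replace ((v - w) * (v + w))%C with (v * v - w * w)%C by ring. rewrite Q, E. ring. }
destruct (Ceq_dec (v - w)%C 0) as [h|h].
- apply Ceq_minus. exact h.
- exfalso. assert (h' : (v + w)%C <> RtoC 0).
  { intros h'. apply (f_equal Re) in h'. rewrite re_plus, re_RtoC in h'. lra. }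
  exact (Cmult_neq_0 _ _ h h' F).
Qed.

Lemma csqrt_pos (x : R) : 0 < x -> csqrt (RtoC x) = RtoC (sqrt x).
Proof.
intros H. apply csqrt_unique; [apply sqrt_lt_R0, H|].
rewrite <- RtoC_mult, sqrt_sqrt by lra. reflexivity.
Qed.

Lemma slit_conj (z : C) : slit z -> slit (Cconj z).
Proof. unfold slit. rewrite re_conj, im_conj. intros [H|H]; [left|right]; lra. Qed.

Lemma csqrt_conj (z : C) : slit z -> csqrt (Cconj z) = Cconj (csqrt z).
Proof.
intros H. apply csqrt_unique.
- rewrite re_conj. apply csqrt_Re, H.
- rewrite <- Cmult_conj, csqrt_sqr by exact H. reflexivity.
Qed.

Lemma csqrt_Im_nonneg (z : C) : slit z -> 0 <= Im z -> 0 <= Im (csqrt z).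
Proof.
intros S H. pose proof (csqrt_Re z S) as P.
change (Im (csqrt z)) with (Im z / (2 * Re (csqrt z))).
apply Rdiv_le_0_compat; lra.
Qed.

Lemma slit_open (z : C) : slit z -> exists r, 0 < r /\ forall w, Cmod (w - z)%C < r -> slit w.
Proof.
intros [H|H].
- exists (Re z); split; [exact H|]. intros w Hw. left.
  pose proof (re_le_Cmod (w - z)%C) as Q. rewrite re_minus in Q.
  apply Rabs_le_between in Q. lra.
- exists (Rabs (Im z)); split; [apply Rabs_pos_lt, H|]. intros w Hw. right.
  pose proof (Im_le_Cmod (w - z)%C) as Q. rewrite im_minus in Q.
  intros E. rewrite E in Q. replace (0 - Im z) with (- Im z) in Q by ring.
  rewrite Rabs_Ropp in Q. lra.
Qed.

Lemma Re_pos_neq_0 (z : C) : 0 < Re z -> z <> 0.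
Proof. intros H E. rewrite E in H. unfold Re in H; simpl in H. lra. Qed.

Lemma csqrt_neq_0 (z : C) : slit z -> csqrt z <> 0.
Proof. intros H. apply Re_pos_neq_0, csqrt_Re, H. Qed.

Lemma csqrt_cderiv (z : C) : slit z -> cderiv csqrt z (/ (2 * csqrt z))%C.
Proof.
intros S eps e0. pose proof (csqrt_Re z S) as P.
destruct (slit_open z S) as [r [r0 Hr]].
set (p := Re (csqrt z)) in *.
(* With [a], [b] the roots of [z], [w], the remainder is [-(w - z)^2 / (2 a (b + a)^2)]; both roots
   have positive real part, so the denominator is at least [p ^ 3] in modulus. *)
exists (Rmin r (eps * p ^ 3)); split.
{ apply Rmin_pos; [exact r0|]. apply Rmult_lt_0_compat; [exact e0|]. apply pow_lt; exact P. }
intros w Hw.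
assert (Sw := Hr w (Rmin_lt_l Hw)).
assert (H2 := Rmin_lt_r Hw).
pose proof (csqrt_Re w Sw) as Pw.
pose proof (csqrt_sqr z S) as Q. pose proof (csqrt_sqr w Sw) as Qw.
assert (R1 : csqrt z <> 0) by (apply csqrt_neq_0, S).
set (a := csqrt z) in *. set (b := csqrt w) in *.
assert (Hs : p < Re (b + a)%C) by (rewrite re_plus; unfold p; lra).
assert (R2 : (b + a)%C <> 0) by (apply Re_pos_neq_0; lra).
assert (E : (b - a - / (2 * a) * (w - z))%C
   = (- ((w - z) * (w - z)) / (2 * a * ((b + a) * (b + a))))%C).
{ rewrite <- Q, <- Qw. field. split; assumption. }
rewrite E. rewrite Cmod_div, Cmod_opp, !Cmod_mult, Cmod_R, Rabs_pos_eq by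
  (try lra; repeat apply Cmult_neq_0; try assumption; apply Re_pos_neq_0; simpl; lra).
assert (M1 : p <= Cmod a).
{ eapply Rle_trans; [apply Rle_abs|apply re_le_Cmod]. }
assert (M2 : p <= Cmod (b + a)%C).
{ eapply Rle_trans; [apply Rlt_le, Hs|]. eapply Rle_trans; [apply Rle_abs|apply re_le_Cmod]. }
pose proof (Cmod_ge_0 (w - z)%C) as D0.
set (d := Cmod (w - z)%C) in *. set (A := Cmod a) in *. set (B := Cmod (b + a)%C) in *.
assert (BB : p * p <= B * B) by nra.
assert (K : p ^ 3 <= 2 * A * (B * B)).
{ replace (p ^ 3) with (p * (p * p)) by ring.
  assert (p * (p * p) <= A * (B * B)) by (apply Rmult_le_compat; nra). nra. }
apply Rle_div_l; [pose proof (pow_lt p 3 P); lra|].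
assert (d * d <= eps * d * p ^ 3) by nra.
assert (eps * d * p ^ 3 <= eps * d * (2 * A * (B * B))) by (apply Rmult_le_compat_l; nra).
lra.
Qed.

(** * The complex time as a function of the coordinate [u] *)

(** The regularity that the construction of primitives asks of its integrand; the closure rules
    below let it be checked along the formula of [dtdu]. *)
Definition twice_cderiv (U : C -> Prop) (f : C -> C) : Prop :=
  exists f1, forall z, U z -> cderiv f z (f1 z) /\ exists l, cderiv f1 z l.

Lemma twice_const (U : C -> Prop) (c : C) : twice_cderiv U (fun _ => c).
Proof.
exists (fun _ => RtoC 0). intros z _. split; [apply cderiv_const|]. exists (RtoC 0). apply cderiv_const.
Qed.

Lemma twice_plus (U : C -> Prop) (f g : C -> C) :
  twice_cderiv U f -> twice_cderiv U g -> twice_cderiv U (fun z => f z + g z)%C.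
Proof.
intros [f1 F] [g1 G]. exists (fun z => f1 z + g1 z)%C. intros z Uz.
destruct (F z Uz) as [F1 [l Fl]], (G z Uz) as [G1 [m Gm]].
split; [apply cderiv_plus; assumption|]. eexists. apply cderiv_plus; eassumption.
Qed.

Lemma twice_mult (U : C -> Prop) (f g : C -> C) :
  twice_cderiv U f -> twice_cderiv U g -> twice_cderiv U (fun z => f z * g z)%C.
Proof.
intros [f1 F] [g1 G]. exists (fun z => f1 z * g z + f z * g1 z)%C. intros z Uz.
destruct (F z Uz) as [F1 [l Fl]], (G z Uz) as [G1 [m Gm]].
split; [apply cderiv_mult; assumption|].
eexists. apply cderiv_plus; apply cderiv_mult; eassumption.
Qed.

Lemma twice_inv (U : C -> Prop) (f : C -> C) :
  (forall z, U z -> f z <> 0) -> twice_cderiv U f -> twice_cderiv U (fun z => / f z)%C.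
Proof.
intros N [f1 F]. exists (fun z => - / (f z * f z) * f1 z)%C. intros z Uz.
destruct (F z Uz) as [F1 [l Fl]]. pose proof (N z Uz) as Nz.
split; [apply cderiv_inv; assumption|].
assert (E : exists m, cderiv (fun z => / (f z * f z) * f1 z)%C z m).
{ eexists. apply cderiv_mult; [|eassumption].
  apply (cderiv_inv (fun z => f z * f z)%C); [apply Cmult_neq_0; assumption|].
  apply cderiv_mult; eassumption. }
destruct E as [m Hm]. exists (-1 * m)%C.
apply (cderiv_ext (fun z => -1 * (/ (f z * f z) * f1 z))%C); [intros w; ring|].
apply cderiv_scal, Hm.
Qed.

Lemma twice_csqrt (U : C -> Prop) (f : C -> C) :
  (forall z, U z -> slit (f z)) -> twice_cderiv U f -> twice_cderiv U (fun z => csqrt (f z)).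
Proof.
intros N [f1 F]. exists (fun z => / (2 * csqrt (f z)) * f1 z)%C. intros z Uz.
destruct (F z Uz) as [F1 [l Fl]]. pose proof (N z Uz) as Nz.
assert (S : cderiv (fun w => csqrt (f w)) z (/ (2 * csqrt (f z)) * f1 z)%C).
{ apply (cderiv_comp csqrt f); [apply csqrt_cderiv, Nz|exact F1]. }
split; [exact S|].
eexists. apply cderiv_mult; [|eassumption].
apply (cderiv_inv (fun w => 2 * csqrt (f w))%C).
- apply Cmult_neq_0; [apply Re_pos_neq_0; simpl; lra|apply csqrt_neq_0, Nz].
- apply cderiv_scal, S.
Qed.

Lemma twice_ccosh (U : C -> Prop) : twice_cderiv U ccosh.
Proof.
exists csinh. intros z _. split; [apply ccosh_cderiv|]. exists (ccosh z). apply csinh_cderiv.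
Qed.

Lemma Re_mult_inv (z w : C) : w <> 0 -> Re (z * / w)%C = Re (Cconj w * z)%C / Cmod w ^ 2.
Proof.
intros H. assert (P : Re w ^ 2 + Im w ^ 2 <> 0).
{ rewrite <- Cmod2_alt. apply pow_nonzero. intros E. apply H, Cmod_eq_0, E. }
rewrite Cmod2_alt. unfold Cinv, Cmult, Cconj, Re, Im in *; simpl in *. field.
intros E; apply P. lra.
Qed.

Lemma Im_mult_inv (z w : C) : w <> 0 -> Im (z * / w)%C = Im (Cconj w * z)%C / Cmod w ^ 2.
Proof.
intros H. assert (P : Re w ^ 2 + Im w ^ 2 <> 0).
{ rewrite <- Cmod2_alt. apply pow_nonzero. intros E. apply H, Cmod_eq_0, E. }
rewrite Cmod2_alt. unfold Cinv, Cmult, Cconj, Re, Im in *; simpl in *. field.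
intros E; apply P. lra.
Qed.

(** * Constants, the coordinate [u] and its domain *)

Lemma a_plus_root : a_plus ^ 2 + a_plus = 1 / 4.
Proof. unfold a_plus. pose proof (sqrt_sqrt 2 ltac:(lra)). nra. Qed.

Lemma a_plus_pos : 0 < a_plus.
Proof. unfold a_plus. assert (1 < sqrt 2) by (rewrite <- sqrt_1 at 1; apply sqrt_lt_1; lra). lra. Qed.

(** Together with [a_plus_root], these bounds stand for [sqrt 2] in the later estimates. *)
Lemma a_plus_bounds : 1 / 5 < a_plus < 21 / 100.
Proof. pose proof a_plus_root. pose proof a_plus_pos. split; nra. Qed.

Lemma a_minus_eq : a_minus = - 1 - a_plus.
Proof. unfold a_minus, a_plus. lra. Qed.

(** Since [(dq/du)^2 = (1 - q)^2 (q - a_plus) / (1 - a_plus)], division by the expression of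
    [(dq/dt)^2] leaves [(dt/du)^2 = kap^2 q / ((q + 1) (q - a_minus))]. *)
Definition kap : R := / sqrt (3 * (1 - a_plus)).

Lemma kap_pos : 0 < kap.
Proof. pose proof a_plus_bounds. apply Rinv_0_lt_compat, sqrt_lt_R0. lra. Qed.

Lemma kap_sqr : kap ^ 2 = / (3 * (1 - a_plus)).
Proof. pose proof a_plus_bounds. unfold kap. rewrite pow_inv. rewrite pow2_sqrt by lra. reflexivity. Qed.

(* [q] in the coordinate [u] with [1 - q = (1 - a_plus) / cosh (u / 2) ^ 2]: it resolves the
   square root of [q - a_plus], and [dt/du] stays bounded as [q] tends to 1. *)
Definition qu (u : C) : C := (1 - RtoC (2 * (1 - a_plus)) * / (1 + ccosh u))%C.

(** On the imaginary axis [q = 1 - 2 (1 - a_plus) / (1 + cos v)], which vanishes exactly when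
    [cos v = 1 - 2 a_plus]. *)
Definition v0 : R := acos (1 - 2 * a_plus).

Lemma cos_v0 : cos v0 = 1 - 2 * a_plus.
Proof. pose proof a_plus_bounds. apply cos_acos. lra. Qed.

Lemma v0_bounds : 0 < v0 < PI / 2.
Proof.
pose proof a_plus_bounds. pose proof cos_v0 as E. pose proof PI_RGT_0.
pose proof (acos_bound (1 - 2 * a_plus)) as [B1 B2]. fold v0 in B1, B2.
split.
- destruct B1 as [B1|B1]; [exact B1|]. rewrite <- B1, cos_0 in E. lra.
- destruct (Rlt_le_dec v0 (PI / 2)) as [h|h]; [exact h|].
  pose proof (cos_le_0 v0 h ltac:(lra)). lra.
Qed.

Lemma cos_gt_v0 (y : R) : Rabs y < v0 -> 1 - 2 * a_plus < cos y.
Proof.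
intros H. rewrite <- cos_v0. pose proof v0_bounds. pose proof (Rabs_pos y).
replace (cos y) with (cos (Rabs y)) by (unfold Rabs; destruct (Rcase_abs y); rewrite ?cos_neg; reflexivity).
apply cos_decreasing_1; lra.
Qed.

(** Horizontal strip of half-width [a] slit along the imaginary axis from height [b] on. The same
    shape describes the domain of [u] and the range of [t]. *)
Definition cut (a b : R) (z : C) : Prop := Rabs (Im z) < a /\ (Re z <> 0 \/ Rabs (Im z) < b).

Lemma cut_open (a b : R) (z : C) : cut a b z ->
  exists r, 0 < r /\ forall w, Cmod (w - z)%C < r -> cut a b w.
Proof.
intros [H H0].
assert (K : exists r, 0 < r /\ forall w, Cmod (w - z)%C < r -> Re w <> 0 \/ Rabs (Im w) < b).
{ destruct H0 as [H0|H0].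
  - exists (Rabs (Re z)); split; [apply Rabs_pos_lt, H0|]. intros w Hw. left. intros E.
    pose proof (re_le_Cmod (w - z)%C) as Q. rewrite re_minus, E in Q.
    replace (0 - Re z) with (- Re z) in Q by ring. rewrite Rabs_Ropp in Q. lra.
  - exists (b - Rabs (Im z)); split; [lra|]. intros w Hw. right.
    pose proof (Im_le_Cmod (w - z)%C) as Q. rewrite im_minus in Q.
    pose proof (Rabs_triang_inv (Im w) (Im z)). lra. }
destruct K as [r [r0 Hr]].
exists (Rmin r (a - Rabs (Im z))); split; [apply Rmin_pos; lra|].
intros w Hw. split.
- pose proof (Im_le_Cmod (w - z)%C) as Q. rewrite im_minus in Q.
  pose proof (Rabs_triang_inv (Im w) (Im z)).
  pose proof (Rmin_lt_r Hw). lra.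
- apply Hr. exact (Rmin_lt_l Hw).
Qed.

Lemma cut_opp (a b : R) (z : C) : cut a b z -> cut a b (- z)%C.
Proof.
unfold cut. rewrite re_opp, im_opp, Rabs_Ropp. intros [H [H0|H0]]; (split; [exact H|]).
- left. lra.
- right. exact H0.
Qed.

Lemma cut_conj (a b : R) (z : C) : cut a b z -> cut a b (Cconj z).
Proof. unfold cut. rewrite re_conj, im_conj, Rabs_Ropp. trivial. Qed.

Definition dom : C -> Prop := cut (PI / 2) v0.

Lemma Re_ccosh_pos (u : C) : Rabs (Im u) < PI / 2 -> 0 < Re (ccosh u).
Proof.
intros H. apply Rabs_lt_between in H. simpl.
apply Rmult_lt_0_compat; [pose proof (cosh_ge_1 (fst u)); unfold Re in *; lra|].
apply cos_gt_0; apply H.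
Qed.

Lemma one_ccosh_neq_0 (u : C) : Rabs (Im u) < PI / 2 -> (1 + ccosh u)%C <> 0.
Proof. intros H. apply Re_pos_neq_0. rewrite re_plus, re_RtoC. pose proof (Re_ccosh_pos u H). lra. Qed.

Lemma one_ccosh_mod (u : C) :
  Cmod (1 + ccosh u)%C ^ 2 = (1 + Re (ccosh u)) ^ 2 + Im (ccosh u) ^ 2.
Proof. rewrite Cmod2_alt, re_plus, im_plus, re_RtoC, im_RtoC. ring. Qed.

Lemma one_ccosh_mod_pos (u : C) : Rabs (Im u) < PI / 2 ->
  0 < (1 + Re (ccosh u)) ^ 2 + Im (ccosh u) ^ 2.
Proof. intros H. pose proof (Re_ccosh_pos u H). nra. Qed.

Lemma qu_Re (u : C) : Rabs (Im u) < PI / 2 ->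
  Re (qu u) = 1 - 2 * (1 - a_plus) * (1 + Re (ccosh u)) / ((1 + Re (ccosh u)) ^ 2 + Im (ccosh u) ^ 2).
Proof.
intros H. unfold qu. rewrite re_minus, Re_mult_inv by (apply one_ccosh_neq_0, H).
rewrite one_ccosh_mod, Re_conj_mult, !re_plus, !im_plus, !re_RtoC, !im_RtoC.
pose proof (one_ccosh_mod_pos u H). field. lra.
Qed.

Lemma qu_Im (u : C) : Rabs (Im u) < PI / 2 ->
  Im (qu u) = 2 * (1 - a_plus) * Im (ccosh u) / ((1 + Re (ccosh u)) ^ 2 + Im (ccosh u) ^ 2).
Proof.
intros H. unfold qu. rewrite im_minus, Im_mult_inv by (apply one_ccosh_neq_0, H).
rewrite one_ccosh_mod, im_mult, re_conj, im_conj, !re_plus, !im_plus, !re_RtoC, !im_RtoC.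
pose proof (one_ccosh_mod_pos u H). field. lra.
Qed.

(** With [s = 1 - a_plus] and [x = Re (cosh u) > 0], [|q|^2 = 1 - 4 s (1 + x - s) / |1 + cosh u|^2],
    and [s < 1]. Hence [q + 1] and [q - a_minus] lie in the right half-plane. *)
Lemma qu_mod (u : C) : Rabs (Im u) < PI / 2 -> Re (qu u) ^ 2 + Im (qu u) ^ 2 < 1.
Proof.
intros H. rewrite qu_Re, qu_Im by exact H.
pose proof (Re_ccosh_pos u H) as P. pose proof (one_ccosh_mod_pos u H) as N.
pose proof a_plus_bounds as B.
set (x := Re (ccosh u)) in *. set (y := Im (ccosh u)) in *.
set (n := (1 + x) ^ 2 + y ^ 2) in *. set (s := 1 - a_plus) in *.
replace ((1 - 2 * s * (1 + x) / n) ^ 2 + (2 * s * y / n) ^ 2)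
  with (1 - 4 * s * (1 + x - s) / n) by (unfold n; field; fold n; lra).
assert (0 < 4 * s * (1 + x - s) / n) by (apply Rdiv_lt_0_compat; unfold s in *; nra). lra.
Qed.

(** [q] is real only where [sinh x sin y = 0], that is on the two axes: on the real one
    [cosh u >= 1], and on the imaginary one the cut leaves [cos v > 1 - 2 a_plus]; both make [q]
    positive. *)
Lemma qu_slit (u : C) : dom u -> slit (qu u).
Proof.
intros [H H0]. pose proof (one_ccosh_mod_pos u H) as N. pose proof a_plus_bounds as B.
pose proof (Re_ccosh_pos u H) as P.
destruct (Req_dec (Im (ccosh u)) 0) as [E|E].
- left. rewrite qu_Re, E by exact H. rewrite E in N.
  assert (K : 1 - 2 * a_plus < Re (ccosh u)).
  { simpl in E |- *. unfold Re, Im in *. apply Rmult_integral in E. destruct H0 as [H0|H0].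
    - destruct E as [E|E].
      + exfalso. destruct (Rtotal_order (fst u) 0) as [h|[h|h]]; [|contradiction|].
        * pose proof (sinh_pos (- fst u)) as Q. rewrite sinh_odd in Q. lra.
        * pose proof (sinh_pos (fst u) h). lra.
      + apply Rabs_lt_between in H.
        assert (Z : snd u = 0).
        { destruct (Rtotal_order (snd u) 0) as [h|[h|h]]; [|exact h|].
          - pose proof (sin_gt_0 (- snd u)) as Q. rewrite sin_neg in Q. lra.
          - pose proof (sin_gt_0 (snd u)) as Q. lra. }
        rewrite Z, cos_0. pose proof (cosh_ge_1 (fst u)). lra.
    - pose proof (cos_gt_v0 _ H0). pose proof (cosh_ge_1 (fst u)). nra. }
  set (x := Re (ccosh u)) in *.
  replace (1 - 2 * (1 - a_plus) * (1 + x) / ((1 + x) ^ 2 + 0 ^ 2))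
    with ((x - (1 - 2 * a_plus)) / (1 + x)) by (field; lra).
  apply Rdiv_lt_0_compat; lra.
- right. rewrite qu_Im by exact H. unfold Rdiv.
  apply Rmult_integral_contrapositive; split.
  + apply Rmult_integral_contrapositive; split; [lra|exact E].
  + apply Rinv_neq_0_compat. lra.
Qed.

Lemma qu1_Re_pos (u : C) : Rabs (Im u) < PI / 2 -> 0 < Re (qu u + 1)%C.
Proof. intros H. pose proof (qu_mod u H). rewrite re_plus, re_RtoC. nra. Qed.

Lemma qum_Re_pos (u : C) : Rabs (Im u) < PI / 2 -> 0 < Re (qu u - RtoC a_minus)%C.
Proof.
intros H. pose proof (qu_mod u H). rewrite re_minus, re_RtoC, a_minus_eq.
pose proof a_plus_bounds. nra.
Qed.

(** Separate principal roots instead of the root of the quotient: each radicand avoids the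
    nonpositive reals, and the three roots can be compared by the signs of their imaginary parts. *)
Definition dtdu (u : C) : C :=
  (RtoC kap * (csqrt (qu u) * / (csqrt (qu u + 1) * csqrt (qu u - RtoC a_minus))))%C.

Lemma dtdu_den_neq_0 (u : C) : Rabs (Im u) < PI / 2 ->
  (csqrt (qu u + 1) * csqrt (qu u - RtoC a_minus))%C <> 0.
Proof.
intros H. apply Cmult_neq_0; apply csqrt_neq_0; left; [apply qu1_Re_pos|apply qum_Re_pos]; exact H.
Qed.

Lemma dtdu_twice : twice_cderiv dom dtdu.
Proof.
assert (Q : twice_cderiv dom qu).
{ destruct (twice_plus dom _ _ (twice_const dom 1) (twice_mult dom _ _
    (twice_const dom (- RtoC (2 * (1 - a_plus)))%C) (twice_inv dom (fun u => 1 + ccosh u)%C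
      (fun z Hz => one_ccosh_neq_0 z (proj1 Hz))
      (twice_plus dom _ _ (twice_const dom 1) (twice_ccosh dom))))) as [f1 F].
  exists f1. intros z Hz. destruct (F z Hz) as [F1 F2]. split; [|exact F2].
  eapply cderiv_ext; [|exact F1]. intros w. unfold qu. ring. }
apply twice_mult; [apply twice_const|]. apply twice_mult.
- apply twice_csqrt; [apply qu_slit|exact Q].
- apply twice_inv; [intros z Hz; apply dtdu_den_neq_0, Hz|].
  apply twice_mult; apply twice_csqrt.
  + intros z Hz; left; apply qu1_Re_pos, Hz.
  + apply twice_plus; [exact Q|apply twice_const].
  + intros z Hz; left; apply qum_Re_pos, Hz.
  + apply twice_plus; [exact Q|apply (twice_const dom (- RtoC a_minus)%C)].
Qed.

Lemma qu_cderiv (u : C) : Rabs (Im u) < PI / 2 ->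
  cderiv qu u (RtoC (2 * (1 - a_plus)) * csinh u * / ((1 + ccosh u) * (1 + ccosh u)))%C.
Proof.
intros H. pose proof (one_ccosh_neq_0 u H) as N.
assert (S : cderiv (fun w => 1 + ccosh w)%C u (csinh u)).
{ replace (csinh u) with (0 + csinh u)%C by ring.
  apply cderiv_plus; [apply cderiv_const|apply ccosh_cderiv]. }
pose proof (cderiv_plus _ _ u _ _ (cderiv_const 1 u)
  (cderiv_scal (- RtoC (2 * (1 - a_plus)))%C _ u _ (cderiv_inv _ u _ N S))) as K.
replace (RtoC (2 * (1 - a_plus)) * csinh u * / ((1 + ccosh u) * (1 + ccosh u)))%C
  with (0 + - RtoC (2 * (1 - a_plus)) * (- / ((1 + ccosh u) * (1 + ccosh u)) * csinh u))%C by ring.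
eapply cderiv_ext; [|exact K]. intros w. unfold qu. ring.
Qed.

Lemma dtdu_sqr (u : C) : dom u ->
  (dtdu u * dtdu u)%C = (RtoC (kap ^ 2) * (qu u * / ((qu u + 1) * (qu u - RtoC a_minus))))%C.
Proof.
intros H. pose proof (csqrt_sqr _ (qu_slit u H)) as E1.
assert (S2 : slit (qu u + 1)%C) by (left; apply qu1_Re_pos, H).
assert (S3 : slit (qu u - RtoC a_minus)%C) by (left; apply qum_Re_pos, H).
pose proof (csqrt_sqr _ S2) as E2. pose proof (csqrt_sqr _ S3) as E3.
pose proof (csqrt_neq_0 _ S2) as N2. pose proof (csqrt_neq_0 _ S3) as N3.
unfold dtdu. rewrite RtoC_pow.
set (a := csqrt (qu u)) in *. set (b := csqrt (qu u + 1)) in *.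
set (c := csqrt (qu u - RtoC a_minus)) in *.
rewrite <- E2, <- E3, <- E1. field. split; assumption.
Qed.

(** The argument is halved, so it is less than [PI / 4] in absolute value. *)
Lemma csqrt_cone (z : C) : 0 < Re z -> Im (csqrt z) ^ 2 < Re (csqrt z) ^ 2.
Proof.
intros H. pose proof (csqrt_sqr z (or_introl H)) as E.
apply (f_equal Re) in E. rewrite re_mult in E. nra.
Qed.

Lemma csqrt_Im_sign (z w : C) : slit z -> slit w -> Im z = Im w ->
  0 <= Im (csqrt z) * Im (csqrt w).
Proof.
intros Sz Sw E. pose proof (csqrt_Re z Sz) as P. pose proof (csqrt_Re w Sw) as Q.
change (Im (csqrt z)) with (Im z / (2 * Re (csqrt z))).
change (Im (csqrt w)) with (Im w / (2 * Re (csqrt w))). rewrite E.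
replace (Im w / (2 * Re (csqrt z)) * (Im w / (2 * Re (csqrt w))))
  with (Im w ^ 2 / (4 * (Re (csqrt z) * Re (csqrt w)))) by (field; lra).
apply Rdiv_le_0_compat; [apply pow2_ge_0|nra].
Qed.

(** The three radicands have the same imaginary part, so their roots [x_k + i y_k] have imaginary
    parts of one sign. The sign of the real part is that of
    [(x2 x3 - y2 y3) x1 + (x2 y3 + y2 x3) y1]: the first term is positive by [csqrt_cone], the
    second is nonnegative. *)
Lemma dtdu_Re_pos (u : C) : dom u -> 0 < Re (dtdu u).
Proof.
intros H. pose proof (qu_slit u H) as S1.
pose proof (qu1_Re_pos u (proj1 H)) as R2. pose proof (qum_Re_pos u (proj1 H)) as R3.
assert (S2 : slit (qu u + 1)%C) by (left; exact R2).
assert (S3 : slit (qu u - RtoC a_minus)%C) by (left; exact R3).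
assert (I2 : Im (qu u) = Im (qu u + 1)%C) by (rewrite im_plus, im_RtoC; ring).
assert (I3 : Im (qu u) = Im (qu u - RtoC a_minus)%C) by (rewrite im_minus, im_RtoC; ring).
pose proof (csqrt_Im_sign _ _ S1 S2 I2) as K2.
pose proof (csqrt_Im_sign _ _ S1 S3 I3) as K3.
pose proof (csqrt_cone _ R2) as C2. pose proof (csqrt_cone _ R3) as C3.
pose proof (csqrt_Re _ S1) as P1. pose proof (csqrt_Re _ S2) as P2. pose proof (csqrt_Re _ S3) as P3.
unfold dtdu. rewrite re_scal_l. apply Rmult_lt_0_compat; [apply kap_pos|].
rewrite Re_mult_inv by (apply dtdu_den_neq_0, H).
apply Rdiv_lt_0_compat; [|apply pow_lt, Cmod_gt_0, dtdu_den_neq_0, H].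
rewrite Re_conj_mult, re_mult, im_mult.
set (x1 := Re (csqrt (qu u))) in *. set (y1 := Im (csqrt (qu u))) in *.
set (x2 := Re (csqrt (qu u + 1))) in *. set (y2 := Im (csqrt (qu u + 1))) in *.
set (x3 := Re (csqrt (qu u - RtoC a_minus))) in *. set (y3 := Im (csqrt (qu u - RtoC a_minus))) in *.
assert (D : y2 * y3 < x2 * x3).
{ apply Rle_lt_trans with (Rabs y2 * Rabs y3); [rewrite <- Rabs_mult; apply Rle_abs|].
  apply Rmult_le_0_lt_compat; try apply Rabs_pos.
  - rewrite <- (Rabs_pos_eq x2) by lra. apply Rsqr_lt_abs_0. unfold Rsqr. lra.
  - rewrite <- (Rabs_pos_eq x3) by lra. apply Rsqr_lt_abs_0. unfold Rsqr. lra. }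
assert (0 < (x2 * x3 - y2 * y3) * x1) by (apply Rmult_lt_0_compat; lra).
assert (0 <= (y1 * y2) * x3) by (apply Rmult_le_pos; lra).
assert (0 <= (y1 * y3) * x2) by (apply Rmult_le_pos; lra).
nra.
Qed.

Lemma dom_star (u : C) (s : R) : dom u -> 0 <= s <= 1 -> dom (RtoC s * u)%C.
Proof.
intros [H H0] Hs. unfold dom, cut. rewrite re_scal_l, im_scal_l, Rabs_mult, (Rabs_pos_eq s) by lra.
pose proof (Rabs_pos (Im u)). pose proof v0_bounds. split; [nra|].
destruct (Req_dec s 0) as [E|E]; [right; rewrite E; lra|].
destruct H0 as [H0|H0]; [left|right; nra].
apply Rmult_integral_contrapositive; split; assumption.
Qed.

Lemma time_exists : exists time : C -> C, time 0 = 0 /\ forall u, dom u -> cderiv time u (dtdu u).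
Proof.
destruct dtdu_twice as [W1 HW].
apply (star_primitive dom dtdu W1 dom_star (cut_open (PI / 2) v0)); intros z Hz; apply HW, Hz.
Qed.

Definition time : C -> C := proj1_sig (constructive_indefinite_description _ time_exists).

Lemma time_0 : time 0 = 0.
Proof. exact (proj1 (proj2_sig (constructive_indefinite_description _ time_exists))). Qed.

Lemma time_cderiv (u : C) : dom u -> cderiv time u (dtdu u).
Proof. exact (proj2 (proj2_sig (constructive_indefinite_description _ time_exists)) u). Qed.

(** * Symmetries, univalence and monotonicity of the complex time *)

Lemma ccosh_opp (u : C) : ccosh (- u)%C = ccosh u.
Proof.
unfold ccosh. rewrite re_opp, im_opp, cosh_even, sinh_odd, cos_neg, sin_neg.
apply C_eq; simpl; ring.
Qed.

Lemma ccosh_conj (u : C) : ccosh (Cconj u) = Cconj (ccosh u).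
Proof.
unfold ccosh. rewrite re_conj, im_conj, cos_neg, sin_neg.
apply C_eq; simpl; ring.
Qed.

Lemma qu_opp (u : C) : qu (- u)%C = qu u.
Proof. unfold qu. rewrite ccosh_opp. reflexivity. Qed.

Lemma RtoC_conj (x : R) : Cconj (RtoC x) = RtoC x.
Proof. apply C_eq; simpl; ring. Qed.

Lemma qu_conj (u : C) : Rabs (Im u) < PI / 2 -> qu (Cconj u) = Cconj (qu u).
Proof.
intros H. unfold qu. rewrite ccosh_conj, Cminus_conj, Cmult_conj.
rewrite Cinv_conj by (apply one_ccosh_neq_0, H). rewrite Cplus_conj, !RtoC_conj. reflexivity.
Qed.

Lemma dtdu_opp (u : C) : dtdu (- u)%C = dtdu u.
Proof. unfold dtdu. rewrite qu_opp. reflexivity. Qed.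

Lemma dtdu_conj (u : C) : dom u -> dtdu (Cconj u) = Cconj (dtdu u).
Proof.
intros H. pose proof (proj1 H) as H1. unfold dtdu. rewrite qu_conj by exact H1.
rewrite !Cmult_conj, Cinv_conj, Cmult_conj by (apply dtdu_den_neq_0, H1).
rewrite <- !csqrt_conj by
  first [apply qu_slit, H | left; apply qu1_Re_pos, H1 | left; apply qum_Re_pos, H1].
rewrite Cplus_conj, Cminus_conj, !RtoC_conj. reflexivity.
Qed.

(** Rays from 0 stay in the domain; this uniqueness turns the symmetries of [dtdu] into those of
    [time]. *)
Lemma dom_primitive_zero (F : C -> C) :
  F 0 = 0 -> (forall u, dom u -> cderiv F u 0) -> forall u, dom u -> F u = 0.
Proof.
intros F0 HF u Hu.
assert (E : forall s, (0 + RtoC s * (u - 0))%C = (RtoC s * u)%C) by (intros; ring).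
pose proof (segment_mean_value F (fun _ => RtoC 0) 0 u 0) as M.
rewrite Rmult_0_l in M.
apply Ceq_minus, Cmod_eq_0. rewrite <- F0 at 1.
apply Rle_antisym; [|apply Cmod_ge_0]. apply M.
- intros s Hs. apply HF. rewrite E. apply dom_star; assumption.
- intros s Hs. rewrite Cmod_0. lra.
Qed.

Lemma time_opp (u : C) : dom u -> time (- u)%C = (- time u)%C.
Proof.
intros H. apply Ceq_minus.
replace (time (- u) - - time u)%C with (time u + time (- u))%C by ring.
apply (dom_primitive_zero (fun w => time w + time (- w))%C); [| |exact H].
- replace (- 0)%C with (RtoC 0) by ring. rewrite time_0. ring.
- intros w Hw. replace (RtoC 0) with (dtdu w + - dtdu w)%C by ring.
  apply cderiv_plus; [apply time_cderiv, Hw|].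
  rewrite <- (dtdu_opp w) . apply cderiv_opp_arg, time_cderiv, cut_opp, Hw.
Qed.

Lemma time_conj (u : C) : dom u -> time (Cconj u) = Cconj (time u).
Proof.
intros H. rewrite <- (Cconj_conj (time (Cconj u))). f_equal. apply Ceq_minus.
apply (dom_primitive_zero (fun w => Cconj (time (Cconj w)) - time w)%C); [| |exact H].
- rewrite RtoC_conj, time_0, RtoC_conj. ring.
- intros w Hw. apply (cderiv_ext (fun w => Cconj (time (Cconj w)) + -1 * time w)%C); [intros; ring|].
  replace (RtoC 0) with (dtdu w + -1 * dtdu w)%C by ring.
  apply cderiv_plus; [|apply cderiv_scal, time_cderiv, Hw].
  rewrite <- (Cconj_conj (dtdu w)), <- dtdu_conj by exact Hw.
  rewrite <- (Cconj_conj w) at 1. apply cderiv_conj, time_cderiv, cut_conj, Hw.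
Qed.

Lemma time_real (x : R) : Im (time (RtoC x)) = 0.
Proof.
assert (H : dom (RtoC x)).
{ pose proof v0_bounds. unfold dom, cut. rewrite im_RtoC, Rabs_R0. lra. }
pose proof (time_conj _ H) as E. rewrite RtoC_conj in E. apply (f_equal Im) in E.
rewrite im_conj in E. lra.
Qed.

Lemma dom_axis (y : R) : Rabs y < v0 -> dom (0, y).
Proof. intros H. pose proof v0_bounds. split; simpl; [lra|right; exact H]. Qed.

Lemma dom_right (x y : R) : 0 < x -> Rabs y < PI / 2 -> dom (x, y).
Proof. intros H H'. split; simpl; [exact H'|left; lra]. Qed.

(** The axis is fixed by [u -> - Cconj u], with which [time] commutes. *)
Lemma time_axis (y : R) : Rabs y < v0 -> Re (time (0, y)) = 0.
Proof.
intros H. pose proof (dom_axis y H) as D.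
pose proof (time_opp _ (cut_conj _ _ _ D)) as E. rewrite time_conj in E by exact D.
replace (- Cconj (0, y))%C with ((0, y) : C) in E by (apply C_eq; simpl; ring).
apply (f_equal Re) in E. rewrite re_opp, re_conj in E. lra.
Qed.

(** The closed right half of the domain is convex, although the domain is not: a convex combination
    lies on the axis only if every end point of nonzero weight does, and there the bound [v0]
    holds. *)
Lemma dom_segment (a b : C) (s : R) :
  dom a -> dom b -> 0 <= Re a -> 0 <= Re b -> 0 <= s <= 1 -> dom (a + RtoC s * (b - a))%C.
Proof.
intros [A1 A2] [B1 B2] Ra Rb Hs.
assert (ER : Re (a + RtoC s * (b - a))%C = (1 - s) * Re a + s * Re b)
  by (rewrite re_plus, re_scal_l, re_minus; ring).
assert (EI : Im (a + RtoC s * (b - a))%C = (1 - s) * Im a + s * Im b)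
  by (rewrite im_plus, im_scal_l, im_minus; ring).
unfold dom, cut. rewrite ER, EI.
assert (K : forall c, Rabs (Im a) < c -> Rabs (Im b) < c ->
  Rabs ((1 - s) * Im a + s * Im b) < c).
{ intros c Ha Hb. apply Rabs_lt_between in Ha. apply Rabs_lt_between in Hb.
  apply Rabs_lt_between. destruct (Rle_dec s (1 / 2)); split; nra. }
split; [apply K; assumption|].
destruct (Req_dec ((1 - s) * Re a + s * Re b) 0) as [E|E]; [right|left; exact E].
assert (E1 : (1 - s) * Re a = 0) by nra. assert (E2 : s * Re b = 0) by nra.
apply Rmult_integral in E1. apply Rmult_integral in E2.
destruct E1 as [E1|E1], E2 as [E2|E2].
- lra.
- replace s with 1 by lra. replace ((1 - 1) * Im a + 1 * Im b) with (Im b) by ring.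
  destruct B2 as [B2|B2]; [contradiction|exact B2].
- rewrite E2. replace ((1 - 0) * Im a + 0 * Im b) with (Im a) by ring.
  destruct A2 as [A2|A2]; [contradiction|exact A2].
- destruct A2 as [A2|A2]; [contradiction|]. destruct B2 as [B2|B2]; [contradiction|].
  apply K; assumption.
Qed.

(* Univalence: [Re time' > 0] along a segment keeps the images of its end points apart. *)
Lemma time_segment_pos (a b : C) :
  dom a -> dom b -> 0 <= Re a -> 0 <= Re b -> a <> b ->
  0 < Re (Cconj (b - a) * (time b - time a))%C.
Proof.
intros Da Db Ra Rb N.
destruct (segment_mvt time dtdu a b (b - a)%C) as [s [Hs E]].
{ intros s Hs. apply time_cderiv, dom_segment; assumption. }
rewrite E. set (w := (a + RtoC s * (b - a))%C).
assert (P : 0 < Re (dtdu w)) by (apply dtdu_Re_pos, dom_segment; assumption).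
replace (Cconj (b - a) * (dtdu w * (b - a)))%C with (dtdu w * (Cconj (b - a) * (b - a)))%C by ring.
rewrite (Cmult_comm (Cconj (b - a)) (b - a)), <- Cmod2_conj, re_scal_r.
apply Rmult_lt_0_compat; [exact P|]. apply pow_lt, Cmod_gt_0.
apply Cminus_eq_contra. congruence.
Qed.

Lemma time_inj_right (a b : C) :
  dom a -> dom b -> 0 <= Re a -> 0 <= Re b -> time a = time b -> a = b.
Proof.
intros Da Db Ra Rb E. destruct (Ceq_dec a b) as [h|h]; [exact h|exfalso].
pose proof (time_segment_pos a b Da Db Ra Rb h) as K. rewrite E in K.
replace (Cconj (b - a) * (time b - time b))%C with (RtoC 0) in K by ring. rewrite re_RtoC in K. lra.
Qed.

Lemma time_Re_incr (x1 x2 y : R) :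
  dom (x1, y) -> 0 <= x1 < x2 -> Re (time (x1, y)) < Re (time (x2, y)).
Proof.
intros D H.
assert (D2 : dom (x2, y)) by (apply dom_right; [lra|apply D]).
pose proof (time_segment_pos (x1, y) (x2, y) D D2 ltac:(simpl; lra) ltac:(simpl; lra)) as K.
rewrite Re_conj_mult, re_minus, im_minus, re_minus in K. simpl in K.
assert (N : (x1, y) <> (x2, y)) by (intros E; injection E; lra).
specialize (K N). nra.
Qed.

Lemma time_Im_incr (x y1 y2 : R) :
  dom (x, y1) -> dom (x, y2) -> 0 <= x -> y1 < y2 -> Im (time (x, y1)) < Im (time (x, y2)).
Proof.
intros D1 D2 Hx H.
pose proof (time_segment_pos (x, y1) (x, y2) D1 D2 ltac:(simpl; lra) ltac:(simpl; lra)) as K.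
rewrite Re_conj_mult, re_minus, im_minus, im_minus in K. simpl in K.
assert (N : (x, y1) <> (x, y2)) by (intros E; injection E; lra).
specialize (K N). nra.
Qed.

(** With [N = |q|^2], the product of [q] and the conjugate of [(q + 1) (q - a_minus)] is [N Cconj q
    + (2 + a_plus) N + (1 + a_plus) q]. As [N < 1] and [Re (dtdu u) > 0], the imaginary part of
    [dtdu u] has the sign of [Im q]. *)
Lemma dtdu_sqr_parts (u : C) : dom u -> exists k, 0 < k /\
  k = kap ^ 2 / (((Re (qu u) + 1) ^ 2 + Im (qu u) ^ 2)
       * ((Re (qu u) + 1 + a_plus) ^ 2 + Im (qu u) ^ 2)) /\
  Re (dtdu u) ^ 2 - Im (dtdu u) ^ 2 = k * (Re (qu u) * (Re (qu u) ^ 2 + Im (qu u) ^ 2 + (1 + a_plus))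
      + (2 + a_plus) * (Re (qu u) ^ 2 + Im (qu u) ^ 2)) /\
  2 * Re (dtdu u) * Im (dtdu u) = k * (Im (qu u) * (1 + a_plus - (Re (qu u) ^ 2 + Im (qu u) ^ 2))).
Proof.
intros H. pose proof (dtdu_sqr u H) as E.
pose proof (qu1_Re_pos u (proj1 H)) as R2. pose proof (qum_Re_pos u (proj1 H)) as R3.
pose proof (Re_pos_neq_0 _ R2) as N2. pose proof (Re_pos_neq_0 _ R3) as N3.
pose proof (f_equal Re E) as ER. pose proof (f_equal Im E) as EI.
rewrite re_mult, re_scal_l, Re_mult_inv in ER by (apply Cmult_neq_0; assumption).
rewrite im_mult, im_scal_l, Im_mult_inv in EI by (apply Cmult_neq_0; assumption).
rewrite Cmod_mult, Rpow_mult_distr, !Cmod2_alt in ER, EI.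
rewrite Re_conj_mult in ER. rewrite (im_mult (Cconj _)), re_conj, im_conj in EI.
rewrite re_mult, im_mult in ER, EI.
rewrite re_plus in R2. rewrite re_minus in R3.
rewrite !re_plus, !im_plus, !re_minus, !im_minus in ER, EI.
rewrite !re_RtoC, !im_RtoC, a_minus_eq in *.
set (x := Re (qu u)) in *. set (y := Im (qu u)) in *.
assert (P2 : 0 < (x + 1) ^ 2 + y ^ 2) by nra.
assert (P3 : 0 < (x + 1 + a_plus) ^ 2 + y ^ 2) by nra.
assert (Pk : 0 < kap ^ 2) by (apply pow_lt, kap_pos).
eexists. split; [|split; [reflexivity|split]].
- apply Rdiv_lt_0_compat; [exact Pk|apply Rmult_lt_0_compat; assumption].
- transitivity (Re (dtdu u) * Re (dtdu u) - Im (dtdu u) * Im (dtdu u)); [ring|]. rewrite ER.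
  field. repeat split; nra.
- transitivity (Re (dtdu u) * Im (dtdu u) + Im (dtdu u) * Re (dtdu u)); [ring|]. rewrite EI.
  field. repeat split; nra.
Qed.

Lemma qu_Im_pos (x y : R) : 0 < x -> 0 < y < PI / 2 -> 0 < Im (qu (x, y)).
Proof.
intros Hx Hy. assert (H : Rabs (Im (x, y)) < PI / 2) by (simpl; rewrite Rabs_pos_eq; lra).
rewrite qu_Im by exact H. pose proof a_plus_bounds.
apply Rdiv_lt_0_compat; [|apply one_ccosh_mod_pos, H].
apply Rmult_lt_0_compat; [lra|]. simpl. apply Rmult_lt_0_compat; [apply sinh_pos, Hx|].
apply sin_gt_0; lra.
Qed.

Lemma qu_Im_nonneg (x y : R) : 0 <= x -> 0 <= y < PI / 2 -> 0 <= Im (qu (x, y)).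
Proof.
intros Hx Hy. assert (H : Rabs (Im (x, y)) < PI / 2) by (simpl; rewrite Rabs_pos_eq; lra).
rewrite qu_Im by exact H. pose proof a_plus_bounds.
apply Rdiv_le_0_compat; [|apply one_ccosh_mod_pos, H].
apply Rmult_le_pos; [lra|]. simpl. apply Rmult_le_pos.
- destruct Hx as [Hx|Hx]; [apply Rlt_le, sinh_pos, Hx|].
  unfold sinh. rewrite <- Hx, Ropp_0. lra.
- apply sin_ge_0; lra.
Qed.

Lemma dtdu_Im_nonneg (u : C) : dom u -> 0 <= Im (qu u) -> 0 <= Im (dtdu u).
Proof.
intros H I. pose proof (dtdu_Re_pos u H) as P. pose proof (qu_mod u (proj1 H)) as M.
pose proof a_plus_bounds.
destruct (dtdu_sqr_parts u H) as [k [k0 [_ [_ E]]]].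
assert (0 <= k * (Im (qu u) * (1 + a_plus - (Re (qu u) ^ 2 + Im (qu u) ^ 2)))).
{ repeat apply Rmult_le_pos; lra. }
nra.
Qed.

Lemma dtdu_Im_pos (u : C) : dom u -> 0 < Im (qu u) -> 0 < Im (dtdu u).
Proof.
intros H I. pose proof (dtdu_Re_pos u H) as P. pose proof (qu_mod u (proj1 H)) as M.
pose proof a_plus_bounds.
destruct (dtdu_sqr_parts u H) as [k [k0 [_ [_ E]]]].
assert (0 < k * (Im (qu u) * (1 + a_plus - (Re (qu u) ^ 2 + Im (qu u) ^ 2)))).
{ repeat apply Rmult_lt_0_compat; lra. }
nra.
Qed.

Lemma time_horizontal (x1 x2 y : R) : dom (x1, y) -> dom (x2, y) -> 0 <= x1 <= x2 ->
  (exists x, x1 <= x <= x2 /\ dom (x, y) /\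
     Re (time (x2, y)) - Re (time (x1, y)) = Re (dtdu (x, y)) * (x2 - x1)) /\
  (exists x, x1 <= x <= x2 /\ dom (x, y) /\
     Im (time (x2, y)) - Im (time (x1, y)) = Im (dtdu (x, y)) * (x2 - x1)).
Proof.
intros D1 D2 H.
assert (S : forall s, 0 <= s <= 1 -> dom ((x1, y) + RtoC s * ((x2, y) - (x1, y)))%C)
  by (intros s Hs; apply dom_segment; simpl; try lra; assumption).
assert (E : forall s, ((x1, y) + RtoC s * ((x2, y) - (x1, y)))%C = (x1 + s * (x2 - x1), y))
  by (intros s; apply C_eq; simpl; ring).
split.
- destruct (segment_mvt time dtdu (x1, y) (x2, y) 1 (fun s Hs => time_cderiv _ (S s Hs))) as [s [Hs K]].
  specialize (S s Hs). rewrite E in S, K.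
  exists (x1 + s * (x2 - x1)). split; [split; nra|]. split; [exact S|].
  set (w := dtdu _) in *. clearbody w.
  unfold Re, Im, Cconj, Cmult, Cminus, Cplus, Copp, RtoC in *; simpl in *. lra.
- destruct (segment_mvt time dtdu (x1, y) (x2, y) Ci (fun s Hs => time_cderiv _ (S s Hs))) as [s [Hs K]].
  specialize (S s Hs). rewrite E in S, K.
  exists (x1 + s * (x2 - x1)). split; [split; nra|]. split; [exact S|].
  set (w := dtdu _) in *. clearbody w.
  unfold Re, Im, Cconj, Cmult, Cminus, Cplus, Copp, Ci, RtoC in *; simpl in *. lra.
Qed.

Lemma time_vertical (x y1 y2 : R) : dom (x, y1) -> dom (x, y2) -> 0 <= x -> y1 <= y2 ->
  exists y, y1 <= y <= y2 /\ dom (x, y) /\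
    Re (time (x, y2)) - Re (time (x, y1)) = - Im (dtdu (x, y)) * (y2 - y1).
Proof.
intros D1 D2 Hx H.
assert (S : forall s, 0 <= s <= 1 -> dom ((x, y1) + RtoC s * ((x, y2) - (x, y1)))%C)
  by (intros s Hs; apply dom_segment; simpl; try lra; assumption).
destruct (segment_mvt time dtdu (x, y1) (x, y2) 1 (fun s Hs => time_cderiv _ (S s Hs))) as [s [Hs K]].
specialize (S s Hs).
replace ((x, y1) + RtoC s * ((x, y2) - (x, y1)))%C with ((x, y1 + s * (y2 - y1)) : C) in S, K
  by (apply C_eq; simpl; ring).
exists (y1 + s * (y2 - y1)). split; [split; nra|]. split; [exact S|].
set (w := dtdu _) in *. clearbody w.
unfold Re, Im, Cconj, Cmult, Cminus, Cplus, Copp, RtoC in *; simpl in *. lra.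
Qed.

Lemma time_Re_decr (x y1 y2 : R) :
  0 < x -> 0 <= y1 -> y1 <= y2 < PI / 2 -> Re (time (x, y2)) <= Re (time (x, y1)).
Proof.
intros Hx H1 H2.
destruct (time_vertical x y1 y2) as [y [Hy [D E]]];
  try (apply dom_right; try rewrite Rabs_pos_eq); try lra.
assert (Q : 0 <= Im (dtdu (x, y))) by (apply dtdu_Im_nonneg; [exact D|apply qu_Im_nonneg; lra]).
nra.
Qed.

Lemma time_Im_incr_x (x1 x2 y : R) :
  dom (x1, y) -> 0 <= x1 <= x2 -> 0 <= y < PI / 2 -> Im (time (x1, y)) <= Im (time (x2, y)).
Proof.
intros D H Hy.
assert (D2 : dom (x2, y)).
{ destruct (Req_dec x1 x2) as [h|h]; [rewrite <- h; exact D|]. apply dom_right; [lra|apply D]. }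
destruct (time_horizontal x1 x2 y D D2 H) as [_ [x [Hx [Dx E]]]].
assert (Q : 0 <= Im (dtdu (x, y))) by (apply dtdu_Im_nonneg; [exact Dx|apply qu_Im_nonneg; lra]).
nra.
Qed.

Lemma time_Im_incr_x_strict (x1 x2 y : R) :
  0 < x1 < x2 -> 0 < y < PI / 2 -> Im (time (x1, y)) < Im (time (x2, y)).
Proof.
intros H Hy.
destruct (time_horizontal x1 x2 y) as [_ [x [Hx [Dx E]]]];
  try (apply dom_right; try rewrite Rabs_pos_eq); try lra.
assert (Q : 0 < Im (dtdu (x, y))) by (apply dtdu_Im_pos; [exact Dx|apply qu_Im_pos; lra]).
nra.
Qed.

(** * The imaginary axis and the constant [A] *)

Lemma pow2_inj (x y : R) : 0 <= x -> 0 <= y -> x ^ 2 = y ^ 2 -> x = y.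
Proof. intros Hx Hy H. apply Rsqr_inj; [exact Hx|exact Hy|]. unfold Rsqr. lra. Qed.

Lemma derive_0_const (f : R -> R) (a b : R) :
  (forall x, a < x < b -> is_derive f x 0) ->
  forall x y, a < x < b -> a < y < b -> f x = f y.
Proof.
intros H.
assert (K : forall x y, a < x < b -> a < y < b -> x <= y -> f y - f x = 0).
{ intros x y Hx Hy xy.
  destruct (MVT_gen f x y (fun _ => 0)) as [c [_ E]];
    rewrite ?Rmin_left, ?Rmax_right in * by lra.
  - intros z Hz. apply H. lra.
  - intros z Hz. eapply is_derive_continuity_pt, H. lra.
  - lra. }
intros x y Hx Hy. destruct (Rle_dec x y) as [xy|xy].
- pose proof (K x y Hx Hy xy). lra.
- pose proof (K y x Hy Hx ltac:(lra)). lra.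
Qed.

Lemma time_axis_deriv (v : R) : Rabs v < v0 -> is_derive (fun y => Im (time (0, y))) v (Re (dtdu (0, v))).
Proof.
intros H. pose proof (vderiv_line 0 Ci v) as L.
assert (E : forall y, (0 + RtoC y * Ci)%C = (0, y)) by (intros; apply C_eq; simpl; ring).
destruct (vderiv_comp time (fun x => 0 + RtoC x * Ci)%C v (dtdu (0, v)) Ci) as [_ D].
- rewrite E. apply time_cderiv, dom_axis, H.
- exact L.
- replace (Re (dtdu (0, v))) with (Im (dtdu (0, v) * Ci)%C) by (rewrite im_mult; simpl; ring).
  eapply is_derive_ext; [|exact D]. intros y. cbv beta. rewrite E. reflexivity.
Qed.

Definition q_axis (v : R) : R := 1 - 2 * (1 - a_plus) / (1 + cos v).

Lemma cos_bounds_axis (v : R) : Rabs v < v0 -> 1 - 2 * a_plus < cos v <= 1.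
Proof. intros H. split; [apply cos_gt_v0, H|apply COS_bound]. Qed.

Lemma q_axis_bounds (v : R) : Rabs v < v0 -> 0 < q_axis v <= a_plus.
Proof.
intros H. pose proof (cos_bounds_axis v H). pose proof a_plus_bounds. unfold q_axis.
split.
- apply Rlt_0_minus. apply Rlt_div_l; lra.
- assert (1 - a_plus <= 2 * (1 - a_plus) / (1 + cos v)); [|lra]. apply Rle_div_r; nra.
Qed.

Lemma qu_axis (v : R) : Rabs v < v0 -> qu (0, v) = RtoC (q_axis v).
Proof.
intros H. pose proof (cos_bounds_axis v H). pose proof a_plus_bounds.
assert (H' : Rabs (Im (0, v)) < PI / 2) by (apply (dom_axis v H)).
apply C_eq.
- rewrite qu_Re, re_RtoC by exact H'. simpl. rewrite cosh_0, sinh_0. unfold q_axis. field. lra.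
- rewrite qu_Im, im_RtoC by exact H'. simpl. rewrite sinh_0. unfold Rdiv. ring.
Qed.

Lemma dtdu_real (u : C) (q : R) : qu u = RtoC q -> 0 < q ->
  dtdu u = RtoC (kap * (sqrt q / (sqrt (q + 1) * sqrt (q - a_minus)))).
Proof.
intros E H. pose proof a_plus_bounds. pose proof a_minus_eq.
unfold dtdu. rewrite E, <- RtoC_plus, <- RtoC_minus, !csqrt_pos by lra.
assert (0 < sqrt (q + 1)) by (apply sqrt_lt_R0; lra).
assert (0 < sqrt (q - a_minus)) by (apply sqrt_lt_R0; lra).
rewrite <- RtoC_mult, <- RtoC_inv by nra. rewrite <- !RtoC_mult. reflexivity.
Qed.

Lemma dtdu_axis (v : R) : Rabs v < v0 ->
  dtdu (0, v) = RtoC (kap * (sqrt (q_axis v) / (sqrt (q_axis v + 1) * sqrt (q_axis v - a_minus)))).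
Proof. intros H. apply dtdu_real; [apply qu_axis, H|apply q_axis_bounds, H]. Qed.

(** The bound [-1 / 2] makes 0 an interior point, so that [A_int] has a two-sided derivative there;
    at negative arguments [sqrt] returns 0. *)
Lemma A_integrand_cont (x : R) : -1 / 2 < x < a_plus -> continuous A_integrand x.
Proof.
intros H. pose proof a_plus_bounds. pose proof a_minus_eq as E.
unfold A_integrand.
apply (continuous_mult (fun x => / (1 - x)) (fun x => sqrt (x / (3 * (x + 1) * (a_plus - x) * (x - a_minus))))).
- apply (@ex_derive_continuous R_AbsRing R_NormedModule). auto_derive. lra.
- apply continuous_sqrt_comp.
  apply (@ex_derive_continuous R_AbsRing R_NormedModule). auto_derive.
  assert (0 < a_plus - x) by lra. assert (0 < x + 1) by lra. assert (0 < x - a_minus) by lra.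
  repeat apply Rmult_integral_contrapositive_currified; lra.
Qed.

Lemma A_integrand_pos (x : R) : 0 < x < a_plus -> 0 < A_integrand x.
Proof.
intros H. pose proof a_plus_bounds. pose proof a_minus_eq as E.
unfold A_integrand. apply Rmult_lt_0_compat; [apply Rinv_0_lt_compat; lra|].
apply sqrt_lt_R0, Rdiv_lt_0_compat; [lra|]. repeat apply Rmult_lt_0_compat; lra.
Qed.

Lemma A_ex_RInt (x : R) : 0 <= x < a_plus -> ex_RInt A_integrand 0 x.
Proof.
intros H. apply (@ex_RInt_continuous R_CompleteNormedModule). intros z Hz.
rewrite Rmin_left, Rmax_right in Hz by lra. apply A_integrand_cont. lra.
Qed.

Definition A_int (x : R) : R := RInt A_integrand 0 x.

Lemma A_int_0 : A_int 0 = 0.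
Proof. exact (@RInt_point R_CompleteNormedModule 0 A_integrand). Qed.

Lemma A_int_pos (x : R) : 0 < x < a_plus -> 0 < A_int x.
Proof.
intros H. apply RInt_gt_0; [lra| |].
- intros y Hy. apply A_integrand_pos. lra.
- intros y Hy. apply A_integrand_cont. lra.
Qed.

Lemma A_int_deriv (x : R) : -1 / 2 < x < a_plus -> is_derive A_int x (A_integrand x).
Proof.
intros H. apply (is_derive_RInt A_integrand A_int 0 x); [|apply A_integrand_cont, H].
assert (p : 0 < Rmin (a_plus - x) (x + 1 / 2)) by (apply Rmin_pos; lra).
exists (mkposreal _ p). intros y Hy.
apply (@RInt_correct R_CompleteNormedModule), (@ex_RInt_continuous R_CompleteNormedModule).
change (Rabs (y - x) < Rmin (a_plus - x) (x + 1 / 2)) in Hy.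
assert (Hy1 := Rmin_lt_l Hy).
assert (Hy2 := Rmin_lt_r Hy).
apply Rabs_lt_between in Hy1. apply Rabs_lt_between in Hy2.
intros z Hz. apply A_integrand_cont. pose proof a_plus_bounds.
unfold Rmin, Rmax in Hz. destruct (Rle_dec 0 y); lra.
Qed.

Definition v_of_q (x : R) : R := acos (2 * (1 - a_plus) / (1 - x) - 1).

Lemma v_of_q_arg (x : R) : 0 < x < a_plus ->
  1 - 2 * a_plus < 2 * (1 - a_plus) / (1 - x) - 1 < 1.
Proof.
intros H. pose proof a_plus_bounds.
assert (0 < x * (1 - a_plus)) by (apply Rmult_lt_0_compat; lra).
assert (2 * (1 - a_plus) < 2 * (1 - a_plus) / (1 - x)) by (apply -> Rlt_div_r; lra).
assert (2 * (1 - a_plus) / (1 - x) < 2) by (apply Rlt_div_l; lra). lra.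
Qed.

Lemma cos_v_of_q (x : R) : 0 < x < a_plus -> cos (v_of_q x) = 2 * (1 - a_plus) / (1 - x) - 1.
Proof. intros H. pose proof (v_of_q_arg x H). pose proof a_plus_bounds. apply cos_acos. lra. Qed.

Lemma v_of_q_bounds (x : R) : 0 < x < a_plus -> 0 < v_of_q x < v0.
Proof.
intros H. pose proof (cos_v_of_q x H) as E. pose proof (v_of_q_arg x H) as K.
pose proof (acos_bound (2 * (1 - a_plus) / (1 - x) - 1)) as [B1 B2]. fold (v_of_q x) in B1, B2.
pose proof v0_bounds. pose proof cos_v0. split.
- destruct B1 as [B1|B1]; [exact B1|]. rewrite <- B1, cos_0 in E. lra.
- apply cos_decreasing_0; lra.
Qed.

Lemma q_axis_v_of_q (x : R) : 0 < x < a_plus -> q_axis (v_of_q x) = x.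
Proof.
intros H. unfold q_axis. rewrite cos_v_of_q by exact H. pose proof a_plus_bounds. field. lra.
Qed.

Lemma v_of_q_axis (v : R) : 0 < v < v0 -> 0 < q_axis v < a_plus /\ v_of_q (q_axis v) = v.
Proof.
intros H. pose proof v0_bounds. pose proof a_plus_bounds.
assert (Hv : Rabs v < v0) by (rewrite Rabs_pos_eq; lra).
pose proof (q_axis_bounds v Hv) as B. pose proof (cos_bounds_axis v Hv) as Cb.
assert (C1 : cos v < 1) by (rewrite <- cos_0; apply cos_decreasing_1; lra).
assert (B2 : q_axis v < a_plus).
{ unfold q_axis. assert (1 - a_plus < 2 * (1 - a_plus) / (1 + cos v)); [|lra]. apply Rlt_div_r; nra. }
split; [lra|]. unfold v_of_q.
replace (2 * (1 - a_plus) / (1 - q_axis v) - 1) with (cos v) by (unfold q_axis; field; lra).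
apply acos_cos. lra.
Qed.

Lemma v_of_q_deriv (x : R) : 0 < x < a_plus ->
  is_derive v_of_q x (- (sqrt (1 - a_plus) / ((1 - x) * sqrt (a_plus - x)))).
Proof.
intros H. pose proof (v_of_q_arg x H) as K. pose proof a_plus_bounds as B.
set (g := fun x => 2 * (1 - a_plus) / (1 - x) - 1) in *.
assert (Kx : -1 < g x < 1) by (unfold g; lra).
assert (Dg : is_derive g x (2 * (1 - a_plus) / (1 - x) ^ 2)).
{ unfold g. auto_derive; [lra|field; lra]. }
assert (Da : is_derive acos (g x) (-1 / sqrt (1 - (g x)²))).
{ apply is_derive_Reals. rewrite <- (derive_pt_acos (g x) Kx).
  apply derive_pt_eq_1 with (derivable_pt_acos (g x) Kx). reflexivity. }
pose proof (is_derive_comp acos g x _ _ Da Dg) as D.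
replace (- (sqrt (1 - a_plus) / ((1 - x) * sqrt (a_plus - x)))) with
  (scal (2 * (1 - a_plus) / (1 - x) ^ 2) (-1 / sqrt (1 - (g x)²))); [exact D|].
assert (S1 : 0 < sqrt (1 - a_plus)) by (apply sqrt_lt_R0; lra).
assert (S2 : 0 < sqrt (a_plus - x)) by (apply sqrt_lt_R0; lra).
assert (E : sqrt (1 - (g x)²) = 2 * sqrt (1 - a_plus) * sqrt (a_plus - x) / (1 - x)).
{ apply pow2_inj; [apply sqrt_pos| |].
  - apply Rdiv_le_0_compat; [|lra]. repeat apply Rmult_le_pos; lra.
  - rewrite pow2_sqrt by (unfold Rsqr; nra). unfold Rdiv.
    rewrite !Rpow_mult_distr, !pow2_sqrt by lra. unfold g, Rsqr. field. lra. }
change (scal (2 * (1 - a_plus) / (1 - x) ^ 2) (-1 / sqrt (1 - (g x)²)))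
  with ((2 * (1 - a_plus) / (1 - x) ^ 2) * (-1 / sqrt (1 - (g x)²))).
rewrite E.
pose proof (pow2_sqrt (1 - a_plus) ltac:(lra)) as Q.
set (s := sqrt (1 - a_plus)) in *. rewrite <- Q.
match goal with |- @eq _ ?a ?b => change (@eq R a b) end. field. repeat split; lra.
Qed.

(** The substitution [x = q(iv)]: the factor with [kap] is [dt/du] on the axis, the other one is
    [- dv/dx]. *)
Lemma A_integrand_factor (x : R) : 0 < x < a_plus ->
  A_integrand x = kap * (sqrt x / (sqrt (x + 1) * sqrt (x - a_minus)))
    * (sqrt (1 - a_plus) / ((1 - x) * sqrt (a_plus - x))).
Proof.
intros H. pose proof a_plus_bounds as B. pose proof a_minus_eq.
assert (0 < sqrt x) by (apply sqrt_lt_R0; lra).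
assert (0 < sqrt (x + 1)) by (apply sqrt_lt_R0; lra).
assert (0 < sqrt (x - a_minus)) by (apply sqrt_lt_R0; lra).
assert (0 < sqrt (1 - a_plus)) by (apply sqrt_lt_R0; lra).
assert (0 < sqrt (a_plus - x)) by (apply sqrt_lt_R0; lra).
pose proof kap_pos.
apply pow2_inj.
- apply Rlt_le, A_integrand_pos, H.
- apply Rmult_le_pos; [apply Rmult_le_pos; [lra|]|]; (apply Rdiv_le_0_compat; [lra|]);
    apply Rmult_lt_0_compat; lra.
- unfold A_integrand, Rdiv. rewrite !Rpow_mult_distr, !pow_inv, !Rpow_mult_distr, kap_sqr.
  assert (0 < x / (3 * (x + 1) * (a_plus - x) * (x - a_minus))).
  { apply Rdiv_lt_0_compat; [lra|]. repeat apply Rmult_lt_0_compat; lra. }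
  unfold Rdiv in *. rewrite !pow2_sqrt by lra. field. repeat split; lra.
Qed.

Lemma A_sum_deriv (x : R) : 0 < x < a_plus ->
  is_derive (fun x => A_int x + Im (time (0, v_of_q x))) x 0.
Proof.
intros H. pose proof (v_of_q_bounds x H) as Bv.
assert (Hv : Rabs (v_of_q x) < v0) by (rewrite Rabs_pos_eq; lra).
pose proof (is_derive_comp _ _ x _ _ (time_axis_deriv _ Hv) (v_of_q_deriv x H)) as D.
pose proof (is_derive_plus _ _ x _ _ (A_int_deriv x ltac:(lra)) D) as S.
rewrite dtdu_axis, q_axis_v_of_q, re_RtoC in S by assumption.
match type of S with is_derive _ _ ?l => assert (E : l = 0) end.
{ rewrite A_integrand_factor by exact H. unfold plus, scal; simpl; unfold mult; simpl.
  match goal with |- @eq _ ?a ?b => change (@eq R a b) end. ring. }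
rewrite E in S. exact S.
Qed.

(** The sum of the integral from 0 to [x] and of the height of [t] at [q = x] is constant in [x]; it
    is read at an arbitrary interior point, since the integral up to [a_plus] is improper. *)
Definition A0 : R := A_int (a_plus / 2) + Im (time (0, v_of_q (a_plus / 2))).

Lemma A0_sum (x : R) : 0 < x < a_plus -> A_int x + Im (time (0, v_of_q x)) = A0.
Proof.
intros H. pose proof a_plus_pos.
apply (derive_0_const (fun x => A_int x + Im (time (0, v_of_q x))) 0 a_plus);
  [intros y Hy; apply A_sum_deriv, Hy|lra|lra].
Qed.

Lemma time_axis_A0 (v : R) : 0 < v < v0 -> Im (time (0, v)) = A0 - A_int (q_axis v).
Proof.
intros H. destruct (v_of_q_axis v H) as [B E].
pose proof (A0_sum _ B) as S. rewrite E in S. lra.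
Qed.

Lemma time_axis_lt (v : R) : Rabs v < v0 -> Rabs (Im (time (0, v))) < A0.
Proof.
assert (Z : Im (time (0, 0)) = 0) by apply (time_real 0).
pose proof v0_bounds.
assert (P : forall v, 0 < v < v0 -> 0 < Im (time (0, v)) < A0).
{ intros w Hw. split.
  - assert (K : Im (time (0, 0)) < Im (time (0, w)))
      by (apply time_Im_incr; try apply dom_axis; rewrite ?Rabs_R0, ?Rabs_pos_eq; lra).
    lra.
  - rewrite time_axis_A0 by exact Hw. pose proof (A_int_pos _ (proj1 (v_of_q_axis w Hw))). lra. }
intros Hv. apply Rabs_lt_between in Hv. apply Rabs_lt_between.
pose proof (P (v0 / 2) ltac:(lra)).
destruct (Rtotal_order v 0) as [h|[h|h]].
- pose proof (P (- v) ltac:(lra)) as Q.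
  assert (D : dom (0, v)) by (apply dom_axis, Rabs_lt_between; lra).
  pose proof (time_opp _ D) as E. replace (- (0, v))%C with ((0, - v) : C) in E by (apply C_eq; simpl; ring).
  rewrite E, im_opp in Q. lra.
- rewrite h, Z. lra.
- pose proof (P v ltac:(lra)). lra.
Qed.

Lemma A0_pos : 0 < A0.
Proof.
pose proof v0_bounds. pose proof (time_axis_lt 0 ltac:(rewrite Rabs_R0; lra)) as K.
pose proof (Rabs_pos (Im (time (0, 0)))). lra.
Qed.

Lemma continuity_pt_eps (f : R -> R) (x : R) : continuity_pt f x ->
  forall eps, 0 < eps -> exists d, 0 < d /\ forall y, Rabs (y - x) < d -> Rabs (f y - f x) < eps.
Proof.
intros H eps e0. rewrite continuity_pt_filterlim in H.
destruct (H (ball (f x) (mkposreal eps e0)) (locally_ball _ _)) as [d Hd].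
exists d; split; [apply cond_pos|]. intros y Hy. exact (Hd y Hy).
Qed.

(** The height missing to [A0] is [A_int x], which tends to 0 with [x]. *)
Lemma time_axis_sup (c : R) : c < A0 -> exists v, 0 < v < v0 /\ c < Im (time (0, v)).
Proof.
intros H. pose proof v0_bounds. pose proof a_plus_bounds.
assert (Hc : continuity_pt A_int 0).
{ eapply is_derive_continuity_pt, A_int_deriv. lra. }
destruct (continuity_pt_eps _ _ Hc (A0 - c) ltac:(lra)) as [d [d0 Hd]].
destruct (exists_small a_plus_pos d0) as [x Hx].
exists (v_of_q x). split; [apply v_of_q_bounds; lra|].
pose proof (A0_sum x ltac:(lra)) as S.
assert (K : Rabs (x - 0) < d) by (rewrite Rminus_0_r, Rabs_pos_eq; lra).
specialize (Hd x K). rewrite A_int_0, Rminus_0_r in Hd. apply Rabs_lt_between in Hd. lra.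
Qed.

(** As [x] tends to [a_plus], [v_of_q x] tends to 0, where [time] vanishes and is continuous; so the
    other summand of [A0] tends to 0. *)
Lemma A0_is_RInt_gen : is_RInt_gen A_integrand (at_point 0) (at_left a_plus) A0.
Proof.
pose proof v0_bounds as Bv. pose proof a_plus_bounds as B.
intros P [eps HP].
assert (Hc : continuity_pt (fun y => Im (time (0, y))) 0).
{ eapply is_derive_continuity_pt, time_axis_deriv. rewrite Rabs_R0; lra. }
destruct (continuity_pt_eps _ _ Hc eps (cond_pos eps)) as [d [d0 Hd]].
destruct (exists_small (proj1 Bv) d0) as [v1 Hv1].
destruct (v_of_q_axis v1 ltac:(lra)) as [Bq Eq].
assert (Z : Im (time (0, 0)) = 0) by apply (time_real 0).
apply (Filter_prod _ _ _ (fun x => x = 0) (fun x => q_axis v1 < x < a_plus)).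
- reflexivity.
- assert (p : 0 < a_plus - q_axis v1) by lra.
  exists (mkposreal _ p). intros y Hy Hlt.
  change (Rabs (y - a_plus) < a_plus - q_axis v1) in Hy. apply Rabs_lt_between in Hy. lra.
- intros x y -> Hy. exists (A_int y). split.
  + apply (@RInt_correct R_CompleteNormedModule), A_ex_RInt. simpl in Hy. simpl. lra.
  + apply HP. change (Rabs (A_int y - A0) < eps).
    rewrite <- (A0_sum y) by lra.
    pose proof (v_of_q_bounds y ltac:(lra)) as Bw.
    assert (Hw : v_of_q y < v1).
    { pose proof PI_RGT_0.
      apply cos_decreasing_0; try lra. rewrite cos_v_of_q by lra. rewrite <- Eq at 1.
      rewrite cos_v_of_q by lra.
      apply Rplus_lt_compat_r. apply Rmult_lt_compat_l; [lra|].
      apply Rinv_lt_contravar; nra. }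
    replace (A_int y - (A_int y + Im (time (0, v_of_q y)))) with (- (Im (time (0, v_of_q y)) - Im (time (0, 0))))
      by (rewrite Z; ring).
    rewrite Rabs_Ropp. apply Hd. rewrite Rminus_0_r, Rabs_pos_eq; lra.
Qed.

(** * Inversion of the complex time *)

(** From [exp x >= 1 + x >= 10]. *)
Lemma cosh_large (x : R) : 9 <= x -> 5 <= cosh x.
Proof.
intros H. unfold cosh. pose proof (exp_ineq1_le x). pose proof (exp_pos (- x)). lra.
Qed.

Lemma qu_Re_large (u : C) : Rabs (Im u) < PI / 2 -> 9 <= Re u -> 1 / 2 <= Re (qu u).
Proof.
intros H Hx. pose proof (cosh_large _ Hx) as L. pose proof a_plus_bounds as B.
pose proof (Re_ccosh_pos u H) as P. pose proof (one_ccosh_mod_pos u H) as N.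
rewrite qu_Re by exact H.
assert (K : Re (ccosh u) ^ 2 + Im (ccosh u) ^ 2 = sinh (Re u) ^ 2 + cos (Im u) ^ 2).
{ simpl. pose proof (sin2_cos2 (Im u)) as S. unfold Rsqr in S.
  pose proof (cosh2_sinh2 (Re u)) as Ch.
  set (c := cosh (Re u)) in *. set (h := sinh (Re u)) in *.
  set (a := cos (Im u)) in *. set (b := sin (Im u)) in *.
  assert (b * b = 1 - a * a) by lra. assert (c ^ 2 = 1 + h ^ 2) by lra.
  transitivity (c ^ 2 * (a * a) + h ^ 2 * (b * b)); [ring|]. rewrite H0, H1. ring. }
pose proof (cosh2_sinh2 (Re u)) as Ch.
assert (X : Re (ccosh u) <= cosh (Re u)).
{ simpl. pose proof (COS_bound (Im u)). nra. }
set (c := cosh (Re u)) in *. set (x := Re (ccosh u)) in *. set (y := Im (ccosh u)) in *.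
(* The right-hand side is at least [2 x + c ^ 2], with [x <= c] and [c >= 5]. *)
assert (M : 4 * (1 + x) <= (1 + x) ^ 2 + y ^ 2).
{ pose proof (pow2_ge_0 (cos (Im u))). nra. }
assert (2 * (1 - a_plus) * (1 + x) / ((1 + x) ^ 2 + y ^ 2) <= 1 / 2); [|lra].
apply Rle_div_l; [exact N|]. nra.
Qed.

(** Since [|q| < 1], the two factors of the denominator are at most 4 and 6. *)
Lemma dtdu_sqr_factor_lower (u : C) (k : R) : dom u ->
  k = kap ^ 2 / (((Re (qu u) + 1) ^ 2 + Im (qu u) ^ 2)
       * ((Re (qu u) + 1 + a_plus) ^ 2 + Im (qu u) ^ 2)) -> kap ^ 2 / 24 <= k.
Proof.
intros H ->. pose proof (qu_mod u (proj1 H)) as M. pose proof a_plus_bounds as B.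
pose proof (qu1_Re_pos u (proj1 H)) as R2. rewrite re_plus, re_RtoC in R2.
set (x := Re (qu u)) in *. set (y := Im (qu u)) in *.
assert (P : 0 < kap ^ 2) by (apply pow_lt, kap_pos).
assert (D1 : (x + 1) ^ 2 + y ^ 2 <= 4) by nra.
assert (D2 : (x + 1 + a_plus) ^ 2 + y ^ 2 <= 6) by nra.
assert (D3 : 0 < (x + 1) ^ 2 + y ^ 2) by nra.
assert (D4 : 0 < (x + 1 + a_plus) ^ 2 + y ^ 2) by nra.
apply Rmult_le_compat_l; [lra|]. apply Rinv_le_contravar; [apply Rmult_lt_0_compat; assumption|].
nra.
Qed.

(** The real part of [dtdu u] squared is at least [kap^2 / 24 * 3 / 5 = kap^2 / 40], which exceeds
    [(kap / 7)^2]. *)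
Lemma dtdu_Re_large (u : C) : Rabs (Im u) < PI / 2 -> 9 <= Re u -> kap / 7 <= Re (dtdu u).
Proof.
intros H Hx. assert (D : dom u) by (split; [exact H|left; lra]).
pose proof (qu_Re_large u H Hx) as Q. pose proof (dtdu_Re_pos u D) as P.
destruct (dtdu_sqr_parts u D) as [k [k0 [Ek [E _]]]].
pose proof (dtdu_sqr_factor_lower u k D Ek) as L. pose proof kap_pos as K0. pose proof a_plus_bounds.
set (x := Re (qu u)) in *. set (y := Im (qu u)) in *.
assert (G : 1 / 2 * (6 / 5) <= x * (x ^ 2 + y ^ 2 + (1 + a_plus)) + (2 + a_plus) * (x ^ 2 + y ^ 2)).
{ pose proof (pow2_ge_0 x). pose proof (pow2_ge_0 y). nra. }
assert (F : kap ^ 2 / 24 * (1 / 2 * (6 / 5)) <= Re (dtdu u) ^ 2 - Im (dtdu u) ^ 2).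
{ rewrite E. apply Rmult_le_compat; try lra. apply Rdiv_le_0_compat; [apply pow2_ge_0|lra]. }
apply Rnot_lt_le. intros C1. pose proof (pow2_ge_0 (Im (dtdu u))). nra.
Qed.

Lemma time_Re_large (x y : R) : Rabs y < PI / 2 -> exists z, 0 < z /\ x < Re (time (z, y)).
Proof.
intros Hy. pose proof kap_pos as K.
(* From abscissa 9 on the slope is at least [kap / 7], so this [z] gains more than the missing
   amount. *)
set (z := 10 + 7 * Rabs (x - Re (time (9, y))) / kap).
assert (Hz : 10 <= z).
{ unfold z. assert (0 <= 7 * Rabs (x - Re (time (9, y))) / kap); [|lra].
  apply Rdiv_le_0_compat; [|exact K]. pose proof (Rabs_pos (x - Re (time (9, y)))). lra. }
exists z; split; [lra|].
assert (D9 : dom (9, y)) by (apply dom_right; lra).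
assert (Dz : dom (z, y)) by (apply dom_right; lra).
destruct (time_horizontal 9 z y D9 Dz ltac:(lra)) as [[w [Hw [_ F]]] _].
assert (Q : kap / 7 <= Re (dtdu (w, y))) by (apply dtdu_Re_large; simpl; [exact Hy|lra]).
assert (G : kap / 7 * (z - 9) <= Re (dtdu (w, y)) * (z - 9)) by (apply Rmult_le_compat_r; lra).
assert (I : kap / 7 * (z - 9) = kap / 7 + Rabs (x - Re (time (9, y)))) by (unfold z; field; lra).
pose proof (Rle_abs (x - Re (time (9, y)))). lra.
Qed.

Lemma dom_0 : dom 0.
Proof. apply (dom_axis 0). rewrite Rabs_R0. apply v0_bounds. Qed.

Lemma time_conj_coord (x y : R) : dom (x, y) -> time (x, - y) = Cconj (time (x, y)).
Proof. intros H. rewrite <- time_conj by exact H. reflexivity. Qed.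

Lemma time_Re_le_real (x y : R) : 0 < x -> Rabs y < PI / 2 -> Re (time (x, y)) <= Re (time (x, 0)).
Proof.
intros Hx Hy. apply Rabs_lt_between in Hy as Hy'.
destruct (Rle_dec 0 y) as [h|h].
- apply time_Re_decr; lra.
- rewrite <- (Ropp_involutive y). rewrite time_conj_coord, re_conj.
  + apply time_Re_decr; lra.
  + apply dom_right; [exact Hx|]. rewrite Rabs_Ropp. exact Hy.
Qed.

Lemma time_real_small (e : R) : 0 < e -> exists d, 0 < d /\ forall x, 0 < x < d -> Re (time (x, 0)) < e.
Proof.
intros e0. destruct (cderiv_cont time _ _ (time_cderiv 0 dom_0) e e0) as [d [d0 Hd]].
exists d; split; [exact d0|]. intros x Hx.
specialize (Hd (RtoC x)). rewrite time_0 in Hd.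
replace (RtoC x - 0)%C with (RtoC x) in Hd by ring. rewrite Cmod_R, Rabs_pos_eq in Hd by lra.
specialize (Hd ltac:(lra)). replace (time x - 0)%C with (time x) in Hd by ring.
pose proof (re_le_Cmod (time x)). pose proof (Rle_abs (Re (time x))).
change (time (x, 0)) with (time (RtoC x)). lra.
Qed.

Lemma time_continuity (u : C) (e : R) : dom u -> 0 < e -> exists d, 0 < d /\
  forall x y, Rabs (x - Re u) < d -> Rabs (y - Im u) < d ->
    Rabs (Re (time (x, y)) - Re (time u)) < e /\ Rabs (Im (time (x, y)) - Im (time u)) < e.
Proof.
intros D e0. destruct (cderiv_cont time _ _ (time_cderiv u D) e e0) as [d [d0 Hd]].
exists (d / 2); split; [lra|]. intros x y Hx Hy.
assert (K : Cmod ((x, y) - u)%C < d).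
{ eapply Rle_lt_trans; [apply Cmod_le_Re_Im|]. rewrite re_minus, im_minus. simpl. lra. }
specialize (Hd _ K). rewrite <- re_minus, <- im_minus. split.
- eapply Rle_lt_trans; [apply re_le_Cmod|exact Hd].
- eapply Rle_lt_trans; [apply Im_le_Cmod|exact Hd].
Qed.

Lemma continuity_pt_of_eps (f : R -> R) (x : R) :
  (forall eps, 0 < eps -> exists d, 0 < d /\ forall y, Rabs (y - x) < d -> Rabs (f y - f x) < eps) ->
  continuity_pt f x.
Proof. intros H. apply continuity_pt_filterlim. exact (continuous_eps f x H). Qed.

(** Intermediate values along a horizontal line: for small [z] the real part is dominated by its
    value on the real axis, which is small, and it is unbounded in [z]. *)
Lemma vertical_level (x y : R) : 0 < x -> Rabs y < PI / 2 -> exists z, 0 < z /\ Re (time (z, y)) = x.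
Proof.
intros Hx Hy.
destruct (time_Re_large x y Hy) as [zb [Hzb Lb]].
destruct (time_real_small x Hx) as [d [d0 Hd]].
destruct (exists_small Hzb d0) as [za Hza].
assert (La : Re (time (za, y)) < x).
{ eapply Rle_lt_trans; [apply time_Re_le_real; [lra|exact Hy]|]. apply Hd. lra. }
destruct (IVT_interv (fun z => Re (time (z, y)) - x) za zb) as [z [Hz E]]; try lra.
- intros z Hz. apply continuity_pt_of_eps. intros e e0.
  destruct (time_continuity (z, y) e (dom_right z y ltac:(lra) Hy) e0) as [r [r0 Hr]].
  exists r; split; [exact r0|]. intros w Hw.
  replace (Re (time (w, y)) - x - (Re (time (z, y)) - x)) with (Re (time (w, y)) - Re (time (z, y))) by ring.
  apply Hr; simpl; [exact Hw|]. rewrite Rminus_diag, Rabs_R0. exact r0.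
- exists z. split; lra.
Qed.

(** Comparison with the axis: for [v < v0], [Im t] increases from [(0, v)] to [(z, v)] and then to
    [(z, y)], and its supremum on the axis is [A0]. Strictness comes from moving from [x / 2] to
    [x]. *)
Lemma time_Im_above (x y : R) : 0 < x -> v0 < y < PI / 2 -> A0 < Im (time (x, y)).
Proof.
assert (K : forall x, 0 < x -> v0 < y < PI / 2 -> A0 <= Im (time (x, y))).
{ intros z Hz Hy. apply Rnot_lt_le. intros L.
  pose proof v0_bounds. destruct (time_axis_sup _ L) as [v [Hv Lv]].
  pose proof (time_Im_incr_x 0 z v (dom_axis v ltac:(rewrite Rabs_pos_eq; lra)) ltac:(lra) ltac:(lra)).
  pose proof (time_Im_incr z v y (dom_right z v Hz ltac:(rewrite Rabs_pos_eq; lra))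
    (dom_right z y Hz ltac:(rewrite Rabs_pos_eq; lra)) ltac:(lra) ltac:(lra)). lra. }
intros Hx Hy. pose proof (K (x / 2) ltac:(lra) Hy). pose proof v0_bounds.
pose proof (time_Im_incr_x_strict (x / 2) x y ltac:(lra) ltac:(lra)). lra.
Qed.

(** Beyond [v0] on the axis, [q] is a real [x1] in []-1, 0[], and [csqrt] jumps there. The bound is
    taken from the square of [dtdu], which is continuous: near [i v1] its real part is close to a
    negative number, hence [Im (dtdu u) ^ 2] is bounded below. *)
Lemma dtdu_Im_lower_near (v1 : R) : v0 < v1 < PI / 2 -> exists r m, 0 < r /\ 0 < m /\
  forall x y, 0 < x < r -> v1 <= y < v1 + r -> y < PI / 2 -> m <= Im (dtdu (x, y)).
Proof.
intros Hv. pose proof v0_bounds as Bv. pose proof a_plus_bounds as B.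
assert (H1 : Rabs (Im (0, v1)) < PI / 2) by (simpl; rewrite Rabs_pos_eq; lra).
assert (C0 : 0 < cos v1) by (apply cos_gt_0; lra).
assert (C1 : cos v1 < 1 - 2 * a_plus) by (rewrite <- cos_v0; apply cos_decreasing_1; lra).
set (x1 := 1 - 2 * (1 - a_plus) / (1 + cos v1)).
assert (Q1 : qu (0, v1) = RtoC x1).
{ apply C_eq.
  - rewrite qu_Re, re_RtoC by exact H1. simpl. rewrite cosh_0, sinh_0. unfold x1. field. lra.
  - rewrite qu_Im, im_RtoC by exact H1. simpl. rewrite sinh_0. unfold Rdiv. ring. }
assert (X1 : -1 < x1 < 0).
{ unfold x1. split.
  - assert (2 * (1 - a_plus) / (1 + cos v1) < 2); [|lra]. apply Rlt_div_l; lra.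
  - assert (1 < 2 * (1 - a_plus) / (1 + cos v1)); [|lra]. apply Rlt_div_r; lra. }
set (g := - (x1 * ((x1 + 1) * (x1 + 1 + a_plus)))).
assert (g0 : 0 < g).
{ unfold g. assert (0 < - x1 * ((x1 + 1) * (x1 + 1 + a_plus))); [|lra].
  repeat apply Rmult_lt_0_compat; lra. }
assert (gub : g < 4).
{ unfold g. assert ((x1 + 1) * (x1 + 1 + a_plus) < 2) by nra.
  assert (0 < (x1 + 1) * (x1 + 1 + a_plus)) by (apply Rmult_lt_0_compat; lra). nra. }
(* With this tolerance the four error terms below are at most
   [(3 + 1 + 1.21 + 6.63) g / 24 < g / 2]. *)
destruct (cderiv_cont qu _ _ (qu_cderiv (0, v1) H1) (g / 24) ltac:(lra)) as [d [d0 Hd]].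
pose proof kap_pos as K0.
assert (M0 : 0 < kap ^ 2 / 24 * (g / 2)).
{ apply Rmult_lt_0_compat; [|lra]. apply Rdiv_lt_0_compat; [apply pow_lt, K0|lra]. }
exists (d / 2), (sqrt (kap ^ 2 / 24 * (g / 2))).
split; [lra|]. split; [apply sqrt_lt_R0, M0|].
intros x y Hx Hy Hy2.
assert (D : dom (x, y)) by (apply dom_right; [lra|rewrite Rabs_pos_eq; lra]).
assert (K : Cmod ((x, y) - (0, v1))%C < d).
{ eapply Rle_lt_trans; [apply Cmod_le_Re_Im|]. rewrite re_minus, im_minus. simpl.
  rewrite !Rabs_pos_eq; lra. }
specialize (Hd _ K). rewrite Q1 in Hd.
pose proof (Rle_lt_trans _ _ _ (re_le_Cmod _) Hd) as R1.
pose proof (Rle_lt_trans _ _ _ (Im_le_Cmod _) Hd) as I1.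
rewrite re_minus, re_RtoC in R1. rewrite im_minus, im_RtoC, Rminus_0_r in I1.
pose proof (qu_mod _ (proj1 D)) as M.
pose proof (dtdu_Im_nonneg _ D (qu_Im_nonneg x y ltac:(lra) ltac:(lra))) as I0.
destruct (dtdu_sqr_parts _ D) as [k [k0 [Ek [E _]]]].
pose proof (dtdu_sqr_factor_lower _ k D Ek) as L. clear Ek.
set (a := Re (qu (x, y))) in *. set (b := Im (qu (x, y))) in *.
apply Rabs_lt_between in R1. apply Rabs_lt_between in I1.
set (e := g / 24) in *. assert (e0 : 0 < e < 1) by (unfold e; lra).
assert (Hb2 : 0 <= b ^ 2 <= e) by (split; [apply pow2_ge_0|nra]).
assert (Ha1 : - 1 < a < 1) by (split; nra).
assert (HN : - (3 * e) <= a ^ 2 + b ^ 2 - x1 ^ 2 <= 3 * e).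
{ replace (a ^ 2 + b ^ 2 - x1 ^ 2) with ((a - x1) * (a + x1) + b ^ 2) by ring. split; nra. }
assert (HG : a * (a ^ 2 + b ^ 2 + (1 + a_plus)) + (2 + a_plus) * (a ^ 2 + b ^ 2) <= - (g / 2)).
{ set (N := a ^ 2 + b ^ 2) in *.
  replace (a * (N + (1 + a_plus)) + (2 + a_plus) * N)
    with (- g + (a * (N - x1 ^ 2) + x1 ^ 2 * (a - x1) + (1 + a_plus) * (a - x1)
       + (2 + a_plus) * (N - x1 ^ 2))) by (unfold g; ring).
  assert (a * (N - x1 ^ 2) <= 3 * e) by nra.
  assert (x1 ^ 2 * (a - x1) <= e).
  { assert (0 <= x1 ^ 2 <= 1) by (split; nra). nra. }
  assert ((1 + a_plus) * (a - x1) <= 121 / 100 * e) by nra.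
  assert ((2 + a_plus) * (N - x1 ^ 2) <= 3 * (221 / 100) * e) by nra.
  unfold e in *. lra. }
set (G := a * (a ^ 2 + b ^ 2 + (1 + a_plus)) + (2 + a_plus) * (a ^ 2 + b ^ 2)) in *.
assert (F : kap ^ 2 / 24 * (g / 2) <= Im (dtdu (x, y)) ^ 2).
{ assert (kap ^ 2 / 24 * (g / 2) <= k * - G).
  { apply Rmult_le_compat; try lra. apply Rdiv_le_0_compat; [apply pow2_ge_0|lra]. }
  pose proof (pow2_ge_0 (Re (dtdu (x, y)))). lra. }
rewrite <- (sqrt_pow2 (Im (dtdu (x, y))) I0). apply sqrt_le_1_alt, F.
Qed.

(** Climbing from height [v1] to [y] just to the right of the cut lowers [Re t] by at least
    [m (y - v1)], whereas its initial value is as small as desired when [x] is small. *)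
Lemma corner_point : exists x y, 0 < x /\ v0 < y < PI / 2 /\ Re (time (x, y)) <= 0.
Proof.
pose proof v0_bounds as Bv.
set (v1 := (v0 + PI / 2) / 2).
assert (Hv : v0 < v1 < PI / 2) by (unfold v1; lra).
destruct (dtdu_Im_lower_near v1 Hv) as [r [m [r0 [m0 Hm]]]].
set (y := v1 + Rmin (r / 2) ((PI / 2 - v1) / 2)).
assert (Hy : v1 < y < PI / 2 /\ y < v1 + r).
{ unfold y, Rmin. destruct (Rle_dec _ _); lra. }
destruct (time_real_small (m * (y - v1)) ltac:(apply Rmult_lt_0_compat; lra)) as [d [d0 Hd]].
destruct (exists_small d0 r0) as [x Hx].
exists x, y. split; [lra|]. split; [lra|].
assert (Dr : forall z, v1 <= z <= y -> dom (x, z)).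
{ intros z Hz. apply dom_right; [lra|]. rewrite Rabs_pos_eq; lra. }
destruct (time_vertical x v1 y) as [w [Hw [_ F]]]; try (apply Dr); try lra.
assert (Q : m <= Im (dtdu (x, w))) by (apply Hm; lra).
pose proof (time_Re_le_real x v1 ltac:(lra) ltac:(rewrite Rabs_pos_eq; lra)).
specialize (Hd x ltac:(lra)). nra.
Qed.

(** At the height of the corner point [(x0, y)], [Re t] increases with the abscissa, so [Re t > 0]
    forces [x >= x0]; there [Im t] is at least its value at [x0], which exceeds [A0]. *)
Lemma margin_exists : exists d, 0 < d /\ exists y, 0 < y < PI / 2 /\
  forall x, 0 < x -> 0 < Re (time (x, y)) -> A0 + d <= Im (time (x, y)).
Proof.
destruct corner_point as [x0 [y [Hx0 [Hy R0]]]]. pose proof v0_bounds.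
exists (Im (time (x0, y)) - A0). split; [pose proof (time_Im_above x0 y Hx0 Hy); lra|].
exists y. split; [lra|]. intros x Hx HR.
assert (D : forall z, 0 < z -> dom (z, y)).
{ intros z Hz. apply dom_right; [exact Hz|]. rewrite Rabs_pos_eq; lra. }
destruct (Rle_dec x0 x) as [h|h].
- pose proof (time_Im_incr_x x0 x y (D x0 Hx0) ltac:(lra) ltac:(lra)). lra.
- pose proof (time_Re_incr x x0 y (D x Hx) ltac:(lra)). lra.
Qed.

Definition margin : R := proj1_sig (constructive_indefinite_description _ margin_exists).

Lemma margin_spec : 0 < margin /\ exists y, 0 < y < PI / 2 /\
  forall x, 0 < x -> 0 < Re (time (x, y)) -> A0 + margin <= Im (time (x, y)).
Proof. exact (proj2_sig (constructive_indefinite_description _ margin_exists)). Qed.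

Lemma quadrant_surjective (x y : R) : 0 < x -> 0 <= y < A0 + margin ->
  exists z w, 0 < z /\ 0 <= w < PI / 2 /\ time (z, w) = (x, y).
Proof.
intros Hx Hy. destruct margin_spec as [_ [E [HE HA]]].
(* The condition on [w] stands under the existential so that choice gives a total function [psi],
   the level line; outside the strip the value 0 is arbitrary. *)
assert (L : forall w, exists z, Rabs w < PI / 2 -> 0 < z /\ Re (time (z, w)) = x).
{ intros w. destruct (Rlt_dec (Rabs w) (PI / 2)) as [h|h].
  - destruct (vertical_level x w Hx h) as [z Hz]. exists z. intros _. exact Hz.
  - exists 0. intros h'. contradiction. }
set (psi := fun w => proj1_sig (constructive_indefinite_description _ (L w))).
assert (Hpsi : forall w, Rabs w < PI / 2 -> 0 < psi w /\ Re (time (psi w, w)) = x).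
{ intros w. exact (proj2_sig (constructive_indefinite_description _ (L w))). }
assert (Habs : forall w, 0 <= w <= E -> Rabs w < PI / 2) by (intros w Hw; rewrite Rabs_pos_eq; lra).
(* [Re t] is below [x] at [psi w - e] and above it at [psi w + e]; this persists at nearby heights,
   and strict monotonicity confines [psi] there to the same interval. *)
assert (Cpsi : forall w, 0 <= w <= E -> forall e, 0 < e -> exists d, 0 < d /\
  forall w', Rabs (w' - w) < d -> Rabs (psi w' - psi w) < e).
{ intros w Hw e0 He0. destruct (Hpsi w (Habs w Hw)) as [P0 PE].
  destruct (exists_small He0 P0) as [e He].
  assert (D : forall z, 0 < z -> dom (z, w)) by (intros z Hz; apply dom_right; [exact Hz|apply Habs, Hw]).
  pose proof (time_Re_incr (psi w - e) (psi w) w (D (psi w - e) ltac:(lra)) ltac:(lra)) as L1.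
  pose proof (time_Re_incr (psi w) (psi w + e) w (D (psi w) ltac:(lra)) ltac:(lra)) as L2.
  destruct (time_continuity (psi w - e, w) (x - Re (time (psi w - e, w))) (D (psi w - e) ltac:(lra)) ltac:(lra)) as [d1 [d10 H1]].
  destruct (time_continuity (psi w + e, w) (Re (time (psi w + e, w)) - x) (D (psi w + e) ltac:(lra)) ltac:(lra)) as [d2 [d20 H2]].
  exists (Rmin (Rmin d1 d2) (PI / 2 - Rabs w)). split.
  { repeat apply Rmin_pos; try assumption. pose proof (Habs w Hw). lra. }
  intros w' Hw'.
  assert (Hw12 := Rlt_le_trans _ _ _ Hw' (Rmin_l _ _)).
  assert (Hw3 := Rlt_le_trans _ _ _ Hw' (Rmin_r _ _)).
  destruct (H1 (psi w - e) w') as [K1 _]; simpl;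
    [rewrite Rminus_diag, Rabs_R0; exact d10|exact (Rmin_lt_l Hw12)|].
  destruct (H2 (psi w + e) w') as [K2 _]; simpl;
    [rewrite Rminus_diag, Rabs_R0; exact d20|exact (Rmin_lt_r Hw12)|].
  apply Rabs_lt_between in K1. apply Rabs_lt_between in K2.
  assert (Aw' : Rabs w' < PI / 2) by (pose proof (Rabs_triang_inv w' w); lra).
  destruct (Hpsi w' Aw') as [P0' PE'].
  assert (D' : forall z, 0 < z -> dom (z, w')) by (intros z Hz; apply dom_right; assumption).
  apply Rlt_le_trans with e; [|lra]. apply Rabs_lt_between. split.
  - apply Rnot_le_lt. intros h. destruct (Req_dec (psi w') (psi w - e)) as [h'|h'].
    + rewrite h' in PE'. lra.
    + pose proof (time_Re_incr (psi w') (psi w - e) w' (D' (psi w') ltac:(lra)) ltac:(lra)). lra.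
  - apply Rnot_le_lt. intros h. destruct (Req_dec (psi w') (psi w + e)) as [h'|h'].
    + rewrite h' in PE'. lra.
    + pose proof (time_Re_incr (psi w + e) (psi w') w' (D' (psi w + e) ltac:(lra)) ltac:(lra)). lra. }
assert (Fin : forall w, 0 <= w <= E -> Im (time (psi w, w)) = y ->
  exists z w, 0 < z /\ 0 <= w < PI / 2 /\ time (z, w) = (x, y)).
{ intros w Hw Ey. destruct (Hpsi w (Habs w Hw)) as [P0 PE].
  exists (psi w), w. split; [exact P0|]. split; [lra|]. apply C_eq; assumption. }
assert (Z : Im (time (psi 0, 0)) = 0) by apply (time_real (psi 0)).
destruct (Req_dec y 0) as [y0|y0].
{ apply (Fin 0); lra. }
destruct (Hpsi E (Habs E ltac:(lra))) as [PE0 PEE].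
pose proof (HA (psi E) PE0 ltac:(lra)) as TE.
destruct (IVT_interv (fun w => Im (time (psi w, w)) - y) 0 E) as [w [Hw Ew]]; try lra.
- intros w Hw. apply continuity_pt_of_eps. intros e e0.
  destruct (Hpsi w (Habs w Hw)) as [P0 PE].
  destruct (time_continuity (psi w, w) e (dom_right _ _ P0 (Habs w Hw)) e0) as [r [r0 Hr]].
  destruct (Cpsi w Hw r r0) as [d [d0 Hd]].
  exists (Rmin r d); split; [apply Rmin_pos; assumption|]. intros w' Hw'.
  replace (Im (time (psi w', w')) - y - (Im (time (psi w, w)) - y))
    with (Im (time (psi w', w')) - Im (time (psi w, w))) by ring.
  apply Hr; simpl.
  + apply Hd. eapply Rlt_le_trans; [exact Hw'|apply Rmin_r].
  + eapply Rlt_le_trans; [exact Hw'|apply Rmin_l].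
- apply (Fin w); lra.
Qed.

(* A cut strip wider than the strip of the theorem: a single extension of [q] to this set serves all the boundary claims. *)
Definition cut_strip : C -> Prop := cut (A0 + margin) A0.

(** * The inverse of the time on the cut strip and the extension of [q] *)

Lemma axis_surjective (y : R) : Rabs y < A0 -> exists v, Rabs v < v0 /\ time (0, v) = (0, y).
Proof.
intros H. pose proof v0_bounds as Bv. pose proof (Rabs_pos y) as Py.
destruct (time_axis_sup _ H) as [v [Hv Lv]].
assert (Av : Rabs v < v0) by (rewrite Rabs_pos_eq; lra).
assert (E : Im (time (0, - v)) = - Im (time (0, v))).
{ rewrite time_conj_coord by (apply dom_axis, Av). apply im_conj. }
destruct (IVT_interv (fun w => Im (time (0, w)) - y) (- v) v) as [w [Hw Ew]].
- intros a Ha. apply continuity_pt_minus; [|apply continuity_pt_const; intros x1 x2; reflexivity].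
  eapply is_derive_continuity_pt, time_axis_deriv. apply Rabs_lt_between. lra.
- lra.
- rewrite E. pose proof (Rle_abs (- y)). rewrite Rabs_Ropp in *. lra.
- pose proof (Rle_abs y). lra.
- assert (Aw : Rabs w < v0) by (apply Rabs_lt_between; lra).
  exists w; split; [exact Aw|]. apply C_eq; simpl; [apply time_axis, Aw|lra].
Qed.

Lemma right_surjective (t : C) : 0 < Re t -> Rabs (Im t) < A0 + margin ->
  exists u, dom u /\ 0 < Re u /\ time u = t.
Proof.
intros H H'. destruct (Rle_dec 0 (Im t)) as [h|h].
- rewrite Rabs_pos_eq in H' by exact h.
  destruct (quadrant_surjective (Re t) (Im t) H ltac:(lra)) as [z [w [Hz [Hw E]]]].
  exists (z, w). split; [apply dom_right; [exact Hz|rewrite Rabs_pos_eq; lra]|].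
  split; [exact Hz|]. rewrite E. apply C_eq; reflexivity.
- rewrite Rabs_left in H' by lra.
  destruct (quadrant_surjective (Re t) (- Im t) H ltac:(lra)) as [z [w [Hz [Hw E]]]].
  assert (D : dom (z, w)) by (apply dom_right; [exact Hz|rewrite Rabs_pos_eq; lra]).
  exists (Cconj (z, w)). split; [apply cut_conj, D|]. split; [exact Hz|].
  rewrite time_conj, E by exact D. apply C_eq; simpl; [reflexivity|]. unfold Im. ring.
Qed.

(** Selects one preimage: [time] is injective on each closed half of the domain, but the images of
    the two halves overlap. *)
Definition same_side (u t : C) : Prop :=
  (0 < Re t -> 0 < Re u) /\ (Re t < 0 -> Re u < 0) /\ (Re t = 0 -> Re u = 0).

Lemma cut_strip_surjective (t : C) : exists u, cut_strip t -> dom u /\ same_side u t /\ time u = t.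
Proof.
destruct (classic (cut_strip t)) as [[H1 H2]|N]; [|exists 0; intros h; contradiction].
destruct (Rtotal_order (Re t) 0) as [h|[h|h]].
- destruct (right_surjective (- t)%C) as [u [D [R E]]].
  + rewrite re_opp. lra.
  + rewrite im_opp, Rabs_Ropp. exact H1.
  + exists (- u)%C. intros _. split; [apply cut_opp, D|].
    rewrite time_opp, E by exact D. split; [|ring].
    unfold same_side. rewrite re_opp. lra.
- destruct H2 as [H2|H2]; [contradiction|].
  destruct (axis_surjective _ H2) as [v [Hv E]].
  exists (0, v). intros _. split; [apply dom_axis, Hv|]. split.
  + unfold same_side. simpl. lra.
  + rewrite E. apply C_eq; simpl; [symmetry; exact h|reflexivity].
- destruct (right_surjective t h H1) as [u [D [R E]]].
  exists u. intros _. split; [exact D|]. split; [|exact E]. unfold same_side. lra.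
Qed.

Definition coord (t : C) : C := proj1_sig (constructive_indefinite_description _ (cut_strip_surjective t)).

Lemma coord_spec (t : C) : cut_strip t -> dom (coord t) /\ same_side (coord t) t /\ time (coord t) = t.
Proof. exact (proj2_sig (constructive_indefinite_description _ (cut_strip_surjective t))). Qed.

Lemma coord_unique (t u : C) : cut_strip t -> dom u -> same_side u t -> time u = t -> u = coord t.
Proof.
intros Ht D S E. destruct (coord_spec t Ht) as [D' [S' E']].
destruct S as [S1 [S2 S3]], S' as [S1' [S2' S3']].
assert (Et : time u = time (coord t)) by congruence.
destruct (Rtotal_order (Re t) 0) as [h|[h|h]].
- specialize (S2 h). specialize (S2' h).
  assert (K : (- u)%C = (- coord t)%C).
  { apply time_inj_right; try apply cut_opp; try assumption; rewrite ?re_opp; try lra.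
    rewrite !time_opp by assumption. rewrite Et. reflexivity. }
  replace u with (- - u)%C by ring. rewrite K. ring.
- apply time_inj_right; try assumption; [specialize (S3 h)|specialize (S3' h)]; lra.
- apply time_inj_right; try assumption; [specialize (S1 h)|specialize (S1' h)]; lra.
Qed.

Lemma coord_opp (t : C) : cut_strip t -> coord (- t)%C = (- coord t)%C.
Proof.
intros H. destruct (coord_spec t H) as [D [S E]]. symmetry.
apply coord_unique; [apply cut_opp, H|apply cut_opp, D| |rewrite time_opp, E by exact D; reflexivity].
unfold same_side in *. rewrite !re_opp. repeat split; intros; [apply proj2 in S; apply proj1 in S|apply proj1 in S|
  apply proj2 in S; apply proj2 in S]; assert (K := S ltac:(lra)); lra.
Qed.

Lemma coord_conj (t : C) : cut_strip t -> coord (Cconj t) = Cconj (coord t).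
Proof.
intros H. destruct (coord_spec t H) as [D [S E]]. symmetry.
apply coord_unique; [apply cut_conj, H|apply cut_conj, D| |rewrite time_conj, E by exact D; reflexivity].
unfold same_side in *. rewrite !re_conj. exact S.
Qed.

Lemma Re_conj_le (d z : C) (c : R) : 0 < Cmod d -> c * Cmod d <= Re (Cconj d * z)%C -> c <= Cmod z.
Proof.
intros H K. apply Rmult_le_reg_r with (Cmod d); [exact H|].
eapply Rle_trans; [exact K|]. eapply Rle_trans; [apply Rle_abs|].
eapply Rle_trans; [apply re_le_Cmod|]. rewrite Cmod_mult, Cmod_conj. lra.
Qed.

(* Beyond distance [r] from [u0] the segment towards [u] still gains what it gains inside
   the disc of radius [r], since [Re time' > 0] all along it. *)
Lemma time_expand_right (u0 : C) : dom u0 -> 0 <= Re u0 ->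
  exists m r, 0 < m /\ 0 < r /\ forall u, dom u -> 0 <= Re u ->
    m * Rmin (Cmod (u - u0)%C) r <= Cmod (time u - time u0)%C.
Proof.
intros D0 R0. destruct dtdu_twice as [W1 HW]. destruct (HW u0 D0) as [CW _]. clear HW.
pose proof (dtdu_Re_pos u0 D0) as P0.
destruct (cderiv_cont dtdu _ _ CW (Re (dtdu u0) / 2) ltac:(lra)) as [r [r0 Hr]].
exists (Re (dtdu u0) / 2), (r / 2). split; [lra|]. split; [lra|].
assert (HW : forall w, Cmod (w - u0)%C < r -> Re (dtdu u0) / 2 <= Re (dtdu w)).
{ intros w Hw. specialize (Hr w Hw). pose proof (re_le_Cmod (dtdu w - dtdu u0)%C) as Q.
  rewrite re_minus in Q. apply Rabs_le_between in Q. lra. }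
set (m := Re (dtdu u0) / 2) in *. assert (m0 : 0 < m) by (unfold m; lra).
assert (Near : forall u, dom u -> 0 <= Re u -> Cmod (u - u0)%C < r ->
  m * Cmod (u - u0)%C ^ 2 <= Re (Cconj (u - u0) * (time u - time u0))%C).
{ intros u D R Hu.
  destruct (segment_mvt time dtdu u0 u (u - u0)%C) as [s [Hs E]].
  { intros s Hs. apply time_cderiv, dom_segment; assumption. }
  rewrite E. set (w := (u0 + RtoC s * (u - u0))%C).
  assert (Hw : m <= Re (dtdu w)).
  { apply HW. unfold w. replace (u0 + RtoC s * (u - u0) - u0)%C with (RtoC s * (u - u0))%C by ring.
    rewrite Cmod_mult, Cmod_R, Rabs_pos_eq by lra. pose proof (Cmod_ge_0 (u - u0)%C). nra. }
  replace (Cconj (u - u0) * (dtdu w * (u - u0)))%C with (dtdu w * (Cconj (u - u0) * (u - u0)))%C by ring.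
  rewrite (Cmult_comm (Cconj (u - u0)) (u - u0)), <- Cmod2_conj, re_scal_r.
  apply Rmult_le_compat_r; [apply pow2_ge_0|exact Hw]. }
intros u D R.
destruct (Ceq_dec u u0) as [h|h].
{ subst u. replace (u0 - u0)%C with (RtoC 0) by ring. rewrite Cmod_0, Rmin_left by lra.
  rewrite Rmult_0_r. apply Cmod_ge_0. }
assert (d0 : 0 < Cmod (u - u0)%C) by (apply Cmod_gt_0, Cminus_eq_contra, h).
apply (Re_conj_le (u - u0)%C); [exact d0|].
destruct (Rle_dec (Cmod (u - u0)%C) (r / 2)) as [g|g].
- rewrite Rmin_left by exact g. pose proof (Near u D R ltac:(lra)). lra.
- rewrite Rmin_right by lra.
  set (d := (u - u0)%C) in *. set (s := r / 2 / Cmod d).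
  assert (Hs : 0 < s < 1).
  { unfold s. split; [apply Rdiv_lt_0_compat; lra|]. apply Rlt_div_l; lra. }
  assert (Es : s * Cmod d = r / 2) by (unfold s; field; lra).
  set (w := (u0 + RtoC s * d)%C).
  assert (Dw : dom w) by (unfold w, d; apply dom_segment; try assumption; lra).
  assert (Rw : 0 <= Re w).
  { unfold w, d. rewrite re_plus, re_scal_l, re_minus. nra. }
  assert (Ew : (w - u0)%C = (RtoC s * d)%C) by (unfold w; ring).
  assert (Mw : Cmod (w - u0)%C = r / 2).
  { rewrite Ew, Cmod_mult, Cmod_R, Rabs_pos_eq by lra. exact Es. }
  pose proof (Near w Dw Rw ltac:(lra)) as N1. rewrite Mw, Ew in N1.
  rewrite Cmult_conj, RtoC_conj, <- Cmult_assoc, re_scal_l in N1.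
  assert (Ew2 : (u - w)%C = (RtoC (1 - s) * d)%C) by (rewrite RtoC_minus; unfold w, d; ring).
  assert (Nw : w <> u).
  { intros E. rewrite E in Ew2. replace (u - u)%C with (RtoC 0) in Ew2 by ring.
    apply (f_equal Cmod) in Ew2. rewrite Cmod_0, Cmod_mult, Cmod_R, Rabs_pos_eq in Ew2 by lra.
    assert (0 < (1 - s) * Cmod d) by (apply Rmult_lt_0_compat; lra). lra. }
  pose proof (time_segment_pos w u Dw D Rw R Nw) as N2.
  rewrite Ew2, Cmult_conj, RtoC_conj, <- Cmult_assoc, re_scal_l in N2.
  replace (time u - time u0)%C with ((time u - time w) + (time w - time u0))%C by ring.
  rewrite Cmult_plus_distr_l, re_plus.
  set (a := Re (Cconj d * (time u - time w))%C) in *. set (b := Re (Cconj d * (time w - time u0))%C) in *.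
  assert (0 < a) by nra.
  assert (m * (r / 2) * Cmod d <= b); [|lra].
  apply Rmult_le_reg_l with s; [lra|].
  replace (s * (m * (r / 2) * Cmod d)) with (m * (r / 2) * (s * Cmod d)) by ring.
  rewrite Es. lra.
Qed.

(** The side condition puts both points in a common closed half of the domain; the left half follows
    by oddness. *)
Lemma time_expand (u0 : C) : dom u0 ->
  exists m r, 0 < m /\ 0 < r /\ forall u, dom u ->
    (Re u0 = 0 \/ 0 < Re u * Re u0) ->
    m * Rmin (Cmod (u - u0)%C) r <= Cmod (time u - time u0)%C.
Proof.
intros D0.
assert (Half : exists m r, 0 < m /\ 0 < r /\ forall u, dom u ->
   (0 <= Re u0 /\ 0 <= Re u) \/ (Re u0 <= 0 /\ Re u <= 0) ->
   m * Rmin (Cmod (u - u0)%C) r <= Cmod (time u - time u0)%C).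
{ assert (Pos : forall u0, dom u0 -> exists m r, 0 < m /\ 0 < r /\ forall u, dom u ->
   0 <= Re u0 -> 0 <= Re u -> m * Rmin (Cmod (u - u0)%C) r <= Cmod (time u - time u0)%C).
  { intros a Da. destruct (Rle_dec 0 (Re a)) as [h|h].
    - destruct (time_expand_right a Da h) as [m [r [m0 [r0 H]]]].
      exists m, r. repeat split; try assumption. intros u Du _. apply H, Du.
    - exists 1, 1. repeat split; try lra. intros; contradiction. }
  destruct (Pos u0 D0) as [m1 [r1 [m10 [r10 H1]]]].
  destruct (Pos (- u0)%C (cut_opp _ _ _ D0)) as [m2 [r2 [m20 [r20 H2]]]].
  exists (Rmin m1 m2), (Rmin r1 r2). split; [apply Rmin_pos; assumption|].
  split; [apply Rmin_pos; assumption|].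
  assert (Mon : forall x, 0 <= x -> Rmin m1 m2 * Rmin x (Rmin r1 r2) <= m1 * Rmin x r1 /\
     Rmin m1 m2 * Rmin x (Rmin r1 r2) <= m2 * Rmin x r2).
  { intros x Hx. assert (0 < Rmin m1 m2) by (apply Rmin_pos; assumption).
    assert (0 <= Rmin x (Rmin r1 r2)) by (apply Rmin_glb; [exact Hx|apply Rlt_le, Rmin_pos; assumption]).
    split; apply Rmult_le_compat; try lra; try apply Rmin_l; try apply Rmin_r;
      apply Rle_min_compat_l; [apply Rmin_l|apply Rmin_r]. }
  intros u D [[A B]|[A B]].
  - eapply Rle_trans; [apply (proj1 (Mon _ (Cmod_ge_0 _)))|]. apply H1; assumption.
  - eapply Rle_trans; [apply (proj2 (Mon _ (Cmod_ge_0 _)))|].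
    replace (Cmod (u - u0)%C) with (Cmod (- u - - u0)%C) by (rewrite <- Cmod_opp; f_equal; ring).
    replace (Cmod (time u - time u0)%C) with (Cmod (time (- u) - time (- u0))%C)
      by (rewrite !time_opp by assumption; rewrite <- Cmod_opp; f_equal; ring).
    apply H2; [apply cut_opp, D| |]; rewrite re_opp; lra. }
destruct Half as [m [r [m0 [r0 H]]]]. exists m, r. split; [exact m0|]. split; [exact r0|].
intros u D K. apply H; [exact D|].
destruct K as [K|K].
- rewrite K. lra.
- destruct (Rle_dec 0 (Re u0)); [left|right]; split; nra.
Qed.

(** Inverse function rule: [time_expand] makes [coord] Lipschitz at [t] without prior continuity,
    and its remainder is minus that of [time] divided by [dtdu (coord t)]. *)
Lemma coord_cderiv (t : C) : cut_strip t -> cderiv coord t (/ dtdu (coord t))%C.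
Proof.
intros H eps e0. destruct (coord_spec t H) as [D [S E]].
destruct (cut_open _ _ t H) as [r1 [r10 H1]].
destruct (time_expand (coord t) D) as [m [r [m0 [r0 HT]]]].
pose proof (Re_pos_neq_0 _ (dtdu_Re_pos _ D)) as NW.
set (u0 := coord t) in *.
assert (Mw : 0 < Cmod (dtdu u0)) by (apply Cmod_gt_0, NW).
destruct (time_cderiv u0 D (eps * (m * Cmod (dtdu u0)))) as [r2 [r20 H2]].
{ repeat apply Rmult_lt_0_compat; assumption. }
(* Off the axis the sign of the real part persists near [t], so [coord w] and [coord t] stay in the
   same half. *)
assert (Hside : exists r3, 0 < r3 /\ forall w, Cmod (w - t)%C < r3 -> Re t = 0 \/ 0 < Re w * Re t).
{ destruct (Req_dec (Re t) 0) as [h|h].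
  - exists 1. split; [lra|]. intros w _. left. exact h.
  - exists (Rabs (Re t)). split; [apply Rabs_pos_lt, h|]. intros w Hw. right.
    pose proof (Rle_lt_trans _ _ _ (re_le_Cmod _) Hw) as Q. rewrite re_minus in Q.
    unfold Rabs in Q. destruct (Rcase_abs (Re w - Re t)), (Rcase_abs (Re t)); nra. }
destruct Hside as [r3 [r30 H3]].
exists (Rmin (Rmin r1 r3) (m * Rmin r r2)). split.
{ repeat apply Rmin_pos; try assumption. apply Rmult_lt_0_compat; [exact m0|apply Rmin_pos; assumption]. }
intros w Hw.
assert (Hw13 := Rmin_lt_l Hw).
assert (Hw2 := Rmin_lt_r Hw).
assert (Cw : cut_strip w) by (apply H1; exact (Rmin_lt_l Hw13)).
destruct (coord_spec w Cw) as [Du [Su Eu]]. set (u := coord w) in *.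
assert (K : m * Rmin (Cmod (u - u0)%C) r <= Cmod (w - t)%C).
{ rewrite <- Eu, <- E.
  assert (Side : Re t = 0 \/ 0 < Re w * Re t)
    by (apply H3; exact (Rmin_lt_r Hw13)).
  assert (Side' : Re u0 = 0 \/ 0 < Re u * Re u0).
  { destruct Side as [h|h].
    - left. apply S, h.
    - right. destruct (Rtotal_order (Re t) 0) as [g|[g|g]].
      + pose proof (proj1 (proj2 S) g). pose proof (proj1 (proj2 Su) ltac:(nra)). nra.
      + rewrite g in h. lra.
      + pose proof (proj1 S g). pose proof (proj1 Su ltac:(nra)). nra. }
  apply HT; [exact Du|exact Side']. }
assert (Rr : Rmin r r2 <= r) by apply Rmin_l. assert (Rr2 : Rmin r r2 <= r2) by apply Rmin_r.
assert (K1 : m * Cmod (u - u0)%C <= Cmod (w - t)%C).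
{ destruct (Rle_dec (Cmod (u - u0)%C) r) as [h|h].
  - rewrite Rmin_left in K by exact h. exact K.
  - rewrite Rmin_right in K by lra. nra. }
assert (K2 : Cmod (u - u0)%C < r2) by nra.
specialize (H2 u K2). rewrite Eu, E in H2.
replace (u - u0 - / dtdu u0 * (w - t))%C with (- (w - t - dtdu u0 * (u - u0)) / dtdu u0)%C by (field; exact NW).
rewrite Cmod_div, Cmod_opp by exact NW. apply Rle_div_l; [exact Mw|].
eapply Rle_trans; [exact H2|].
replace (eps * (m * Cmod (dtdu u0)) * Cmod (u - u0)%C)
  with (eps * Cmod (dtdu u0) * (m * Cmod (u - u0)%C)) by ring.
replace (eps * Cmod (w - t)%C * Cmod (dtdu u0)) with (eps * Cmod (dtdu u0) * Cmod (w - t)%C) by ring.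
apply Rmult_le_compat_l; [apply Rlt_le, Rmult_lt_0_compat; assumption|exact K1].
Qed.

Definition Qext (t : C) : C := qu (coord t).

Lemma Qext_opp (t : C) : cut_strip t -> Qext (- t)%C = Qext t.
Proof. intros H. unfold Qext. rewrite coord_opp, qu_opp by exact H. reflexivity. Qed.

Lemma Qext_conj (t : C) : cut_strip t -> Qext (Cconj t) = Cconj (Qext t).
Proof.
intros H. unfold Qext. rewrite coord_conj, qu_conj by (try exact H; apply coord_spec, H). reflexivity.
Qed.

Lemma Qext_slit (t : C) : cut_strip t -> slit (Qext t).
Proof. intros H. apply qu_slit, coord_spec, H. Qed.

Definition qu' (u : C) : C := (RtoC (2 * (1 - a_plus)) * csinh u * / ((1 + ccosh u) * (1 + ccosh u)))%C.

Lemma Qext_cderiv (t : C) : cut_strip t -> cderiv Qext t (qu' (coord t) * / dtdu (coord t))%C.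
Proof.
intros H. apply (cderiv_comp qu coord); [apply qu_cderiv, coord_spec, H|apply coord_cderiv, H].
Qed.

(** [same_side] does not constrain [Im u]; the preimage built in the first quadrant has [Im u >= 0],
    and uniqueness identifies it with [coord t]. *)
Lemma Qext_Im_nonneg (t : C) : cut_strip t -> 0 <= Re t -> 0 <= Im t -> 0 <= Im (Qext t).
Proof.
intros H HR HI. destruct (coord_spec t H) as [D [[S1 [_ S3]] E]]. unfold Qext.
destruct HR as [HR|HR].
- destruct (quadrant_surjective (Re t) (Im t) HR) as [z [w [Hz [Hw Ew]]]].
  { destruct H as [H _]. rewrite Rabs_pos_eq in H by exact HI. lra. }
  assert (K : (z, w) = coord t).
  { apply coord_unique; [exact H|apply dom_right; [exact Hz|rewrite Rabs_pos_eq; lra]| |].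
    - unfold same_side. simpl. lra.
    - rewrite Ew. apply C_eq; reflexivity. }
  rewrite <- K. apply qu_Im_nonneg; lra.
- assert (RU : Re (coord t) = 0) by (apply S3; lra).
  destruct D as [_ [D|D]]; [contradiction|].
  replace (coord t) with ((0, Im (coord t)) : C) by (apply C_eq; [symmetry; exact RU|reflexivity]).
  rewrite qu_axis, im_RtoC by exact D. lra.
Qed.

(** * Behaviour at the singularities *)

Lemma ccosh2_csinh2 (z : C) : (csinh z * csinh z)%C = (ccosh z * ccosh z - 1)%C.
Proof.
pose proof (cosh2_sinh2 (Re z)) as Ch. pose proof (sin2_cos2 (Im z)) as Sc. unfold Rsqr in Sc.
apply C_eq; rewrite ?re_minus, ?im_minus, ?re_mult, ?im_mult, ?re_RtoC, ?im_RtoC; simpl.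
- set (c := cosh (Re z)) in *. set (h := sinh (Re z)) in *.
  set (a := cos (Im z)) in *. set (b := sin (Im z)) in *.
  assert (E : c * c = 1 + h * h) by lra. assert (F : b * b = 1 - a * a) by lra.
  transitivity (h * h * (a * a) - c * c * (b * b)); [ring|].
  transitivity (c * c * (a * a) - h * h * (b * b) - 1); [|ring]. rewrite E, F. ring.
- ring.
Qed.

Lemma qu'_sqr (u : C) : Rabs (Im u) < PI / 2 ->
  (qu' u * qu' u)%C = (/ RtoC (1 - a_plus) * ((1 - qu u) * (1 - qu u) * (qu u - RtoC a_plus)))%C.
Proof.
intros H. pose proof (one_ccosh_neq_0 u H) as N. pose proof a_plus_bounds as B.
assert (Ns : RtoC (1 - a_plus) <> 0) by (apply Re_pos_neq_0; rewrite re_RtoC; lra).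
replace (RtoC a_plus) with (1 - RtoC (1 - a_plus))%C by (rewrite <- RtoC_minus; f_equal; ring).
unfold qu', qu. rewrite RtoC_mult.
transitivity (2 * RtoC (1 - a_plus) * (2 * RtoC (1 - a_plus)) * (csinh u * csinh u)
   * / ((1 + ccosh u) * (1 + ccosh u) * ((1 + ccosh u) * (1 + ccosh u))))%C; [field; exact N|].
rewrite ccosh2_csinh2. field. split; assumption.
Qed.

(* [sqrt q * dq/dt], which stays regular where [q] vanishes. *)
Definition q_speed (t : C) : C := (csqrt (Qext t) * (qu' (coord t) * / dtdu (coord t)))%C.

Lemma Qext_mod (t : C) : cut_strip t -> Cmod (Qext t) < 1.
Proof.
intros H. pose proof (qu_mod (coord t) (proj1 (proj1 (coord_spec t H)))) as M.
rewrite <- Cmod2_alt in M. unfold Qext. pose proof (Cmod_ge_0 (qu (coord t))). nra.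
Qed.

Lemma Qext_neq_0 (t : C) : cut_strip t -> Qext t <> 0.
Proof.
intros H E. pose proof (csqrt_sqr _ (Qext_slit t H)) as S.
pose proof (csqrt_neq_0 _ (Qext_slit t H)) as N. rewrite E in S, N.
exact (Cmult_neq_0 _ _ N N S).
Qed.

(** The differential equation of [q] multiplied by [q], hence polynomial in [q]; it is the quotient
    of [qu'_sqr] and [dtdu_sqr]. *)
Lemma q_speed_sqr (t : C) : cut_strip t ->
  (q_speed t * q_speed t)%C = (3 * ((1 - Qext t) * (1 - Qext t) * (Qext t - RtoC a_plus)
     * ((Qext t + 1) * (Qext t - RtoC a_minus))))%C.
Proof.
intros H. pose proof (coord_spec t H) as [D _]. pose proof (proj1 D) as H1.
pose proof (dtdu_sqr _ D) as EW. pose proof (qu'_sqr _ H1) as EQ.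
pose proof (csqrt_sqr _ (Qext_slit t H)) as ES.
pose proof (Re_pos_neq_0 _ (dtdu_Re_pos _ D)) as NW.
pose proof (Re_pos_neq_0 _ (qu1_Re_pos _ H1)) as N1.
pose proof (Re_pos_neq_0 _ (qum_Re_pos _ H1)) as N2.
pose proof (Qext_neq_0 t H) as NQ. pose proof a_plus_bounds as B.
assert (Ns : RtoC (1 - a_plus) <> 0) by (apply Re_pos_neq_0; rewrite re_RtoC; lra).
assert (N3 : RtoC 3 <> 0) by (apply Re_pos_neq_0; rewrite re_RtoC; lra).
unfold q_speed.
transitivity (csqrt (Qext t) * csqrt (Qext t) * (qu' (coord t) * qu' (coord t)) * / (dtdu (coord t) * dtdu (coord t)))%C;
  [field; exact NW|].
rewrite ES, EQ, EW, kap_sqr, RtoC_inv, RtoC_mult by lra.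
fold (Qext t) in *. field. repeat split; assumption.
Qed.

(** At [q = 0] the polynomial is [3 a_plus a_minus = - 3 / 4]. The rest is [q] times a Horner form
    bounded by [3 (5/4 + 1/4 + 9/4 + 1) < 15] on the unit disc. *)
Lemma q_speed_sqr_near (t : C) : cut_strip t -> Cmod (q_speed t * q_speed t + RtoC (3 / 4))%C <= 15 * Cmod (Qext t).
Proof.
intros H. rewrite q_speed_sqr by exact H. pose proof (Qext_mod t H) as M.
set (q := Qext t) in *. pose proof (Cmod_ge_0 q) as M0.
pose proof a_plus_root as R.
assert (Ea : ((q - RtoC a_plus) * (q - RtoC a_minus))%C = (q * q + q - RtoC (1 / 4))%C).
{ rewrite a_minus_eq, <- R. rewrite RtoC_plus, RtoC_minus, RtoC_pow, ?RtoC_opp. ring. }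
replace (3 * ((1 - q) * (1 - q) * (q - RtoC a_plus) * ((q + 1) * (q - RtoC a_minus))) + RtoC (3 / 4))%C
  with (q * (3 * (RtoC (5 / 4) + q * (RtoC (1 / 4) + q * (- RtoC (9 / 4) + q * q)))))%C.
- rewrite Cmod_mult, Rmult_comm. apply Rmult_le_compat_r; [exact M0|].
  assert (St : forall c d z, Cmod z <= d -> 0 <= d -> Cmod (RtoC c + q * z)%C <= Rabs c + d).
  { intros c d z Hz Hd. eapply Rle_trans; [apply Cmod_triangle|]. rewrite Cmod_R, Cmod_mult.
    pose proof (Cmod_ge_0 z). nra. }
  rewrite Cmod_mult, Cmod_R, Rabs_pos_eq by lra.
  assert (S1 : Cmod (- RtoC (9 / 4) + q * q)%C <= 9 / 4 + 1).
  { rewrite <- RtoC_opp. eapply Rle_trans; [apply (St _ 1); lra|]. rewrite Rabs_left by lra. lra. }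
  pose proof (St (1 / 4) _ _ S1 ltac:(lra)) as S2. rewrite Rabs_pos_eq in S2 by lra.
  pose proof (St (5 / 4) _ _ S2 ltac:(lra)) as S3. rewrite Rabs_pos_eq in S3 by lra. lra.
- replace ((1 - q) * (1 - q) * (q - RtoC a_plus) * ((q + 1) * (q - RtoC a_minus)))%C
    with ((1 - q) * (1 - q) * (q + 1) * ((q - RtoC a_plus) * (q - RtoC a_minus)))%C by ring.
  rewrite Ea. rewrite !RtoC_div by lra.
  field.
Qed.

Lemma q_speed_bound (t : C) : cut_strip t -> Cmod (q_speed t) <= 9.
Proof.
intros H. pose proof (q_speed_sqr_near t H) as K. pose proof (Qext_mod t H) as M.
pose proof (Cmod_triangle (q_speed t * q_speed t + RtoC (3 / 4))%C (- RtoC (3 / 4))%C) as Tr.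
replace (q_speed t * q_speed t + RtoC (3 / 4) + - RtoC (3 / 4))%C with (q_speed t * q_speed t)%C in Tr by ring.
rewrite Cmod_opp, Cmod_R, Cmod_mult, (Rabs_pos_eq (3 / 4)) in Tr by lra.
pose proof (Cmod_ge_0 (q_speed t)). nra.
Qed.

Definition q32 (t : C) : C := (csqrt (Qext t) * Qext t)%C.

Lemma q32_mod (t : C) : cut_strip t -> Cmod (q32 t) = Cmod (csqrt (Qext t)) ^ 3.
Proof.
intros H. unfold q32. rewrite Cmod_mult. rewrite <- (csqrt_sqr _ (Qext_slit t H)) at 2.
rewrite Cmod_mult. ring.
Qed.

Lemma Qext_mod_csqrt (t : C) : cut_strip t -> Cmod (Qext t) = Cmod (csqrt (Qext t)) ^ 2.
Proof.
intros H. rewrite <- (csqrt_sqr _ (Qext_slit t H)) at 1. rewrite Cmod_mult. ring.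
Qed.

Lemma q32_cderiv (t : C) : cut_strip t -> cderiv q32 t (RtoC (3 / 2) * q_speed t)%C.
Proof.
intros H. pose proof (Qext_cderiv t H) as DQ. pose proof (Qext_slit t H) as S.
pose proof (csqrt_neq_0 _ S) as N.
pose proof (cderiv_mult _ _ t _ _ (cderiv_comp csqrt Qext t _ _ (csqrt_cderiv _ S) DQ) DQ) as D.
replace (RtoC (3 / 2) * q_speed t)%C with
  (/ (2 * csqrt (Qext t)) * (qu' (coord t) * / dtdu (coord t)) * Qext t
   + csqrt (Qext t) * (qu' (coord t) * / dtdu (coord t)))%C; [exact D|].
unfold q_speed. set (d := (qu' (coord t) * / dtdu (coord t))%C).
rewrite <- (csqrt_sqr _ S) at 2. rewrite RtoC_div by lra. field. exact N.
Qed.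

Lemma q_speed_ex_cderiv (t : C) : cut_strip t -> exists l, cderiv q_speed t l.
Proof.
intros H. pose proof (coord_spec t H) as [D _]. pose proof (coord_cderiv t H) as DU.
destruct dtdu_twice as [W1 HW]. destruct (HW _ D) as [DW _].
pose proof (one_ccosh_neq_0 _ (proj1 D)) as N.
eexists. unfold q_speed. apply cderiv_mult.
- apply (cderiv_comp csqrt Qext); [apply csqrt_cderiv, Qext_slit, H|apply Qext_cderiv, H].
- apply cderiv_mult.
  + apply (cderiv_comp qu' coord); [|exact DU]. unfold qu'. apply cderiv_mult.
    * apply cderiv_scal, csinh_cderiv.
    * apply (cderiv_inv (fun u => (1 + ccosh u) * (1 + ccosh u))%C); [apply Cmult_neq_0; exact N|].
      apply cderiv_mult; apply (cderiv_plus (fun _ => RtoC 1)); try apply cderiv_const; apply ccosh_cderiv.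
  + apply (cderiv_comp (fun u => / dtdu u)%C coord); [|exact DU].
    apply cderiv_inv; [apply Re_pos_neq_0, dtdu_Re_pos, D|exact DW].
Qed.

Lemma cut_strip_axis (y : R) : Rabs y < A0 -> cut_strip (0, y).
Proof. intros H. pose proof (proj1 margin_spec). split; simpl; [lra|right; exact H]. Qed.

(** On the axis the integral from 0 to [q] is the distance [r] to the singularity, so [q] is
    controlled by inverting [A_int]. *)
Lemma axis_preimage (r : R) : 0 < r < A0 -> exists v, 0 < v < v0 /\
  coord (0, A0 - r) = (0, v) /\ Qext (0, A0 - r) = RtoC (q_axis v) /\ A_int (q_axis v) = r.
Proof.
intros H. assert (Hc : cut_strip (0, A0 - r)) by (apply cut_strip_axis; rewrite Rabs_pos_eq; lra).
destruct (coord_spec _ Hc) as [D [[_ [_ S]] E]]. specialize (S eq_refl).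
assert (Dv : Rabs (Im (coord (0, A0 - r))) < v0) by (destruct D as [_ [D|D]]; [contradiction|exact D]).
assert (EU : coord (0, A0 - r) = (0, Im (coord (0, A0 - r)))) by (apply C_eq; [exact S|reflexivity]).
set (v := Im (coord (0, A0 - r))) in *.
assert (Hv : 0 < v).
{ apply Rnot_le_lt. intros h.
  assert (K : Im (time (0, v)) <= Im (time (0, 0))).
  { destruct h as [h|h]; [|rewrite h; lra]. apply Rlt_le, time_Im_incr; try lra.
    - apply dom_axis, Dv.
    - apply dom_0. }
  rewrite <- EU, E in K. change (time (0, 0)) with (time (RtoC 0)) in K. rewrite time_real in K. simpl in K. lra. }
assert (Hv2 : v < v0) by (rewrite Rabs_pos_eq in Dv; lra).
exists v. split; [lra|]. split; [exact EU|]. split.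
- unfold Qext. rewrite EU. apply qu_axis, Dv.
- pose proof (time_axis_A0 v ltac:(lra)) as K. rewrite <- EU, E in K. simpl in K. lra.
Qed.

Lemma A_int_incr (x y : R) : 0 < x -> x < y < a_plus -> A_int x < A_int y.
Proof.
intros Hx Hy.
destruct (MVT_gen A_int x y A_integrand) as [c [Hc E]]; rewrite ?Rmin_left, ?Rmax_right in * by lra.
- intros z Hz. apply A_int_deriv. lra.
- intros z Hz. eapply is_derive_continuity_pt, A_int_deriv. lra.
- assert (0 < A_integrand c * (y - x)); [|lra].
  apply Rmult_lt_0_compat; [apply A_integrand_pos|]; lra.
Qed.

Lemma Qext_axis_small (e : R) : 0 < e -> exists d, 0 < d <= A0 /\
  forall r, 0 < r < d -> Cmod (Qext (0, A0 - r)) < e.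
Proof.
intros e0. pose proof a_plus_bounds. pose proof A0_pos.
destruct (exists_small a_plus_pos e0) as [x Hx].
exists (Rmin A0 (A_int x)). split.
{ split; [apply Rmin_pos; [lra|apply A_int_pos; lra]|apply Rmin_l]. }
intros r Hr.
assert (H1 := Rmin_lt_l (proj2 Hr)).
assert (H2 := Rmin_lt_r (proj2 Hr)).
destruct (axis_preimage r ltac:(lra)) as [v [Hv [_ [EQ EA]]]].
destruct (v_of_q_axis v Hv) as [B _].
rewrite EQ, Cmod_R, Rabs_pos_eq by lra.
apply Rnot_le_lt. intros h.
destruct (Rlt_dec x (q_axis v)) as [g|g].
- pose proof (A_int_incr x (q_axis v) ltac:(lra) ltac:(lra)). lra.
- replace (q_axis v) with x in EA by lra. lra.
Qed.

(** On the axis [dq/du] is a positive multiple of [i] and the other factors are positive reals; this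
    selects the sign among the two roots of [- 3 / 4]. *)
Lemma q_speed_axis_Im_pos (r : R) : 0 < r < A0 -> 0 < Im (q_speed (0, A0 - r)).
Proof.
intros H. destruct (axis_preimage r H) as [v [Hv [EU [EQ _]]]].
assert (Av : Rabs v < v0) by (rewrite Rabs_pos_eq; lra).
pose proof (dtdu_Re_pos _ (dom_axis v Av)) as PW.
destruct (v_of_q_axis v Hv) as [B _]. pose proof v0_bounds. pose proof a_plus_bounds.
unfold q_speed. rewrite EQ, EU, csqrt_pos by lra.
rewrite dtdu_axis in PW |- * by exact Av. rewrite re_RtoC in PW.
set (w := kap * (sqrt (q_axis v) / (sqrt (q_axis v + 1) * sqrt (q_axis v - a_minus)))) in *.
assert (E : qu' (0, v) = (RtoC (2 * (1 - a_plus) * sin v / (1 + cos v) ^ 2) * Ci)%C).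
{ assert (P : 0 < cos v) by (apply cos_gt_0; lra).
  assert (Ec : (1 + ccosh (0, v))%C = RtoC (1 + cos v)).
  { apply C_eq; simpl; rewrite ?cosh_0, ?sinh_0; ring. }
  assert (Es : csinh (0, v) = (RtoC (sin v) * Ci)%C).
  { apply C_eq; simpl; rewrite ?cosh_0, ?sinh_0; ring. }
  unfold qu'. rewrite Ec, Es, <- RtoC_mult, <- RtoC_inv by nra.
  unfold Rdiv. rewrite !RtoC_mult.
  replace (/ (1 + cos v) ^ 2) with (/ ((1 + cos v) * (1 + cos v))) by (f_equal; ring). ring. }
rewrite E, <- RtoC_inv by lra.
rewrite im_scal_l, im_scal_r, im_scal_l. simpl.
assert (0 < sin v) by (apply sin_gt_0; lra).
assert (0 < cos v) by (apply cos_gt_0; lra).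
apply Rmult_lt_0_compat; [apply sqrt_lt_R0; lra|].
apply Rmult_lt_0_compat; [|apply Rinv_0_lt_compat; exact PW].
rewrite Rmult_1_r. apply Rdiv_lt_0_compat; [|nra].
repeat apply Rmult_lt_0_compat; lra.
Qed.

(** * Polar coordinates and estimates around [iA] *)

Definition cis (x : R) : C := (cos x, sin x).

Lemma cis_plus (x y : R) : cis (x + y) = (cis x * cis y)%C.
Proof. apply C_eq; unfold cis, Cmult; simpl; rewrite ?cos_plus, ?sin_plus; ring. Qed.

Lemma cis_PI2 : cis (PI / 2) = Ci.
Proof. unfold cis. rewrite cos_PI2, sin_PI2. reflexivity. Qed.

Lemma cis_PI : cis PI = (- RtoC 1)%C.
Proof. unfold cis. rewrite cos_PI, sin_PI. apply C_eq; simpl; ring. Qed.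

Lemma cis_conj (x : R) : Cconj (cis x) = cis (- x).
Proof. apply C_eq; unfold cis; simpl; rewrite ?cos_neg, ?sin_neg; reflexivity. Qed.

Lemma Cmod_cis (x : R) : Cmod (cis x) = 1.
Proof.
pose proof (Cmod2_alt (cis x)) as E. unfold cis in E; simpl in E.
pose proof (sin2_cos2 x) as S. unfold Rsqr in S. fold (cis x) in E.
pose proof (Cmod_ge_0 (cis x)). nra.
Qed.

Lemma polar_cis (c : C) (r x : R) : polar c r x = (c + RtoC r * cis x)%C.
Proof. unfold polar. f_equal. apply C_eq; unfold cis; simpl; ring. Qed.

Lemma polar_vderiv (c : C) (r x : R) : vderiv (polar c r) x (RtoC r * (cis x * Ci))%C.
Proof.
split.
- apply (is_derive_ext (fun x => Re c + r * cos x)); [intros; reflexivity|].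
  simpl. auto_derive; [trivial|]. ring.
- apply (is_derive_ext (fun x => Im c + r * sin x)); [intros; reflexivity|].
  simpl. auto_derive; [trivial|]. ring.
Qed.

Definition top_angle (x : R) : Prop := - (3 * PI / 2) < x < PI / 2.

(** Below [margin] the slit disc stays in the widened strip; below [A0] it does not reach the real
    axis. *)
Definition nu0 : R := Rmin margin A0.

Lemma nu0_bounds : 0 < nu0 /\ nu0 <= margin /\ nu0 <= A0.
Proof.
split; [apply Rmin_pos; [apply margin_spec|apply A0_pos]|].
split; [apply Rmin_l|apply Rmin_r].
Qed.

Lemma polar_axis (r : R) : polar (0, A0) r (- (PI / 2)) = (0, A0 - r).
Proof. apply C_eq; simpl; rewrite ?cos_neg, ?sin_neg, ?cos_PI2, ?sin_PI2; ring. Qed.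

Lemma polar_cut_strip (r x : R) : 0 < r < nu0 -> top_angle x -> cut_strip (polar (0, A0) r x).
Proof.
intros Hr [H1 H2]. pose proof nu0_bounds as [N1 [N2 N3]]. pose proof (SIN_bound x).
pose proof A0_pos.
destruct (Req_dec x (- (PI / 2))) as [E|E].
{ rewrite E, polar_axis. apply cut_strip_axis. rewrite Rabs_pos_eq; lra. }
split; simpl.
- apply Rabs_lt_between. split; nra.
- left. rewrite Rplus_0_l. apply Rmult_integral_contrapositive; split; [lra|].
  destruct (Rlt_dec x (- (PI / 2))) as [h|h].
  + rewrite <- cos_neg. pose proof (cos_lt_0 (- x) ltac:(lra) ltac:(lra)). lra.
  + pose proof (cos_gt_0 x ltac:(lra) ltac:(lra)). lra.
Qed.

(** The mean value inequality is used between distances [s] and [r] from [iA], and [s] tends to 0: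
    nothing is assumed of [f] at [iA] itself. *)
Lemma axis_bound (f f' : C -> C) (r M : R) : 0 < r ->
  (forall s, 0 < s <= r -> cderiv f (0, A0 - s)%R (f' (0, A0 - s)%R) /\ Cmod (f' (0, A0 - s)%R) <= M) ->
  (forall e, 0 < e -> exists d, 0 < d /\ forall s, 0 < s < d -> Cmod (f (0, A0 - s)%R) < e) ->
  Cmod (f (0, A0 - r)%R) <= M * r.
Proof.
intros Hr Hf H0. apply le_epsilon. intros e e0.
destruct (H0 e e0) as [d [d0 Hd]].
destruct (exists_small Hr d0) as [s Hs].
assert (M0 : 0 <= M).
{ destruct (Hf r ltac:(lra)) as [_ K]. pose proof (Cmod_ge_0 (f' (0, A0 - r)%R)). lra. }
assert (E : forall x, ((0, A0) + RtoC x * - Ci)%C = (0, A0 - x)%R) by (intros; apply C_eq; simpl; ring).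
assert (V : forall x, s <= x <= r -> vderiv (fun x => f ((0, A0) + RtoC x * - Ci)%C) x (f' (0, A0 - x)%R * - Ci)%C).
{ intros x Hx. apply (vderiv_comp f (fun x => (0, A0) + RtoC x * - Ci)%C).
  - rewrite E. apply Hf. lra.
  - apply vderiv_line. }
pose proof (curve_mean_value _ _ s r M ltac:(lra) (fun x Hx => V x ltac:(lra))
  (fun x Hx => vderiv_continuity _ _ _ (V x Hx))) as K.
cbv beta in K. rewrite !E in K.
assert (K' : Cmod (f (0, A0 - r)%R - f (0, A0 - s)%R)%C <= M * (r - s)).
{ apply K. intros x Hx. rewrite Cmod_mult, Cmod_opp, Cmod_Ci, Rmult_1_r. apply Hf. lra. }
specialize (Hd s ltac:(lra)).
replace (f (0, A0 - r)%R) with ((f (0, A0 - r)%R - f (0, A0 - s)%R) + f (0, A0 - s)%R)%C by ring.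
eapply Rle_trans; [apply Cmod_triangle|]. nra.
Qed.

(* Inside the slit disc every point is reached from the axis below [iA] along an arc. *)
Lemma polar_bound (f f' : C -> C) (r x M : R) : 0 < r -> top_angle x ->
  (forall s y, 0 < s <= r -> top_angle y ->
     cderiv f (polar (0, A0) s y) (f' (polar (0, A0) s y)) /\ Cmod (f' (polar (0, A0) s y)) <= M) ->
  (forall e, 0 < e -> exists d, 0 < d /\ forall s, 0 < s < d -> Cmod (f (0, A0 - s)%R) < e) ->
  Cmod (f (polar (0, A0) r x)) <= 5 * M * r.
Proof.
intros Hr Hx Hf H0. pose proof PI_RGT_0 as P0. pose proof PI_4 as P4.
assert (T0 : top_angle (- (PI / 2))) by (unfold top_angle; lra).
assert (Ax : Cmod (f (0, A0 - r)%R) <= M * r).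
{ apply (axis_bound f f'); [exact Hr| |exact H0].
  intros s Hs. rewrite <- polar_axis. apply Hf; assumption. }
rewrite <- polar_axis in Ax.
assert (M0 : 0 <= M).
{ destruct (Hf r x ltac:(lra) Hx) as [_ K]. pose proof (Cmod_ge_0 (f' (polar (0, A0) r x))). lra. }
assert (V : forall y, top_angle y -> vderiv (fun y => f (polar (0, A0) r y)) y
   (f' (polar (0, A0) r y) * (RtoC r * (cis y * Ci)))%C).
{ intros y Hy. apply (vderiv_comp f); [apply Hf; [lra|exact Hy]|apply polar_vderiv]. }
assert (B : forall y, top_angle y -> Cmod (f' (polar (0, A0) r y) * (RtoC r * (cis y * Ci)))%C <= M * r).
{ intros y Hy. rewrite !Cmod_mult, Cmod_cis, Cmod_Ci, Cmod_R, Rabs_pos_eq by lra.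
  rewrite !Rmult_1_r. apply Rmult_le_compat_r; [lra|]. apply Hf; [lra|exact Hy]. }
(* The angle to the axis direction [- PI / 2] is less than [PI <= 4]; with the part along the axis
   this gives the factor 5. *)
assert (Arc : Cmod (f (polar (0, A0) r x) - f (polar (0, A0) r (- (PI / 2))))%C <= M * r * 4).
{ unfold top_angle in *.
  assert (0 <= M * r) by (apply Rmult_le_pos; lra).
  destruct (Rle_dec (- (PI / 2)) x) as [h|h].
  - eapply Rle_trans.
    + apply (curve_mean_value (fun y => f (polar (0, A0) r y))
        (fun y => f' (polar (0, A0) r y) * (RtoC r * (cis y * Ci)))%C (- (PI / 2)) x (M * r) h).
      * intros y Hy. apply V. lra.
      * intros y Hy. eapply vderiv_continuity, V. lra.
      * intros y Hy. apply B. lra.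
    + apply Rmult_le_compat_l; lra.
  - rewrite Cmod_minus_sym. eapply Rle_trans.
    + apply (curve_mean_value (fun y => f (polar (0, A0) r y))
        (fun y => f' (polar (0, A0) r y) * (RtoC r * (cis y * Ci)))%C x (- (PI / 2)) (M * r)).
      * lra.
      * intros y Hy. apply V. lra.
      * intros y Hy. eapply vderiv_continuity, V. lra.
      * intros y Hy. apply B. lra.
    + apply Rmult_le_compat_l; lra. }
replace (f (polar (0, A0) r x)) with ((f (polar (0, A0) r x) - f (polar (0, A0) r (- (PI / 2))))
  + f (polar (0, A0) r (- (PI / 2))))%C by ring.
eapply Rle_trans; [apply Cmod_triangle|]. lra.
Qed.

(** The fractional powers of the radius become natural powers of [cbrt r], so polynomial arithmetic
    applies. *)
Definition cbrt (x : R) : R := Rpower x (1 / 3).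

Lemma cbrt_pos (x : R) : 0 < cbrt x.
Proof. apply exp_pos. Qed.

Lemma cbrt_pow (x : R) : 0 < x -> cbrt x ^ 3 = x.
Proof.
intros H. unfold cbrt. rewrite <- Rpower_pow by apply exp_pos. rewrite Rpower_mult.
replace (1 / 3 * INR 3) with 1 by (simpl; field). apply Rpower_1, H.
Qed.

Lemma cbrt_le (x y : R) : 0 < x -> x <= y -> cbrt x <= cbrt y.
Proof. intros H K. apply Rle_Rpower_l; lra. Qed.

Lemma Rpower_cbrt (x : R) (n : nat) : Rpower x (INR n / 3) = cbrt x ^ n.
Proof.
unfold cbrt. rewrite <- Rpower_pow by apply exp_pos. rewrite Rpower_mult. f_equal. field.
Qed.

Lemma pow_le_inv (x y : R) (n : nat) : 0 <= y -> x ^ S n <= y ^ S n -> x <= y.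
Proof.
intros Hy H. apply Rnot_lt_le. intros L.
assert (y ^ S n < x ^ S n); [|lra].
clear H. induction n as [|n IH]; [simpl; lra|].
change (y * y ^ S n < x * x ^ S n).
assert (0 <= y ^ S n) by (apply pow_le, Hy). apply Rmult_le_0_lt_compat; assumption.
Qed.

Lemma q32_axis_limit (e : R) : 0 < e -> exists d, 0 < d /\ forall s, 0 < s < d ->
  Cmod (q32 (0, A0 - s)) < e.
Proof.
intros e0. destruct (Qext_axis_small e e0) as [d [Hd H]].
exists d; split; [lra|]. intros s Hs.
assert (Hc : cut_strip (0, A0 - s)) by (apply cut_strip_axis; rewrite Rabs_pos_eq; lra).
specialize (H s Hs). pose proof (Qext_mod _ Hc) as M. unfold q32. rewrite Cmod_mult.
rewrite Qext_mod_csqrt in * by exact Hc.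
set (w := Cmod (csqrt (Qext (0, A0 - s)))) in *.
assert (0 <= w) by apply Cmod_ge_0. assert (w < 1) by nra. nra.
Qed.

Lemma q32_bound (r x : R) : 0 < r < nu0 -> top_angle x -> Cmod (q32 (polar (0, A0) r x)) <= 135 / 2 * r.
Proof.
intros Hr Hx.
(* [27 / 2] is [3 / 2] times the bound 9 on [q_speed]. *)
replace (135 / 2 * r) with (5 * (27 / 2) * r) by field.
apply (polar_bound q32 (fun t => RtoC (3 / 2) * q_speed t)%C); [lra|exact Hx| |exact q32_axis_limit].
intros s y Hs Hy.
assert (Hc : cut_strip (polar (0, A0) s y)) by (apply polar_cut_strip; [lra|exact Hy]).
split; [apply q32_cderiv, Hc|]. rewrite Cmod_mult, Cmod_R, Rabs_pos_eq by lra.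
pose proof (q_speed_bound _ Hc). lra.
Qed.

(** The cube of the left-hand side is the modulus of [q32], and [135 / 2 <= 5 ^ 3]. *)
Lemma csqrt_Qext_bound (r x : R) : 0 < r < nu0 -> top_angle x ->
  Cmod (csqrt (Qext (polar (0, A0) r x))) <= 5 * cbrt r.
Proof.
intros Hr Hx. pose proof (q32_bound r x Hr Hx) as B.
rewrite q32_mod in B by (apply polar_cut_strip; assumption).
pose proof (cbrt_pos r) as P. pose proof (cbrt_pow r ltac:(lra)) as E.
apply (pow_le_inv _ _ 2); [lra|]. rewrite Rpow_mult_distr, E. lra.
Qed.

Lemma Qext_bound (r x : R) : 0 < r < nu0 -> top_angle x ->
  Cmod (Qext (polar (0, A0) r x)) <= 25 * cbrt r ^ 2.
Proof.
intros Hr Hx. pose proof (csqrt_Qext_bound r x Hr Hx) as B.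
rewrite Qext_mod_csqrt by (apply polar_cut_strip; assumption).
pose proof (Cmod_ge_0 (csqrt (Qext (polar (0, A0) r x)))). pose proof (cbrt_pos r). nra.
Qed.

(** Then [cbrt r < 1 / 30], so [15 |q| <= 15 * 25 / 900], which is less than [3 / 4]. *)
Definition nu1 : R := Rmin nu0 (1 / 27000).

Lemma nu1_bounds : 0 < nu1 /\ nu1 <= nu0 /\ nu1 <= 1 / 27000.
Proof.
split; [apply Rmin_pos; [apply nu0_bounds|lra]|]. split; [apply Rmin_l|apply Rmin_r].
Qed.

Lemma cbrt_small (r : R) : 0 < r < nu1 -> cbrt r < 1 / 30.
Proof.
intros H. pose proof nu1_bounds. pose proof (cbrt_pow r ltac:(lra)) as E.
apply Rnot_le_lt. intros L.
assert ((1 / 30) ^ 3 <= cbrt r ^ 3) by (apply pow_incr; lra). lra.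
Qed.

(* [q_speed ^ 2] is close to [- 3 / 4], so [q_speed] cannot cross the real line along an arc. *)
Lemma q_speed_Im_pos (r x : R) : 0 < r < nu1 -> top_angle x -> 0 < Im (q_speed (polar (0, A0) r x)).
Proof.
intros Hr Hx. pose proof nu1_bounds as N. pose proof nu0_bounds as N0. pose proof PI_RGT_0 as P0.
pose proof (cbrt_small r Hr) as S. pose proof (cbrt_pos r) as P.
assert (Cs : forall y, top_angle y -> cut_strip (polar (0, A0) r y)).
{ intros y Hy. apply polar_cut_strip; [lra|exact Hy]. }
assert (NZ : forall y, top_angle y -> Im (q_speed (polar (0, A0) r y)) <> 0).
{ intros y Hy E. pose proof (q_speed_sqr_near _ (Cs y Hy)) as K.
  pose proof (Qext_bound r y ltac:(lra) Hy) as B.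
  pose proof (Rle_trans _ _ _ (Rle_abs _) (re_le_Cmod (q_speed (polar (0, A0) r y) * q_speed (polar (0, A0) r y) + RtoC (3 / 4))%C)) as Q.
  rewrite re_plus, re_mult, re_RtoC, E in Q. nra. }
assert (Ax : 0 < Im (q_speed (polar (0, A0) r (- (PI / 2))))).
{ rewrite polar_axis. apply q_speed_axis_Im_pos. lra. }
assert (Ct : forall y, top_angle y -> continuity_pt (fun y => Im (q_speed (polar (0, A0) r y))) y).
{ intros y Hy. destruct (q_speed_ex_cderiv _ (Cs y Hy)) as [l Hl].
  eapply vderiv_continuity. apply (vderiv_comp q_speed); [exact Hl|apply polar_vderiv]. }
apply Rnot_le_lt. intros [L|L]; [|exact (NZ x Hx L)].
unfold top_angle in *.
destruct (Rtotal_order (- (PI / 2)) x) as [h|[h|h]].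
- destruct (IVT_interv (fun y => - Im (q_speed (polar (0, A0) r y))) (- (PI / 2)) x) as [y [Hy E]]; try lra.
  + intros y Hy. apply continuity_pt_opp, Ct. lra.
  + apply (NZ y); lra.
- rewrite <- h in L. lra.
- destruct (IVT_interv (fun y => Im (q_speed (polar (0, A0) r y))) x (- (PI / 2))) as [y [Hy E]]; try lra.
  + intros y Hy. apply Ct. lra.
  + apply (NZ y); lra.
Qed.

Definition g0 : R := sqrt 3 / 2.

Lemma g0_facts : g0 ^ 2 = 3 / 4 /\ 5 / 6 < g0 < 1.
Proof.
assert (E : g0 ^ 2 = 3 / 4).
{ unfold g0, Rdiv. rewrite Rpow_mult_distr, pow2_sqrt by lra. field. }
assert (0 <= g0) by (unfold g0; pose proof (sqrt_pos 3); lra).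
split; [exact E|]. split; nra.
Qed.

(** The sum of [3 / 4] and the square of [q_speed] is a product of two factors, and the one with
    [+ g0 i] has modulus at least [5 / 6] because [Im q_speed > 0]; [15 * 25 / (5 / 6) = 450]. *)
Lemma q_speed_near (r x : R) : 0 < r < nu1 -> top_angle x ->
  Cmod (q_speed (polar (0, A0) r x) - RtoC g0 * Ci)%C <= 450 * cbrt r ^ 2.
Proof.
intros Hr Hx. pose proof nu1_bounds as N. pose proof (q_speed_Im_pos r x Hr Hx) as I.
assert (Hc : cut_strip (polar (0, A0) r x)) by (apply polar_cut_strip; [lra|exact Hx]).
pose proof (q_speed_sqr_near _ Hc) as K. pose proof (Qext_bound r x ltac:(lra) Hx) as B.
destruct g0_facts as [Eg Bg].
set (g := q_speed (polar (0, A0) r x)) in *. clearbody g.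
assert (E : (g * g + RtoC (3 / 4))%C = ((g - RtoC g0 * Ci) * (g + RtoC g0 * Ci))%C).
{ rewrite <- Eg, RtoC_pow. apply C_eq; unfold RtoC, Ci, Cpow, Cmult, Cplus, Cminus, Copp; simpl; ring. }
rewrite E, Cmod_mult in K.
assert (L : 5 / 6 <= Cmod (g + RtoC g0 * Ci)%C).
{ eapply Rle_trans; [|apply Im_le_Cmod]. eapply Rle_trans; [|apply Rle_abs].
  rewrite im_plus, im_scal_l. change (Im Ci) with 1. lra. }
pose proof (Cmod_ge_0 (g - RtoC g0 * Ci)%C). nra.
Qed.

(* [q ^ (3 / 2)] is asymptotic to [k0 * i * (t - iA)]: indeed [(q ^ (3 / 2))' = 3 / 2 * sqrt q * q']
   and [sqrt q * q'] tends to [g0 * i]. *)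
Definition k0 : R := 3 / 2 * g0.

Lemma q32_expansion (r x : R) : 0 < r < nu1 -> top_angle x ->
  Cmod (q32 (polar (0, A0) r x) - RtoC (k0 * r) * (Ci * cis x))%C <= 3375 * cbrt r ^ 5.
Proof.
intros Hr Hx. pose proof nu1_bounds as N. pose proof (cbrt_pow r ltac:(lra)) as Ec.
destruct g0_facts as [Eg Bg].
replace (3375 * cbrt r ^ 5) with (5 * (675 * cbrt r ^ 2) * r) by (rewrite <- Ec at 2; ring).
(* Once the linear term is subtracted, the derivative is [3 / 2] times the deviation of [q_speed],
   at most [675 cbrt r ^ 2]. *)
set (f := fun t : C => (q32 t + (- (RtoC k0 * Ci)) * (t - (0, A0)))%C).
assert (Ef : (q32 (polar (0, A0) r x) - RtoC (k0 * r) * (Ci * cis x))%C = f (polar (0, A0) r x)).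
{ unfold f. rewrite polar_cis, RtoC_mult. ring. }
rewrite Ef.
apply (polar_bound f (fun t => RtoC (3 / 2) * (q_speed t - RtoC g0 * Ci))%C); [lra|exact Hx| |].
- intros s y Hs Hy.
  assert (Hc : cut_strip (polar (0, A0) s y)) by (apply polar_cut_strip; [lra|exact Hy]).
  split.
  + replace (RtoC (3 / 2) * (q_speed (polar (0, A0) s y) - RtoC g0 * Ci))%C
      with (RtoC (3 / 2) * q_speed (polar (0, A0) s y) + (- (RtoC k0 * Ci)) * (1 + 0))%C
      by (unfold k0; rewrite RtoC_mult; ring).
    apply cderiv_plus; [apply q32_cderiv, Hc|]. apply cderiv_scal.
    apply (cderiv_plus (fun t => t) (fun _ => - (0, A0))%C); [apply cderiv_id|apply cderiv_const].
  + rewrite Cmod_mult, Cmod_R, Rabs_pos_eq by lra.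
    pose proof (q_speed_near s y ltac:(lra) Hy) as K. pose proof (cbrt_le s r ltac:(lra) ltac:(lra)) as L.
    pose proof (cbrt_pos s). nra.
- intros e e0. destruct (q32_axis_limit (e / 2) ltac:(lra)) as [d [d0 Hd]].
  exists (Rmin d (e / 4)). split; [apply Rmin_pos; lra|]. intros s Hs.
  specialize (Hd s (conj (proj1 Hs) (Rmin_lt_l (proj2 Hs)))).
  assert (Hs2 := Rmin_lt_r (proj2 Hs)).
  unfold f. eapply Rle_lt_trans; [apply Cmod_triangle|].
  replace ((0, A0 - s)%R - (0, A0))%C with (RtoC s * - Ci)%C by (apply C_eq; simpl; ring).
  rewrite !Cmod_mult, !Cmod_opp, Cmod_mult, Cmod_Ci, !Cmod_R, !Rabs_pos_eq by (unfold k0; lra).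
  unfold k0. nra.
Qed.

(* With [0 <= Re (conj e * w)], [w] stays away from the other two cube roots of [e ^ 3]. *)
Lemma cube_root_close (w e : C) : 0 <= Re (Cconj e * w)%C -> e <> 0 ->
  Cmod (w - e)%C * (Cmod e ^ 2 / 4) <= Cmod (w * w * w - e * e * e)%C.
Proof.
intros H N. assert (P : 0 < Cmod e) by (apply Cmod_gt_0, N).
assert (L : forall y : R, Cmod e / 2 <= Cmod (w - ((-1 / 2)%R, y) * e)%C).
{ intros y. apply (Re_conj_le e); [exact P|].
  replace (Cconj e * (w - ((-1 / 2)%R, y) * e))%C with (Cconj e * w - ((-1 / 2)%R, y) * (Cconj e * e))%C by ring.
  rewrite (Cmult_comm (Cconj e) e), <- Cmod2_conj, re_minus, re_scal_r.
  change (Re ((-1 / 2)%R, y)) with (-1 / 2). lra. }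
set (h := sqrt 3 / 2).
assert (Eh : h * h = 3 / 4) by (unfold h; pose proof (sqrt_sqrt 3 ltac:(lra)); lra).
replace (w * w * w - e * e * e)%C with
  ((w - e) * ((w - ((-1 / 2)%R, h) * e) * (w - ((-1 / 2)%R, (- h)%R) * e)))%C.
- rewrite !Cmod_mult. apply Rmult_le_compat_l; [apply Cmod_ge_0|].
  replace (Cmod e ^ 2 / 4) with (Cmod e / 2 * (Cmod e / 2)) by field.
  apply Rmult_le_compat; try lra; apply L.
- assert (Eo : (((-1 / 2)%R, h) * ((-1 / 2)%R, (- h)%R))%C = RtoC 1).
  { apply C_eq; unfold Cmult, RtoC; simpl; lra. }
  assert (Es : (((-1 / 2)%R, h) + ((-1 / 2)%R, (- h)%R))%C = (- RtoC 1)%C).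
  { apply C_eq; unfold Cplus, Copp, RtoC; simpl; lra. }
  set (o1 := ((-1 / 2)%R, h) : C) in *. set (o2 := ((-1 / 2)%R, (- h)%R) : C) in *.
  transitivity ((w - e) * (w * w - (o1 + o2) * (w * e) + o1 * o2 * (e * e)))%C; [ring|].
  rewrite Eo, Es. ring.
Qed.

Lemma csqrt_Im_nonpos (z : C) : slit z -> Im z <= 0 -> Im (csqrt z) <= 0.
Proof.
intros S H. pose proof (csqrt_Im_nonneg _ (slit_conj z S)) as K.
rewrite csqrt_conj, !im_conj in K by exact S. lra.
Qed.

Lemma Qext_Im_nonpos (t : C) : cut_strip t -> Re t <= 0 -> 0 <= Im t -> Im (Qext t) <= 0.
Proof.
intros H HR HI.
pose proof (Qext_Im_nonneg (- Cconj t)%C (cut_opp _ _ _ (cut_conj _ _ _ H))) as K.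
rewrite Qext_opp, Qext_conj in K by (try apply cut_conj; exact H).
rewrite re_opp, im_opp, re_conj, !im_conj in K. lra.
Qed.

Definition kc : R := cbrt k0.

Lemma kc_facts : 0 < kc /\ kc ^ 3 = k0 /\ k0 ^ 2 = 27 / 16.
Proof.
destruct g0_facts as [E B]. split; [apply cbrt_pos|]. split.
- apply cbrt_pow. unfold k0. lra.
- unfold k0. rewrite Rpow_mult_distr, E. field.
Qed.

(** Let [w] be the square root of [q] and [e = kc cbrt r cis ((x + PI / 2) / 3)], a cube root of the
    leading term of [w^3]. Both have positive real part and imaginary parts of the same sign, so [w]
    is near [e] and not near another cube root; then [q - e^2 = (w - e) (w + e)]. *)
Lemma Qext_expansion (r x : R) : 0 < r < nu1 -> top_angle x ->
  Cmod (Qext (polar (0, A0) r x) - RtoC (kc ^ 2 * cbrt r ^ 2) * cis (PI / 3 + 2 * x / 3))%C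
  <= 13500 * (5 + kc) / kc ^ 2 * cbrt r ^ 4.
Proof.
intros Hr Hx. pose proof nu1_bounds as N. pose proof nu0_bounds as N0.
destruct kc_facts as [K0 [K1 _]]. pose proof PI_RGT_0 as P0.
assert (Hc : cut_strip (polar (0, A0) r x)) by (apply polar_cut_strip; [lra|exact Hx]).
pose proof (q32_expansion r x Hr Hx) as B. pose proof (csqrt_Qext_bound r x ltac:(lra) Hx) as Bw.
pose proof (Qext_slit _ Hc) as S. pose proof (csqrt_sqr _ S) as Sq.
pose proof (cbrt_pow r ltac:(lra)) as Er. pose proof (cbrt_pos r) as Pr.
set (p := (x + PI / 2) / 3).
assert (Hp : - (PI / 3) < p < PI / 3) by (unfold p, top_angle in *; lra).
set (e := (RtoC (kc * cbrt r) * cis p)%C).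
assert (Me : Cmod e = kc * cbrt r).
{ unfold e. rewrite Cmod_mult, Cmod_cis, Cmod_R, Rabs_pos_eq by nra. ring. }
assert (E3 : (e * e * e)%C = (RtoC (k0 * r) * (Ci * cis x))%C).
{ unfold e. replace (k0 * r) with ((kc * cbrt r) ^ 3) by (rewrite Rpow_mult_distr, K1, Er; reflexivity).
  rewrite <- cis_PI2, <- cis_plus.
  replace (PI / 2 + x) with (p + p + p) by (unfold p; field). rewrite !cis_plus, RtoC_pow. ring. }
assert (E2 : (RtoC (kc ^ 2 * cbrt r ^ 2) * cis (PI / 3 + 2 * x / 3))%C = (e * e)%C).
{ unfold e. replace (PI / 3 + 2 * x / 3) with (p + p) by (unfold p; field).
  rewrite cis_plus, !RtoC_mult, !RtoC_pow. ring. }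
rewrite E2. unfold q32 in B. rewrite <- E3 in B.
set (w := csqrt (Qext (polar (0, A0) r x))) in *. set (q := Qext (polar (0, A0) r x)) in *.
assert (W0 : 0 < Re w) by (apply csqrt_Re, S).
assert (Re0 : 0 < Re e).
{ unfold e. rewrite re_scal_l. apply Rmult_lt_0_compat; [nra|]. simpl. apply cos_gt_0; lra. }
(* To the right of the axis [Im q >= 0] and the angle [p] is nonnegative; to the left both signs are
   reversed. *)
assert (Hs : 0 <= Im e * Im w).
{ assert (It : 0 <= Im (polar (0, A0) r x)).
  { unfold polar. simpl. pose proof (SIN_bound x). nra. }
  assert (Ie : Im e = kc * cbrt r * sin p) by (unfold e; rewrite im_scal_l; reflexivity).
  assert (kc * cbrt r > 0) by nra.
  unfold top_angle in Hx. destruct (Rle_dec (- (PI / 2)) x) as [h|h].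
  - assert (0 <= Im w).
    { apply csqrt_Im_nonneg; [exact S|]. apply Qext_Im_nonneg; [exact Hc| |exact It].
      unfold polar. simpl. pose proof (cos_ge_0 x ltac:(lra) ltac:(lra)). nra. }
    assert (0 <= sin p) by (apply sin_ge_0; unfold p in *; lra).
    rewrite Ie. apply Rmult_le_pos; [nra|assumption].
  - assert (Im w <= 0).
    { apply csqrt_Im_nonpos; [exact S|]. apply Qext_Im_nonpos; [exact Hc| |exact It].
      unfold polar. simpl. pose proof (cos_le_0 (- x) ltac:(lra) ltac:(lra)) as K. rewrite cos_neg in K. nra. }
    assert (sin p <= 0).
    { pose proof (sin_ge_0 (- p) ltac:(unfold p; lra) ltac:(lra)) as K. rewrite sin_neg in K. lra. }
    rewrite Ie. replace (kc * cbrt r * sin p * Im w) with (kc * cbrt r * (- sin p * - Im w)) by ring.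
    repeat apply Rmult_le_pos; lra. }
assert (N1 : e <> 0) by (apply Re_pos_neq_0, Re0).
pose proof (cube_root_close w e) as CC. rewrite Re_conj_mult, Me, Sq in CC.
specialize (CC ltac:(nra) N1). replace (q * w)%C with (w * q)%C in CC by ring.
assert (D1 : Cmod (w - e)%C <= 13500 * cbrt r ^ 3 / kc ^ 2).
{ apply Rmult_le_reg_r with ((kc * cbrt r) ^ 2 / 4).
  - apply Rdiv_lt_0_compat; [apply pow_lt; nra|lra].
  - replace (13500 * cbrt r ^ 3 / kc ^ 2 * ((kc * cbrt r) ^ 2 / 4)) with (3375 * cbrt r ^ 5) by (field; lra).
    lra. }
assert (D2 : Cmod (w + e)%C <= (5 + kc) * cbrt r).
{ eapply Rle_trans; [apply Cmod_triangle|]. lra. }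
rewrite <- Sq. replace (w * w - e * e)%C with ((w - e) * (w + e))%C by ring. rewrite Cmod_mult.
replace (13500 * (5 + kc) / kc ^ 2 * cbrt r ^ 4)
  with (13500 * cbrt r ^ 3 / kc ^ 2 * ((5 + kc) * cbrt r)) by (field; lra).
apply Rmult_le_compat; try apply Cmod_ge_0; assumption.
Qed.

(** Solves [- 3 / 2 * alpha0 = kc ^ 2 cis (PI / 3)], the leading coefficient of the expansion. *)
Definition alpha0 : C := (RtoC (- (2 / 3) * kc ^ 2) * cis (PI / 3))%C.

Lemma alpha0_cube : (alpha0 * (alpha0 * alpha0))%C = RtoC (1 / 2).
Proof.
destruct kc_facts as [_ [K1 K2]]. unfold alpha0.
transitivity (RtoC ((- (2 / 3) * kc ^ 2) ^ 3) * (cis (PI / 3) * (cis (PI / 3) * cis (PI / 3))))%C.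
{ rewrite RtoC_pow. ring. }
rewrite <- !cis_plus. replace (PI / 3 + (PI / 3 + PI / 3)) with PI by field. rewrite cis_PI.
replace ((- (2 / 3) * kc ^ 2) ^ 3) with (- (1 / 2)).
- rewrite RtoC_opp. ring.
- replace ((- (2 / 3) * kc ^ 2) ^ 3) with (- (8 / 27) * (kc ^ 3) ^ 2) by field. rewrite K1, K2. field.
Qed.

Lemma Qext_holo (V : C -> Prop) : (forall t, V t -> cut_strip t) -> holo Qext V.
Proof.
intros H t Ht. eexists. apply cderiv_is_derive, Qext_cderiv, H, Ht.
Qed.

Lemma Qext_puiseux_expr (r x : R) : 0 < r < nu1 -> top_angle x ->
  Cmod (Cplus (Qext (polar (0, A0) r x)) (Cmult (RtoC (3 / 2))
     (Cmult alpha0 (polar (RtoC 0) (Rpower r (2 / 3)) (2 * x / 3)))))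
  <= 13500 * (5 + kc) / kc ^ 2 * Rpower r (4 / 3).
Proof.
intros Hr Hx. pose proof (Qext_expansion r x Hr Hx) as B.
replace (4 / 3) with (INR 4 / 3) by (simpl; field).
replace (2 / 3) with (INR 2 / 3) by (simpl; field).
rewrite !Rpower_cbrt. rewrite (polar_cis (RtoC 0)).
replace (Qext (polar (0, A0) r x) + RtoC (3 / 2) * (alpha0 * (0 + RtoC (cbrt r ^ 2) * cis (2 * x / 3))))%C
  with (Qext (polar (0, A0) r x) - RtoC (kc ^ 2 * cbrt r ^ 2) * cis (PI / 3 + 2 * x / 3))%C; [exact B|].
unfold alpha0. rewrite cis_plus.
replace (RtoC (kc ^ 2 * cbrt r ^ 2)) with (- (RtoC (3 / 2) * (RtoC (- (2 / 3) * kc ^ 2) * RtoC (cbrt r ^ 2))))%C; [ring|].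
rewrite <- !RtoC_mult, <- RtoC_opp. f_equal. field.
Qed.

Lemma Qext_puiseux_top : puiseux_at Qext A0 (0, A0) (- (3 * PI / 2)) (PI / 2) alpha0.
Proof.
exists nu1. split; [apply nu1_bounds|]. exists Qext. split; [|split].
- apply Qext_holo. intros t [r [x [Hr [Hx ->]]]]. apply polar_cut_strip; [|exact Hx].
  pose proof nu1_bounds. lra.
- intros; reflexivity.
- exists (13500 * (5 + kc) / kc ^ 2). intros r x Hr Hx. apply Qext_puiseux_expr; assumption.
Qed.

Lemma polar_conj (c : C) (r x : R) : polar (Cconj c) r x = Cconj (polar c r (- x)).
Proof.
rewrite !polar_cis, Cplus_conj, Cmult_conj, RtoC_conj, cis_conj, Ropp_involutive. reflexivity.
Qed.

Lemma Qext_puiseux_bottom :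
  puiseux_at Qext A0 (0, - A0) (- (PI / 2)) (3 * PI / 2) (Cconj alpha0).
Proof.
pose proof nu1_bounds as N.
assert (Ec : ((0, - A0) : C) = Cconj (0, A0)) by (apply C_eq; reflexivity).
assert (Ta : forall x, - (PI / 2) < x < 3 * PI / 2 -> top_angle (- x)) by (unfold top_angle; intros; lra).
assert (Cs : forall r x, 0 < r < nu1 -> - (PI / 2) < x < 3 * PI / 2 -> cut_strip (polar (0, A0) r (- x))).
{ intros r x Hr Hx. apply polar_cut_strip; [lra|apply Ta, Hx]. }
exists nu1. split; [apply nu1_bounds|]. exists Qext. split; [|split].
- apply Qext_holo. intros t [r [x [Hr [Hx ->]]]]. rewrite Ec, polar_conj.
  apply cut_conj, Cs; assumption.
- intros; reflexivity.
- exists (13500 * (5 + kc) / kc ^ 2). intros r x Hr Hx.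
  rewrite Ec, polar_conj, Qext_conj by (apply Cs; assumption).
  rewrite <- (RtoC_conj 0), polar_conj, <- (RtoC_conj (3 / 2)), <- !Cmult_conj, <- Cplus_conj, Cmod_conj.
  replace (- (2 * x / 3)) with (2 * - x / 3) by field.
  apply Qext_puiseux_expr; [exact Hr|apply Ta, Hx].
Qed.

(* Along the axis [q ^ (3 / 2)] is comparable to the distance [r] to the singularity. *)
Lemma Qext_axis_not_lipschitz (v : C) (M d : R) : 0 < d ->
  ~ (forall r, 0 < r < d -> Cmod (Qext (0, (A0 - r)%R) - v)%C <= M * r).
Proof.
intros d0 H. pose proof nu1_bounds as N. pose proof nu0_bounds as N0.
(* Along the axis [q] tends both to [v] and to 0. *)
assert (v0 : v = 0).
{ apply Cmod_eq_0, Rle_antisym; [|apply Cmod_ge_0]. apply le_epsilon. intros e e0.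
  destruct (Qext_axis_small (e / 2) ltac:(lra)) as [d' [Hd' H']].
  set (r := Rmin (Rmin (d / 2) (d' / 2)) (e / 2 / (Rabs M + 1))).
  pose proof (Rabs_pos M) as AM.
  assert (E0 : 0 < e / 2 / (Rabs M + 1)) by (apply Rdiv_lt_0_compat; lra).
  assert (Hr : 0 < r /\ r < d /\ r < d' /\ r <= e / 2 / (Rabs M + 1)).
  { unfold r, Rmin. destruct (Rle_dec (d / 2) (d' / 2)); destruct (Rle_dec _ _); lra. }
  specialize (H r ltac:(lra)). specialize (H' r ltac:(lra)).
  assert (Rabs M * r <= e / 2).
  { destruct Hr as [R0 [_ [_ R1]]]. apply Rle_div_r in R1; lra. }
  pose proof (Rle_abs M).
  replace v with (Qext (0, (A0 - r)%R) - (Qext (0, (A0 - r)%R) - v))%C by ring.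
  eapply Rle_trans; [apply Cmod_triangle|]. rewrite Cmod_opp. nra. }
subst v.
destruct kc_facts as [_ [_ K2]]. destruct g0_facts as [_ Bg].
assert (Bk : 5 / 4 < k0) by (unfold k0; lra).
set (B := Rabs M + 1). assert (B1 : 1 <= B) by (unfold B; pose proof (Rabs_pos M); lra).
(* The third bound gives [|q|^3 <= (B r)^3 <= r^2 / 4]. The last gives [cbrt r <= 1 / 100], so the
   error of [q32] is at most [3 r / 8] and [|q|^3 = |q32|^2 >= 9 r^2 / 16], a contradiction. *)
set (r := Rmin (Rmin (d / 2) (nu1 / 2)) (Rmin (/ (4 * B ^ 3)) (/ 1000000))).
assert (E0 : 0 < / (4 * B ^ 3)) by (apply Rinv_0_lt_compat; pose proof (pow_lt B 3 ltac:(lra)); lra).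
assert (Hr : 0 < r /\ r < d /\ r < nu1 /\ r <= / (4 * B ^ 3) /\ r <= / 1000000).
{ unfold r, Rmin. destruct (Rle_dec (d / 2) (nu1 / 2)), (Rle_dec (/ (4 * B ^ 3)) (/ 1000000));
    destruct (Rle_dec _ _); lra. }
destruct Hr as [R0 [R1 [R2 [R3 R4]]]].
specialize (H r ltac:(lra)).
replace (Qext (0, (A0 - r)%R) - 0)%C with (Qext (0, (A0 - r)%R)) in H by ring.
assert (Hc : cut_strip (0, A0 - r)) by (apply cut_strip_axis; rewrite Rabs_pos_eq; lra).
assert (T0 : top_angle (- (PI / 2))) by (unfold top_angle; pose proof PI_RGT_0; lra).
pose proof (q32_expansion r _ ltac:(lra) T0) as X. rewrite polar_axis in X.
assert (Cm : Cmod (RtoC (k0 * r) * (Ci * cis (- (PI / 2))))%C = k0 * r).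
{ rewrite !Cmod_mult, Cmod_Ci, Cmod_cis, Cmod_R, Rabs_pos_eq by nra. ring. }
pose proof (Cmod_minus_ge (RtoC (k0 * r) * (Ci * cis (- (PI / 2))))%C (q32 (0, A0 - r))) as Y.
rewrite Cmod_minus_sym, Cm in Y.
pose proof (cbrt_pow r R0) as Er. pose proof (cbrt_pos r) as Pr.
assert (Sm : cbrt r <= 1 / 100).
{ apply (pow_le_inv _ _ 2); [lra|]. rewrite Er. lra. }
assert (L : r * (3 / 4) <= Cmod (q32 (0, A0 - r))).
{ assert (3375 * cbrt r ^ 5 <= r * (3 / 8)); [|nra].
  replace (3375 * cbrt r ^ 5) with (cbrt r ^ 3 * (3375 * cbrt r ^ 2)) by ring. rewrite Er.
  apply Rmult_le_compat_l; [lra|]. nra. }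
pose proof (q32_mod _ Hc) as E1. pose proof (Qext_mod_csqrt _ Hc) as E2.
set (w := Cmod (csqrt (Qext (0, A0 - r)))) in *.
assert (W0 : 0 <= w) by apply Cmod_ge_0.
assert (H2 : w ^ 2 <= B * r).
{ rewrite <- E2. unfold B. pose proof (Rle_abs M). nra. }
assert (H3 : (w ^ 2) ^ 3 <= (B * r) ^ 3) by (apply pow_incr; split; [apply pow2_ge_0|exact H2]).
assert (H4 : (r * (3 / 4)) ^ 2 <= (w ^ 3) ^ 2) by (apply pow_incr; lra).
assert (H5 : B ^ 3 * r <= 1 / 4).
{ apply Rmult_le_compat_l with (r := B ^ 3) in R3; [|apply pow_le; lra].
  replace (B ^ 3 * / (4 * B ^ 3)) with (1 / 4) in R3 by (field; lra). exact R3. }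
assert (H6 : (B * r) ^ 3 <= 1 / 4 * r ^ 2).
{ replace ((B * r) ^ 3) with (B ^ 3 * r * r ^ 2) by ring. apply Rmult_le_compat_r; [apply pow2_ge_0|exact H5]. }
replace ((w ^ 3) ^ 2) with ((w ^ 2) ^ 3) in H4 by ring.
nra.
Qed.

(** * The real orbit *)

Lemma Qext_axis_sign (sg y : R) : sg = 1 \/ sg = -1 -> Rabs y < A0 -> Qext (0, sg * y) = Qext (0, y).
Proof.
intros [->| ->] H; [f_equal; f_equal; ring|].
rewrite <- (Qext_opp (0, y)) by (apply cut_strip_axis, H). f_equal. apply C_eq; simpl; ring.
Qed.

(** A holomorphic continuation would be Lipschitz at the point, hence so would [q] be along the
    axis. Evenness reduces both signs to the upper one. *)
Lemma Qext_not_regular (sg : R) : sg = 1 \/ sg = -1 -> ~ regular_at Qext A0 (0, sg * A0).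
Proof.
intros Hsg [r [r0 [g [Hg Eg]]]]. pose proof A0_pos as PA.
assert (Asg : Rabs sg = 1) by (destruct Hsg as [->| ->]; [apply Rabs_R1|rewrite Rabs_left; lra]).
destruct (Hg (0, sg * A0)) as [l Hl].
{ unfold cdisc. replace (Cminus (0, sg * A0) (0, sg * A0)) with (RtoC 0) by (apply C_eq; simpl; ring).
  rewrite Cmod_0. exact r0. }
apply cderiv_is_derive in Hl. destruct (cderiv_lip _ _ _ Hl) as [d [d0 Hd]].
apply (Qext_axis_not_lipschitz (g (0, sg * A0)) (Cmod l + 1) (Rmin (Rmin r d) A0)).
{ repeat apply Rmin_pos; assumption. }
intros s Hs.
assert (Hs1 := Rmin_lt_l (proj2 Hs)).
assert (Hs2 := Rmin_lt_r (proj2 Hs)).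
assert (Es : Cmod (Cminus (0, sg * (A0 - s)) (0, sg * A0)) = s).
{ replace (Cminus (0, sg * (A0 - s)) (0, sg * A0)) with (Cmult (RtoC (- s * sg)) Ci)
    by (apply C_eq; simpl; ring).
  rewrite Cmod_mult, Cmod_Ci, Cmod_R, Rabs_mult, Asg, Rabs_Ropp, Rabs_pos_eq; lra. }
rewrite <- (Qext_axis_sign sg) by (try exact Hsg; rewrite Rabs_pos_eq; lra). rewrite <- Eg.
- rewrite <- Es at 2. apply Hd. rewrite Es. exact (Rmin_lt_r Hs1).
- unfold cdisc. rewrite Es. exact (Rmin_lt_l Hs1).
- unfold strip. simpl. rewrite Rabs_mult, Asg, Rabs_pos_eq; lra.
Qed.

(** At a first return to zero the function would be positive just before, against its positive
    derivative there. That return is the supremum of the points up to which [f] stays positive. *)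
Lemma pos_after_zero (f : R -> R) :
  (forall x, ex_derive f x) -> f 0 = 0 -> (forall x l, f x = 0 -> is_derive f x l -> 0 < l) ->
  forall x, 0 < x -> 0 < f x.
Proof.
intros Df f0 Hz x1 Hx1. apply Rnot_le_lt. intros L1.
destruct (Df 0) as [l0 D0]. pose proof (Hz 0 l0 f0 D0) as P0.
rewrite is_derive_eps in D0. destruct (D0 (l0 / 2) ltac:(lra)) as [d [d0 Hd]].
destruct (exists_small Hx1 d0) as [s Hs].
assert (fs : 0 < f s).
{ specialize (Hd s). rewrite f0, !Rminus_0_r, (Rabs_pos_eq s) in Hd by lra.
  specialize (Hd ltac:(lra)). apply Rabs_le_between in Hd. nra. }
destruct (completeness (fun z => s <= z <= x1 /\ forall x, s <= x <= z -> 0 < f x)) as [m [Hm1 Hm2]].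
{ exists x1. intros z [Hzz _]. lra. }
{ exists s. split; [lra|]. intros x Hx. replace x with s by lra. exact fs. }
assert (ms : s <= m).
{ apply Hm1. split; [lra|]. intros x Hx. replace x with s by lra. exact fs. }
assert (mx : m <= x1) by (apply Hm2; intros z [Hzz _]; lra).
assert (below : forall x, s <= x < m -> 0 < f x).
{ intros x Hx. apply Rnot_le_lt. intros L.
  assert (m <= x); [|lra]. apply Hm2. intros z [Hz1 Hz2].
  apply Rnot_lt_le. intros g. pose proof (Hz2 x ltac:(lra)). lra. }
destruct (Df m) as [l D]. pose proof (is_derive_continuity_pt _ _ _ D) as Cm.
assert (fm : f m = 0).
{ destruct (Rtotal_order (f m) 0) as [h|[h|h]]; [exfalso|exact h|exfalso].
  - destruct (continuity_pt_eps _ _ Cm (- f m) ltac:(lra)) as [e [e0 He]].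
    assert (sm : s < m) by (destruct ms as [ms|ms]; [exact ms|rewrite <- ms in h; lra]).
    set (z := Rmax s (m - e / 2)).
    assert (Hz' : s <= z < m /\ m - e < z) by (unfold z, Rmax; destruct (Rle_dec _ _); lra).
    pose proof (below z ltac:(lra)). specialize (He z).
    rewrite Rabs_left in He by lra. specialize (He ltac:(lra)).
    apply Rabs_lt_between in He. lra.
  - destruct (continuity_pt_eps _ _ Cm (f m) h) as [e [e0 He]].
    assert (mx1 : m < x1) by (destruct mx as [mx|mx]; [exact mx|rewrite mx in h; lra]).
    set (z := Rmin x1 (m + e / 2)).
    assert (Hz' : m < z <= x1 /\ z < m + e) by (unfold z, Rmin; destruct (Rle_dec _ _); lra).
    assert (z <= m); [|lra]. apply Hm1. split; [lra|]. intros x Hx.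
    destruct (Rlt_dec x m) as [g|g]; [apply below; lra|].
    specialize (He x). rewrite Rabs_pos_eq in He by lra. specialize (He ltac:(lra)).
    apply Rabs_lt_between in He. lra. }
pose proof (Hz m l fm D) as Pl. rewrite is_derive_eps in D.
destruct (D (l / 2) ltac:(lra)) as [e [e0 He]].
assert (sm : s < m) by (destruct ms as [ms|ms]; [exact ms|rewrite <- ms in fm; lra]).
set (z := Rmax s (m - e / 2)).
assert (Hz' : s <= z < m /\ m - e < z) by (unfold z, Rmax; destruct (Rle_dec _ _); lra).
pose proof (below z ltac:(lra)). specialize (He z).
rewrite fm, Rminus_0_r, (Rabs_left (z - m)) in He by lra. specialize (He ltac:(lra)).
apply Rabs_le_between in He. nra.
Qed.

Lemma sqrt_half_angle (l : R) : 0 < l < PI -> 0 < cos (l / 2) < 1 /\ cos l = 2 * cos (l / 2) ^ 2 - 1 /\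
  sqrt (2 + 2 * cos l) = 2 * cos (l / 2).
Proof.
intros H. assert (P : 0 < cos (l / 2)) by (apply cos_gt_0; lra).
assert (E : cos l = 2 * cos (l / 2) ^ 2 - 1).
{ replace l with (2 * (l / 2)) at 1 by field. rewrite cos_2a_cos. ring. }
split; [split; [exact P|]|split; [exact E|]].
- rewrite <- cos_0. apply cos_decreasing_1; lra.
- rewrite E. replace (2 + 2 * (2 * cos (l / 2) ^ 2 - 1)) with ((2 * cos (l / 2)) ^ 2) by ring.
  apply sqrt_pow2. lra.
Qed.

(** Multiplied by [2 q], the energy relation becomes cubic in [q = cos (l / 2)], with roots 1 and
    the roots [a_plus], [a_minus] of [q^2 + q = 1 / 4]. *)
Lemma Hpend_half_angle (l L : R) : 0 < l < PI -> Hpend l L = - (1 / 2) ->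
  3 * cos (l / 2) * L ^ 2
    = 4 * (1 - cos (l / 2)) * (cos (l / 2) - a_minus) * (cos (l / 2) - a_plus).
Proof.
intros H E. destruct (sqrt_half_angle l H) as [P [C S]].
unfold Hpend, Vpend in E. rewrite S, C in E. set (q := cos (l / 2)) in *.
assert (K : 3 / 2 * L ^ 2 * (2 * q) = (5 / 2 - 2 * q ^ 2) * (2 * q) - 1).
{ replace ((5 / 2 - 2 * q ^ 2) * (2 * q) - 1) with ((5 / 2 - 2 * q ^ 2 - / (2 * q)) * (2 * q)) by (field; lra).
  f_equal. lra. }
rewrite a_minus_eq. pose proof a_plus_root as R.
replace (4 * (1 - q) * (q - (-1 - a_plus)) * (q - a_plus))
  with (4 * (1 - q) * (q ^ 2 + q - (a_plus ^ 2 + a_plus))) by ring.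
rewrite R. lra.
Qed.

Lemma Vpend_derive (l : R) : 0 < l < PI ->
  Derive Vpend l = sin l * (1 - / (2 * cos (l / 2)) ^ 3).
Proof.
intros H. destruct (sqrt_half_angle l H) as [P [C S]].
apply is_derive_unique. unfold Vpend.
assert (K : 0 < 2 + 2 * cos l) by (rewrite C; nra).
auto_derive; [split; [exact K|split; [rewrite S; lra|trivial]]|].
rewrite S. field. lra.
Qed.

Lemma Derive_half_cos (lam Lam : R -> R) (t : R) : is_derive lam t (-3 * Lam t) ->
  is_derive (fun t => cos (lam t / 2)) t (3 / 2 * sin (lam t / 2) * Lam t).
Proof.
intros H.
pose proof (is_derive_comp (fun x => cos (x / 2)) lam t (- sin (lam t / 2) / 2) (-3 * Lam t)) as K.
replace (3 / 2 * sin (lam t / 2) * Lam t) with (scal (-3 * Lam t) (- sin (lam t / 2) / 2)).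
- apply K; [|exact H]. auto_derive; [trivial|]. unfold Rdiv. field.
- unfold scal; simpl; unfold mult; simpl.
  match goal with |- @eq _ ?a ?b => change (@eq R a b) end. field.
Qed.

Lemma qu_real (y : R) : qu (RtoC y) = RtoC (1 - 2 * (1 - a_plus) / (1 + cosh y)).
Proof.
pose proof (cosh_ge_1 y).
assert (E : (1 + ccosh (RtoC y))%C = RtoC (1 + cosh y)).
{ apply C_eq; simpl; rewrite ?cos_0, ?sin_0; ring. }
unfold qu. rewrite E, <- RtoC_inv, <- RtoC_mult, <- RtoC_minus by lra. reflexivity.
Qed.

Definition acosh (p : R) : R := ln (p + sqrt (p ^ 2 - 1)).

Lemma acosh_deriv (p : R) : 1 < p -> is_derive acosh p (/ sqrt (p ^ 2 - 1)).
Proof.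
intros H. unfold acosh. assert (S : 0 < sqrt (p ^ 2 - 1)) by (apply sqrt_lt_R0; nra).
auto_derive; replace (p * (p * 1) + - (1)) with (p ^ 2 - 1) by ring.
- split; [nra|split; [lra|trivial]].
- field. lra.
Qed.

Lemma cosh_acosh (p : R) : 1 <= p -> cosh (acosh p) = p.
Proof.
intros H. pose proof (sqrt_pos (p ^ 2 - 1)) as S. pose proof (pow2_sqrt (p ^ 2 - 1) ltac:(nra)) as E.
unfold cosh, acosh. rewrite exp_Ropp, exp_ln by lra.
set (s := sqrt (p ^ 2 - 1)) in *.
replace (/ (p + s)) with (p - s); [field|].
apply Rmult_eq_reg_r with (p + s); [|lra]. rewrite Rinv_l by lra. lra.
Qed.

Lemma acosh_pos (p : R) : 1 < p -> 0 < acosh p.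
Proof.
intros H. unfold acosh. rewrite <- ln_1. apply ln_increasing; [lra|].
pose proof (sqrt_pos (p ^ 2 - 1)). lra.
Qed.

Lemma acosh_1 : acosh 1 = 0.
Proof. unfold acosh. replace (1 ^ 2 - 1) with 0 by ring. rewrite sqrt_0, Rplus_0_r. apply ln_1. Qed.

(** The value 1 is reached at [t = 0], where [acosh] has no derivative; continuity carries the
    constant of integration there. Just below 1 the radicand is negative and [sqrt] gives 0. *)
Lemma acosh_cont_1 : continuity_pt acosh 1.
Proof.
unfold acosh. apply (continuity_pt_comp (fun p => p + sqrt (p ^ 2 - 1)) ln).
- apply continuity_pt_plus; [apply continuity_pt_id|].
  apply (continuity_pt_comp (fun p => p ^ 2 - 1) sqrt).
  + apply (is_derive_continuity_pt _ _ 2). auto_derive; [trivial|ring].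
  + apply continuity_pt_sqrt. lra.
- apply (is_derive_continuity_pt _ _ (/ (1 + sqrt (1 ^ 2 - 1)))).
  apply is_derive_Reals, derivable_pt_lim_ln. pose proof (sqrt_pos (1 ^ 2 - 1)). lra.
Qed.

Lemma dom_real (y : R) : dom (RtoC y).
Proof. pose proof v0_bounds. unfold dom, cut. rewrite im_RtoC, Rabs_R0. lra. Qed.

Lemma time_real_deriv (y : R) : is_derive (fun y => Re (time (RtoC y))) y (Re (dtdu (RtoC y))).
Proof.
assert (E : forall y, (0 + RtoC y * 1)%C = RtoC y) by (intros; ring).
destruct (vderiv_comp time (fun x => 0 + RtoC x * 1)%C y (dtdu (RtoC y)) 1) as [D _].
- rewrite E. apply time_cderiv, dom_real.
- apply vderiv_line.
- replace (Re (dtdu (RtoC y))) with (Re (dtdu (RtoC y) * 1)%C) by (f_equal; ring).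
  eapply is_derive_ext; [|exact D]. intros z. cbv beta. rewrite E. reflexivity.
Qed.

(** The value of [cosh u] when [qu u = x]. *)
Definition p_of_q (x : R) : R := 2 * (1 - a_plus) / (1 - x) - 1.

Lemma p_of_q_ge_1 (x : R) : a_plus <= x < 1 -> 1 <= p_of_q x.
Proof.
intros H. pose proof a_plus_bounds. unfold p_of_q.
assert (2 <= 2 * (1 - a_plus) / (1 - x)); [|lra]. apply Rle_div_r; lra.
Qed.

Lemma p_of_q_gt_1 (x : R) : a_plus < x < 1 -> 1 < p_of_q x.
Proof.
intros H. pose proof a_plus_bounds. unfold p_of_q.
assert (2 < 2 * (1 - a_plus) / (1 - x)); [|lra]. apply Rlt_div_r; lra.
Qed.

Lemma p_of_q_deriv (x : R) : x < 1 -> is_derive p_of_q x (2 * (1 - a_plus) / (1 - x) ^ 2).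
Proof. intros H. unfold p_of_q. auto_derive; [lra|field; lra]. Qed.

Lemma qu_acosh (x : R) : a_plus <= x < 1 -> qu (RtoC (acosh (p_of_q x))) = RtoC x.
Proof.
intros H. pose proof a_plus_bounds. rewrite qu_real, cosh_acosh by (apply p_of_q_ge_1, H).
f_equal. unfold p_of_q. field. lra.
Qed.

(** * The orbit in the coordinate [u] *)

Section Flow.
Variables lam Lam : R -> R.
Hypothesis lam_eq : forall t, is_derive lam t (-3 * Lam t).
Hypothesis Lam_eq : forall t, is_derive Lam t (- Derive Vpend (lam t)).
Hypothesis lam_range : forall t, 0 < lam t < PI.
Hypothesis energy : forall t, Hpend (lam t) (Lam t) = - (1 / 2).
Hypothesis Lam_0 : Lam 0 = 0.

Definition qf (t : R) : R := cos (lam t / 2).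

Lemma qf_energy (t : R) :
  3 * qf t * Lam t ^ 2 = 4 * (1 - qf t) * (qf t - a_minus) * (qf t - a_plus).
Proof. apply Hpend_half_angle; [apply lam_range|apply energy]. Qed.

(** The left-hand side of the energy relation is nonnegative, and on the right every factor other
    than [qf t - a_plus] is positive. *)
Lemma qf_range (t : R) : a_plus <= qf t < 1.
Proof.
pose proof (qf_energy t) as E. destruct (sqrt_half_angle _ (lam_range t)) as [P _]. fold (qf t) in P.
split; [|lra]. pose proof a_plus_bounds. rewrite a_minus_eq in E.
apply Rnot_lt_le. intros L. pose proof (pow2_ge_0 (Lam t)).
assert (0 < 4 * (1 - qf t) * (qf t - (-1 - a_plus)) * (a_plus - qf t)) by (repeat apply Rmult_lt_0_compat; lra).
nra.
Qed.

Lemma qf_zero (t : R) : Lam t = 0 -> qf t = a_plus.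
Proof.
intros Z. pose proof (qf_energy t) as E. pose proof (qf_range t). pose proof a_plus_bounds.
rewrite Z, a_minus_eq in E.
assert (K : 4 * (1 - qf t) * (qf t - (-1 - a_plus)) * (qf t - a_plus) = 0) by (rewrite <- E; ring).
apply Rmult_integral in K. destruct K as [K|K]; [|lra].
assert (0 < 4 * (1 - qf t) * (qf t - (-1 - a_plus))) by (repeat apply Rmult_lt_0_compat; lra). lra.
Qed.

Lemma qf_deriv (t : R) : is_derive qf t (3 / 2 * sin (lam t / 2) * Lam t).
Proof. apply Derive_half_cos, lam_eq. Qed.

Lemma qf_deriv_sqr (t : R) : (3 / 2 * sin (lam t / 2) * Lam t) ^ 2
  = 3 / qf t * (qf t - 1) ^ 2 * (qf t + 1) * (qf t - a_minus) * (qf t - a_plus).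
Proof.
pose proof (qf_energy t) as E. pose proof (qf_range t). pose proof a_plus_bounds.
pose proof (sin2_cos2 (lam t / 2)) as S. fold (qf t) in S. unfold Rsqr in S.
transitivity (3 / 4 / qf t * (sin (lam t / 2) * sin (lam t / 2)) * (3 * qf t * Lam t ^ 2)); [field; lra|].
rewrite E. replace (sin (lam t / 2) * sin (lam t / 2)) with (1 - qf t * qf t) by lra. field. lra.
Qed.

(** At a zero of [Lam], [q = a_plus < 1 / 2], so the derivative of [Lam] is
    [sin lam * (1 / (2 a_plus)^3 - 1) > 0]: zeros are crossed upwards only. *)
Lemma Lam_pos (t : R) : 0 < t -> 0 < Lam t.
Proof.
apply pos_after_zero; [intros x; eexists; apply Lam_eq|exact Lam_0|].
intros x l Z D. pose proof a_plus_bounds.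
assert (El : l = - Derive Vpend (lam x)).
{ rewrite <- (is_derive_unique _ _ _ D). apply is_derive_unique, Lam_eq. }
rewrite El, Vpend_derive by apply lam_range. pose proof (qf_zero x Z) as Q. unfold qf in Q. rewrite Q.
pose proof (lam_range x) as R. pose proof (sin_gt_0 (lam x) ltac:(lra) ltac:(lra)) as S.
assert (K : 1 < / (2 * a_plus) ^ 3).
{ rewrite <- Rinv_1 at 1. apply Rinv_lt_contravar; [apply Rmult_lt_0_compat; [apply pow_lt|]; lra|].
  assert ((2 * a_plus) ^ 3 <= (1 / 2) ^ 3) by (apply pow_incr; lra). lra. }
nra.
Qed.

Lemma qf_gt (t : R) : 0 < t -> a_plus < qf t.
Proof.
intros H. pose proof (Lam_pos t H) as L. pose proof (qf_energy t) as E. pose proof (qf_range t) as R.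
destruct R as [[R|R] _]; [exact R|exfalso]. rewrite <- R in E. pose proof a_plus_bounds.
assert (0 < 3 * a_plus * Lam t ^ 2) by (repeat apply Rmult_lt_0_compat; try lra; apply pow_lt; lra).
rewrite Rminus_diag, Rmult_0_r in E. lra.
Qed.

Definition uf (t : R) : R := acosh (p_of_q (qf t)).

(** By the chain rule the derivative is a product of positive factors, as [Lam t > 0]; it therefore
    suffices that its square be 1, which follows from the differential equation of [q]. *)
Lemma uf_time_deriv (t : R) : 0 < t -> is_derive (fun t => Re (time (RtoC (uf t)))) t 1.
Proof.
intros H. pose proof (qf_range t) as Rq. pose proof (qf_gt t H) as Gt. pose proof a_plus_bounds as B.
pose proof a_minus_eq as Am. pose proof kap_pos as Kp.
assert (P1 : 1 < p_of_q (qf t)) by (apply p_of_q_gt_1; lra).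
pose proof (is_derive_comp _ _ t _ _ (p_of_q_deriv (qf t) ltac:(lra)) (qf_deriv t)) as D1.
pose proof (is_derive_comp _ _ t _ _ (acosh_deriv _ P1) D1) as D2.
pose proof (is_derive_comp _ _ t _ _ (time_real_deriv (uf t)) D2) as D3.
match type of D3 with is_derive _ _ ?l => assert (E : l = 1) end.
2:{ rewrite E in D3. exact D3. }
unfold uf. rewrite (dtdu_real _ (qf t)), re_RtoC by (try apply qu_acosh; lra).
unfold scal; simpl; unfold mult; simpl. match goal with |- @eq _ ?a ?b => change (@eq R a b) end.
pose proof (qf_deriv_sqr t) as Q2.
assert (Sl : 0 < sin (lam t / 2)).
{ pose proof (lam_range t). apply sin_gt_0; lra. }
pose proof (Lam_pos t H) as Lp.
set (x := qf t) in *. set (d := 3 / 2 * sin (lam t / 2) * Lam t) in *.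
assert (d0 : 0 < d) by (unfold d; repeat apply Rmult_lt_0_compat; lra).
assert (X : p_of_q x ^ 2 - 1 = 4 * (1 - a_plus) * (x - a_plus) / (1 - x) ^ 2) by (unfold p_of_q; field; lra).
assert (X0 : 0 < p_of_q x ^ 2 - 1) by nra.
assert (S0 : 0 < sqrt (p_of_q x ^ 2 - 1)) by (apply sqrt_lt_R0, X0).
assert (S1 : 0 < sqrt x) by (apply sqrt_lt_R0; lra).
assert (S2 : 0 < sqrt (x + 1)) by (apply sqrt_lt_R0; lra).
assert (S3 : 0 < sqrt (x - a_minus)) by (apply sqrt_lt_R0; lra).
change (p_of_q x * (p_of_q x * 1)) with (p_of_q x ^ 2).
apply pow2_inj; [|lra|].
- apply Rlt_le. repeat apply Rmult_lt_0_compat; try assumption; try (apply Rinv_0_lt_compat); try lra.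
  + apply (pow_lt (1 - x) 2). lra.
  + apply Rmult_lt_0_compat; assumption.
- unfold Rdiv. rewrite !Rpow_mult_distr, !pow_inv, !Rpow_mult_distr, !pow2_sqrt by lra.
  rewrite kap_sqr, Q2, X. field. repeat split; lra.
Qed.

Lemma uf_cont_0 : continuity_pt (fun t => Re (time (RtoC (uf t)))) 0 /\ uf 0 = 0.
Proof.
pose proof (qf_zero 0 Lam_0) as Q. pose proof a_plus_bounds.
assert (P : p_of_q (qf 0) = 1) by (rewrite Q; unfold p_of_q; field; lra).
assert (U0 : uf 0 = 0) by (unfold uf; rewrite P; apply acosh_1).
split; [|exact U0].
apply (continuity_pt_comp uf (fun y => Re (time (RtoC y)))).
- unfold uf. apply (continuity_pt_comp (fun t => p_of_q (qf t)) acosh).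
  + apply (continuity_pt_comp qf p_of_q).
    * eapply is_derive_continuity_pt, qf_deriv.
    * eapply is_derive_continuity_pt, p_of_q_deriv. lra.
  + rewrite P. apply acosh_cont_1.
- eapply is_derive_continuity_pt, time_real_deriv.
Qed.

(** The difference with [t] is constant for positive times, and continuity at 0 makes it vanish. *)
Lemma uf_time (t : R) : 0 <= t -> Re (time (RtoC (uf t))) = t.
Proof.
intros [H|H].
2:{ rewrite <- H, (proj2 uf_cont_0), time_0. reflexivity. }
set (f := fun t => Re (time (RtoC (uf t))) - t).
assert (C : continuity_pt f 0).
{ apply continuity_pt_minus; [apply uf_cont_0|apply continuity_pt_id]. }
assert (f0 : f 0 = 0) by (unfold f; rewrite (proj2 uf_cont_0), time_0, re_RtoC; ring).
assert (K : forall s, 0 < s < t + 1 -> f s = f t).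
{ intros s Hs. apply (derive_0_const f 0 (t + 1)); try lra.
  intros y Hy. unfold f. replace 0 with (1 - 1) by ring.
  apply (is_derive_minus (fun t => Re (time (RtoC (uf t)))) (fun t => t)).
  - apply uf_time_deriv. lra.
  - apply is_derive_Reals, derivable_pt_lim_id. }
assert (Z : Rabs (f t) <= 0).
{ apply le_epsilon. intros e e0. destruct (continuity_pt_eps _ _ C e e0) as [d [d0 Hd]].
  destruct (exists_small H d0) as [s Hs].
  specialize (Hd s). rewrite f0, !Rminus_0_r, (Rabs_pos_eq s), (K s) in Hd by lra.
  specialize (Hd ltac:(lra)). lra. }
apply Rabs_le_between in Z. unfold f in Z. lra.
Qed.

Lemma cut_strip_real (t : R) : cut_strip (RtoC t).
Proof.
pose proof A0_pos. pose proof (proj1 margin_spec). unfold cut_strip, cut. rewrite im_RtoC, Rabs_R0. lra.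
Qed.

(** For nonnegative times the nonnegative coordinate [uf t] is the preimage on the side of [t], so
    uniqueness gives [coord t]. *)
Lemma Qext_flow (t : R) : 0 <= t -> Qext (RtoC t) = RtoC (qf t).
Proof.
intros H. pose proof (uf_time t H) as E.
assert (EU : RtoC (uf t) = coord (RtoC t)).
{ apply coord_unique; [apply cut_strip_real|apply dom_real| |].
  - unfold same_side. rewrite !re_RtoC. repeat split; intros K; try lra.
    + apply acosh_pos, p_of_q_gt_1. split; [apply qf_gt, K|apply qf_range].
    + rewrite K. apply uf_cont_0.
  - apply C_eq; [exact E|]. rewrite time_real. reflexivity. }
unfold Qext. rewrite <- EU. apply qu_acosh, qf_range.
Qed.

End Flow.

Lemma is_derive_reflect (f : R -> R) (t l : R) :
  is_derive f (- t) l -> is_derive (fun s => f (- s)) t (- l).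
Proof.
intros H. replace (- l) with (scal (-1) l) by (unfold scal; simpl; unfold mult; simpl;
  match goal with |- @eq _ ?a ?b => change (@eq R a b) end; ring).
apply (is_derive_comp f (fun s => - s)); [exact H|]. auto_derive; [trivial|ring].
Qed.

Theorem theorem3p1 (lam Lam : R -> R) :
  (* sigma = (lam, Lam) solves the pendulum equations *)
  (forall t, is_derive lam t (-3 * Lam t)) ->
  (forall t, is_derive Lam t (- Derive Vpend (lam t))) ->
  (* it parametrizes the homoclinic orbit to (0,0) with lam in (0,pi),
     on the energy level H_pend = -1/2 *)
  (forall t, 0 < lam t < PI) ->
  (forall t, Hpend (lam t) (Lam t) = - (1/2)) ->
  is_lim lam p_infty 0 -> is_lim lam m_infty 0 ->
  is_lim Lam p_infty 0 -> is_lim Lam m_infty 0 ->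
  (* normalization sigma(0) = (lam0, 0), lam0 in (2pi/3, pi) *)
  2 * PI / 3 < lam 0 < PI -> Lam 0 = 0 ->
  let q := fun t => cos (lam t / 2) in
  (forall t, a_plus <= q t < 1) /\
  q 0 = a_plus /\
  (forall t, (Derive q t) ^ 2
     = 3 / q t * (q t - 1) ^ 2 * (q t + 1) * (q t - a_minus) * (q t - a_plus)) /\
  exists A : R,
    is_RInt_gen A_integrand (at_point 0) (at_left a_plus) A /\
    exists Q : C -> C,
      (* (i) analytic extension to the strip Pi_A *)
      holo Q (strip A) /\
      (forall t : R, Q (RtoC t) = RtoC (q t)) /\
      (* (ii) the only boundary singularities are at +- iA *)
      (forall z : C, Rabs (snd z) = A ->
         (regular_at Q A z <-> (z <> (0, A) /\ z <> (0, - A)))) /\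
      (* (iii) local expansions at +- iA *)
      exists alpha : C,
        Cmult alpha (Cmult alpha alpha) = RtoC (1/2) /\
        puiseux_at Q A (0, A) (- (3 * PI / 2)) (PI / 2) alpha /\
        puiseux_at Q A (0, - A) (- (PI / 2)) (3 * PI / 2) (Cconj alpha).
Proof.
intros lam_eq Lam_eq lam_range energy _ _ _ _ _ Lam_0 q.
split; [exact (qf_range lam Lam lam_range energy)|].
split; [exact (qf_zero lam Lam lam_range energy 0 Lam_0)|].
split.
{ intros t. rewrite (is_derive_unique q t _ (qf_deriv lam Lam lam_eq t)).
  exact (qf_deriv_sqr lam Lam lam_range energy t). }
exists A0. split; [exact A0_is_RInt_gen|].
pose proof (proj1 margin_spec) as M0.
assert (Hstrip : forall t, strip A0 t -> cut_strip t).
{ intros t Ht. unfold strip in Ht. split; [|right; exact Ht]. unfold Im. lra. }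
exists Qext. split; [apply Qext_holo, Hstrip|].
split; [|split; [|exists alpha0; split; [exact alpha0_cube|split; [exact Qext_puiseux_top|exact Qext_puiseux_bottom]]]].
- intros t. destruct (Rle_dec 0 t) as [h|h].
  + exact (Qext_flow lam Lam lam_eq Lam_eq lam_range energy Lam_0 t h).
  + replace (RtoC t) with (- RtoC (- t))%C by (rewrite RtoC_opp; ring).
    rewrite Qext_opp by apply cut_strip_real.
    (* Negative times: the reversed orbit satisfies the same hypotheses, and [Qext] is even. *)
    rewrite (Qext_flow (fun s => lam (- s)) (fun s => - Lam (- s))); try lra.
    * unfold qf. rewrite Ropp_involutive. reflexivity.
    * intros s. replace (-3 * - Lam (- s)) with (- (-3 * Lam (- s))) by ring.
      apply is_derive_reflect, lam_eq.
    * intros s. rewrite <- (Ropp_involutive (- Derive Vpend (lam (- s)))).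
      apply (is_derive_opp (fun s => Lam (- s))).
      apply is_derive_reflect, Lam_eq.
    * intros s. apply lam_range.
    * intros s. unfold Hpend. replace ((- Lam (- s)) ^ 2) with (Lam (- s) ^ 2) by ring. apply energy.
    * rewrite Ropp_0. lra.
- intros z Hz. split.
  + intros Hreg. split; intros ->; revert Hreg.
    * replace ((0, A0) : C) with ((0, 1 * A0) : C) by (f_equal; ring). apply Qext_not_regular. left; reflexivity.
    * replace ((0, - A0) : C) with ((0, -1 * A0) : C) by (f_equal; ring). apply Qext_not_regular. right; reflexivity.
  + intros [N1 N2].
    (* A boundary point other than [iA] and [-iA] has nonzero real part, hence is interior to the
       cut strip, where [Qext] is already holomorphic. *)
    assert (Cz : cut_strip z).
    { split; [unfold Im; lra|]. left. intros E. destruct z as [a b]. simpl in *. subst a.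
      unfold Rabs in Hz. destruct (Rcase_abs b).
      - apply N2. f_equal. lra.
      - apply N1. f_equal. exact Hz. }
    destruct (cut_open _ _ z Cz) as [r [r0 Hr]].
    exists r. split; [exact r0|]. exists Qext. split; [|reflexivity].
    apply Qext_holo. exact Hr.
Qed.
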